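(* Let $0<\beta<1$, $0<\alpha<n$, $\alpha+\beta<n$, $0<t<\infty$, $1<p<r<\infty$ and $1<q<s<\infty$ with $$\frac{\alpha+\beta}{n}=\frac{1}{p}-\frac{1}{r}=\frac{1}{q}-\frac{1}{s}.$$ Let $T_{\Omega,\alpha}$ denote the fractional integral operator with the rough kernel $\Omega$, where $\Omega$ satisfies $\Omega(\lambda x)=\Omega(x)$ for any $\lambda\in(0,\infty)$ and $x\in\mathbb{S}^{n-1}$, and $\int_{\mathbb{S}^{n-1}}\Omega(x)\,d\sigma(x)=0$. Let $b$ be a locally integrable function on $\mathbb{R}^n$. Then the following statements hold true. (a) Suppose that $\Omega$ is a Lipschitz function. If $b\in \mathrm{Lip}_\beta(\mathbb{R}^n)$, then the commutator $[b,T_{\Omega,\alpha}]$ is bounded from $(E_p^q)_t(\mathbb{R}^n)$ to $(E_r^s)_t(\mathbb{R}^n)$. (b) In addition, suppose that $\Omega$ is infinitely differentiable on an open set. If $[b,T_{\Omega,\alpha}]$ is bounded from $(E_p^q)_t(\mathbb{R}^n)$ to $(E_r^s)_t(\mathbb{R}^n)$, then $b\in \mathrm{Lip}_\beta(\mathbb{R}^n)$.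
   Context: $Q(x,\rho)$ denotes the cube in $\mathbb{R}^n$ centered at $x$ with side length $\rho>0$, and $|E|$ is the Lebesgue measure of $E$. $\mathbb{S}^{n-1}=\{x\in\mathbb{R}^n:|x|=1\}$ is the unit sphere and $d\sigma$ its area measure. ''$\Omega$ is a Lipschitz function'' means that there is a constant $C$ with $|\Omega(x)-\Omega(y)|\le C|x-y|$ for all $x,y\in\mathbb{S}^{n-1}$. Fractional integral operator with rough kernel: for any locally integrable function $f$ and any $x\in\mathbb{R}^n$, $$T_{\Omega,\alpha}(f)(x)=\int_{\mathbb{R}^n}\frac{\Omega(x-y)}{|x-y|^{n-\alpha}}f(y)\,dy .$$ Commutator: $[b,T_{\Omega,\alpha}]f(x)=b(x)T_{\Omega,\alpha}f(x)-T_{\Omega,\alpha}(bf)(x)$. Slice space: for $0<t<\infty$ and $1<p,q<\infty$, $(E_p^q)_t(\mathbb{R}^n)$ is the set of all locally $p$-integrable functions $f$ on $\mathbb{R}^n$ with $$\|f\|_{(E_p^q)_t(\mathbb{R}^n)}=\left(\int_{\mathbb{R}^n}\left(\frac{1}{|Q(x,t)|}\int_{Q(x,t)}|f(y)|^p\,dy\right)^{q/p}dx\right)^{1/q}<\infty .$$ Bounded from $(E_p^q)_t(\mathbb{R}^n)$ to $(E_r^s)_t(\mathbb{R}^n)$ means that there is a constant $C$ with $\|[b,T_{\Omega,\alpha}]f\|_{(E_r^s)_t(\mathbb{R}^n)}\le C\|f\|_{(E_p^q)_t(\mathbb{R}^n)}$ for all $f\in(E_p^q)_t(\mathbb{R}^n)$.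 For $0<\beta<1$, $b\in\mathrm{Lip}_\beta(\mathbb{R}^n)$ means that there is a constant $C>0$ such that $|b(x)-b(y)|\le C|x-y|^\beta$ for every $x,y\in\mathbb{R}^n$.
   Formalization: In (b) Ω is assumed not identically zero on the unit sphere (for Ω = 0 the commutator vanishes and (b) fails), and b ∈ Lip_β is understood up to a null set: b agrees almost everywhere with a function satisfying the Lip_β bound. *)

(* Defs.v *)
From HB Require Import structures.
From mathcomp Require Import all_boot all_order all_algebra.
From mathcomp Require Import all_classical all_reals all_analysis.
From mathcomp Require Import measurable_realfun.
Set Implicit Arguments.
Unset Strict Implicit.
Unset Printing Implicit Defensive.
Import Order.TTheory GRing.Theory Num.Theory.
Import numFieldNormedType.Exports.

Local Open Scope classical_set_scope.
Local Open Scope ring_scope.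

(* R^n is 'rV[R]_n.  The library norm `|x| on it is the sup norm; it is only
   used through the topology it induces. *)

Section measurable_rV.
Context {R : realType} {n : nat}.

Let coord (i : 'I_n) (x : 'rV[R]_n) : measurableTypeR R := x 0 i.

Let rV_set0 : g_sigma_preimage coord set0.
Proof. exact: sigma_algebra0. Qed.

Let rV_setC A : g_sigma_preimage coord A -> g_sigma_preimage coord (~` A).
Proof. exact: sigma_algebraC. Qed.

Let rV_bigcup (F : (set 'rV[R]_n)^nat) :
  (forall i, g_sigma_preimage coord (F i)) ->
  g_sigma_preimage coord (\bigcup_i (F i)).
Proof. exact: sigma_algebra_bigcup. Qed.

(* The sigma-algebra generated by the coordinates, i.e. the Borel sets. *)
HB.instance Definition _ := @isMeasurable.Build default_measure_display
  'rV[R]_n (g_sigma_preimage coord) rV_set0 rV_setC rV_bigcup.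

Lemma measurable_coord (i : 'I_n) :
  measurable_fun [set: 'rV[R]_n] (fun x => x 0 i : measurableTypeR R).
Proof.
move=> _ Y mY; rewrite setTI; apply: sub_sigma_algebra => /=.
rewrite -bigcup_seq/=; exists i => /=; first by rewrite mem_index_enum.
by exists Y => //; rewrite setTI.
Qed.

Lemma measurable_fun_rVP d (T : measurableType d) (f : T -> 'rV[R]_n) :
  measurable_fun [set: T] f <->
  forall i, measurable_fun [set: T] (fun x => f x 0 i : measurableTypeR R).
Proof.
split=> [mf i|mf].
  exact: (measurableT_comp (measurable_coord i) mf).
have -> : measurable_fun [set: T] f <->
    g_sigma_preimage (fun i => coord i \o f) `<=` measurable.
  rewrite g_sigma_preimage_comp; split=> [mf' A [/= C preC <-]|prefS].
    exact: mf'.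
  by move=> _ A mA; apply: prefS; exists A.
apply: smallest_sub; first exact: sigma_algebra_measurable.
elim/big_ind: _ => // [A B hA hB X []|i _ A [B mB <-]]; [exact: hA|exact: hB|].
exact: mf.
Qed.

End measurable_rV.

Section lebesgue_measure_step.
Context {R : realType} {n : nat}.
Variable mu : {sigma_finite_measure set 'rV[R]_n -> \bar R}.

Definition rV_cons (xv : measurableTypeR R * 'rV[R]_n) : 'rV[R]_n.+1 :=
  row_mx (const_mx xv.1 : 'rV[R]_1) xv.2.

Definition rV_uncons (x : 'rV[R]_n.+1) : measurableTypeR R * 'rV[R]_n :=
  (x 0 0, \row_i x 0 (lift ord0 i)).

Lemma rV_consK : cancel rV_cons rV_uncons.
Proof.
move=> [x v]; congr pair => /=.
  have -> : (0 : 'I_n.+1) = lshift n (0 : 'I_1) by exact/val_inj.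
  by rewrite /rV_cons (row_mxEl (const_mx x : 'rV[R]_1) v) mxE.
apply/rowP => i; rewrite mxE.
have -> : lift ord0 i = rshift 1 i by exact/val_inj.
by rewrite /rV_cons (row_mxEr (const_mx x : 'rV[R]_1) v).
Qed.

Lemma rV_unconsK : cancel rV_uncons rV_cons.
Proof.
move=> x; apply/rowP => i; rewrite /rV_cons /rV_uncons /=.
case: (unliftP ord0 i) => [j ->|->].
  have -> : lift ord0 j = rshift 1 j by exact/val_inj.
  rewrite (row_mxEr (const_mx (x 0 0) : 'rV[R]_1)) mxE; congr (x 0 _).
  exact/val_inj.
have -> : (ord0 : 'I_n.+1) = lshift n (0 : 'I_1) by exact/val_inj.
rewrite (row_mxEl (const_mx _ : 'rV[R]_1)) mxE; congr (x 0 _).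
exact/val_inj.
Qed.

Lemma measurable_rV_cons : measurable_fun [set: _] rV_cons.
Proof.
apply/measurable_fun_rVP => i.
case: (unliftP ord0 i) => [j ->|->].
  rewrite (_ : (fun _ => _) = (fun v : 'rV[R]_n => v 0 j : measurableTypeR R) \o snd).
    by apply: measurableT_comp; [exact: measurable_coord|exact: measurable_snd].
  apply/funext => xv /=; rewrite -[in RHS](rV_consK xv) /= mxE.
  by [].
rewrite (_ : (fun _ => _) = fst); first exact: measurable_fst.
by apply/funext => xv; rewrite -[in RHS](rV_consK xv).
Qed.

Lemma measurable_rV_uncons : measurable_fun [set: _] rV_uncons.
Proof.
apply/measurable_fun_pairP; split => /=; first exact: measurable_coord.
apply/measurable_fun_rVP => i.
rewrite (_ : (fun _ => _) = fun x : 'rV[R]_n.+1 => x 0 (lift ord0 i)).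
  exact: measurable_coord.
by apply/funext => x /=; rewrite mxE.
Qed.

Definition lebesgue_step : set 'rV[R]_n.+1 -> \bar R :=
  pushforward (lebesgue_measure \x mu)%E rV_cons.

Let mcons := measurable_rV_cons.

Let step0 : lebesgue_step set0 = 0%E.
Proof. by rewrite /lebesgue_step /pushforward preimage_set0 measure0. Qed.

Let step_ge0 A : (0 <= lebesgue_step A)%E.
Proof. exact: measure_ge0. Qed.

Let step_sigma_additive : semi_sigma_additive lebesgue_step.
Proof. exact: measure_semi_sigma_additive. Qed.

HB.instance Definition _ := isMeasure.Build _ _ _ lebesgue_step
  step0 step_ge0 step_sigma_additive.

Let step_sigma_finite : sigma_finite setT lebesgue_step.
Proof.
have /sigma_finiteP[F [TF ndF Foo]] := sigma_finiteT (@lebesgue_measure R).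
have /sigma_finiteP[G [TG ndG Goo]] := sigma_finiteT mu.
exists (fun k => rV_uncons @^-1` (F k `*` G k)).
  apply/esym/seteqP; split=> // x _.
  have [k _ Fk] : (\bigcup_k F k) (x 0 0) by rewrite -TF.
  have [l _ Gl] : (\bigcup_k G k) (rV_uncons x).2 by rewrite -TG.
  exists (maxn k l) => //; split=> /=.
    by move: Fk; exact/subsetPset/ndF/leq_maxl.
  by move: Gl; exact/subsetPset/ndG/leq_maxr.
move=> k; have [mF Ffin] := Foo k; have [mG Gfin] := Goo k; split.
  rewrite -[X in measurable X]setTI; apply: measurable_rV_uncons => //.
  exact: measurableX.
rewrite /lebesgue_step /pushforward -comp_preimage.
rewrite (_ : rV_uncons \o rV_cons = id); last exact/funext/rV_consK.
by rewrite preimage_id product_measure1E// lte_mul_pinfty// ge0_fin_numE.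
Qed.

HB.instance Definition _ := Measure_isSigmaFinite.Build _ _ _ lebesgue_step
  step_sigma_finite.

End lebesgue_measure_step.

(* The n-fold product of the one-dimensional Lebesgue measure. *)
Fixpoint lebesgueRn {R : realType} (n : nat) :
    {sigma_finite_measure set 'rV[R]_n -> \bar R} :=
  match n with
  | 0 => dirac (0 : 'rV[R]_0)
  | n'.+1 => lebesgue_step (lebesgueRn n')
  end.

Lemma lebesgueRn_box (R : realType) (n : nat)
    (A : 'I_n -> set (measurableTypeR R)) :
  (forall i, measurable (A i)) ->
  lebesgueRn n [set x : 'rV[R]_n | forall i, A i (x 0 i)] =
  (\prod_(i < n) lebesgue_measure (A i))%E.
Proof.
elim: n A => [|n IHn] A mA.
  rewrite big_ord0 /= diracE mem_set//=.
  by case.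
rewrite big_ord_recl -IHn; last by move=> i; exact: mA.
rewrite -product_measure1E//; last first.
  rewrite (_ : mkset _ = \bigcap_(i in [set: 'I_n])
      ((fun x : 'rV[R]_n => x 0 i : measurableTypeR R) @^-1` A (lift ord0 i))).
    apply: (@fin_bigcap_measurable _ 'rV[R]_n) => // i _.
    by rewrite -[X in measurable X]setTI; exact: measurable_coord.
  by apply/seteqP; split=> [x Ax i _|x Ax i]; exact: Ax.
rewrite /= /lebesgue_step /pushforward; congr (_ _).
have headE (y : measurableTypeR R * 'rV[R]_n) : rV_cons y 0 0 = y.1.
  by rewrite -[in RHS](rV_consK y).
have tailE (y : measurableTypeR R * 'rV[R]_n) i :
    rV_cons y 0 (lift ord0 i) = y.2 0 i.
  by rewrite -[in RHS](rV_consK y) [RHS]mxE.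
apply/seteqP; split=> y /=.
  move=> Ay; split=> [|i]; first by rewrite -headE; exact: Ay.
  by rewrite -tailE; exact: Ay.
move=> [A0 A1] i; case: (unliftP ord0 i) => [j ->|->]; first by rewrite tailE.
by rewrite headE.
Qed.

Definition enorm {R : realType} {n : nat} (x : 'rV[R]_n) : R :=
  Num.sqrt (\sum_(i < n) x 0 i ^+ 2).

Definition cube {R : realType} {n : nat} (x : 'rV[R]_n) (rho : R) :
    set 'rV[R]_n :=
  [set y | forall i, `|y 0 i - x 0 i| <= rho / 2].

Definition sphere {R : realType} {n : nat} : set 'rV[R]_n :=
  [set x | enorm x = 1].

Section sphere_measure.
Context {R : realType} {n : nat}.

Definition radial_proj (x : 'rV[R]_n) : 'rV[R]_n := (enorm x)^-1 *: x.

Definition punctured_ball : set 'rV[R]_n := [set x | 0 < enorm x <= 1].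

Lemma measurable_enorm : measurable_fun [set: 'rV[R]_n] (@enorm R n).
Proof.
rewrite (_ : @enorm R n = fun x => (\sum_(i < n) x 0 i ^+ 2) `^ 2^-1).
  apply: (measurableT_comp (measurable_powR _)).
  apply: measurable_sum => i; apply: measurable_funX.
  exact: measurable_coord.
apply/funext => x; rewrite powR12_sqrt//.
by apply: sumr_ge0 => i _; exact: sqr_ge0.
Qed.

Lemma measurable_punctured_ball : measurable punctured_ball.
Proof.
rewrite (_ : punctured_ball = @enorm R n @^-1` `]0, 1]).
  by rewrite -[X in measurable X]setTI; exact: measurable_enorm.
by apply/seteqP; split=> x; rewrite /punctured_ball /= in_itv.
Qed.

Lemma measurable_radial_proj : measurable_fun [set: 'rV[R]_n] radial_proj.
Proof.
apply/measurable_fun_rVP => i.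
rewrite (_ : (fun _ => _) = fun x : 'rV[R]_n => enorm x `^ (-1) * x 0 i).
  apply: measurable_funM; last exact: measurable_coord.
  exact: (measurableT_comp (measurable_powR _) measurable_enorm).
by apply/funext => x; rewrite mxE powR_inv1// sqrtr_ge0.
Qed.

(* The surface measure of the unit sphere through polar coordinates:
   sigma(A) = n |{rho x : 0 < rho <= 1, x in A}|. *)
Definition sphere_measure (A : set 'rV[R]_n) : \bar R :=
  (n%:R%:E * lebesgueRn n (radial_proj @^-1` A `&` punctured_ball))%E.

Let sphere_measure0 : sphere_measure set0 = 0%E.
Proof. by rewrite /sphere_measure preimage_set0 set0I measure0 mule0. Qed.

Let sphere_measure_ge0 A : (0 <= sphere_measure A)%E.
Proof. by rewrite /sphere_measure mule_ge0// lee_fin. Qed.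

Let mproj := measurable_radial_proj.

Let sphere_measure_sigma_additive : semi_sigma_additive sphere_measure.
Proof.
exact: (@measure_semi_sigma_additive _ _ _
  (mscale (n%:R)%:nng (pushforward
    (mrestr (lebesgueRn n) measurable_punctured_ball) radial_proj))).
Qed.

HB.instance Definition _ := isMeasure.Build _ _ _ sphere_measure
  sphere_measure0 sphere_measure_ge0 sphere_measure_sigma_additive.

End sphere_measure.

Section definitions.
Context {R : realType} {n : nat}.
Implicit Types (f b Omega : 'rV[R]_n -> R) (F : 'rV[R]_n -> \bar R).
Local Notation mu := (@lebesgueRn R n).

(* Lebesgue measurability: the library sigma-algebra on 'rV[R]_n is the Borel
   one, so a Lebesgue measurable function is one that agrees almost everywhere
   with a Borel function. *)
Definition lebesgue_measurable f : Prop :=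
  exists2 g : 'rV[R]_n -> R, measurable_fun [set: 'rV[R]_n] g &
    \forall x \ae mu, f x = g x.

Definition loc_p_integrable (p : R) f : Prop :=
  lebesgue_measurable f /\
  forall K : set 'rV[R]_n, compact K ->
    (\int[mu]_(x in K) (`|f x| `^ p)%:E < +oo)%E.

Definition loc_integrable f : Prop :=
  lebesgue_measurable f /\
  forall K : set 'rV[R]_n, compact K -> (\int[mu]_(x in K) `|f x|%:E < +oo)%E.

(* (E_p^q)_t: p is the inner (local) exponent, q the outer one.  F is \bar R
   valued so that the norm applies directly to frac_int and frac_commutator. *)
Definition slice_norm (t p q : R) F : \bar R :=
  ((\int[mu]_x (((fine (mu (cube x t)))^-1)%:E *
                \int[mu]_(y in cube x t) (`|F y| `^ p)) `^ (q / p)) `^ q^-1)%E.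

Definition slice_space (t p q : R) : set ('rV[R]_n -> R) :=
  [set f | loc_p_integrable p f /\ (slice_norm t p q (EFin \o f) < +oo)%E].

(* The integral is kept in \bar R: it is finite exactly when it converges
   absolutely, so divergence cannot pass for a finite value.  At y = x the
   quotient has the junk value 0, on a null set. *)
Definition frac_int (Omega : 'rV[R]_n -> R) (alpha : R) f (x : 'rV[R]_n) :
    \bar R :=
  (\int[mu]_y (Omega (x - y) / enorm (x - y) `^ (n%:R - alpha) * f y)%:E)%E.

Definition frac_commutator b Omega (alpha : R) f (x : 'rV[R]_n) : \bar R :=
  ((b x)%:E * frac_int Omega alpha f x
   - frac_int Omega alpha (fun y => (b y * f y)%R) x)%E.

Definition slice_bounded (T : ('rV[R]_n -> R) -> 'rV[R]_n -> \bar R)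
    (t p q r s : R) : Prop :=
  exists C : R, forall f, slice_space t p q f ->
    (slice_norm t r s (T f) <= C%:E * slice_norm t p q (EFin \o f))%E.

Definition lipschitz_on_sphere Omega : Prop :=
  exists C : R, forall x y, sphere x -> sphere y ->
    `|Omega x - Omega y| <= C * enorm (x - y).

(* Membership in Lip_beta of a locally integrable function, which is given only
   up to a null set: some representative satisfies the pointwise bound. *)
Definition in_Lip (beta : R) b : Prop :=
  exists2 b' : 'rV[R]_n -> R, \forall x \ae mu, b x = b' x &
    exists2 C : R, 0 < C &
      forall x y, `|b' x - b' y| <= C * enorm (x - y) `^ beta.

Definition iter_partial (l : seq 'I_n) (f : 'rV[R]_n -> R^o) :
    'rV[R]_n -> R^o :=
  foldr (fun i g => 'D_(delta_mx 0 i) g) f l.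

Definition smooth_on (U : set 'rV[R]_n) (f : 'rV[R]_n -> R^o) : Prop :=
  forall (l : seq 'I_n) x, U x -> differentiable (iter_partial l f) x.

End definitions.

(* Main.v *)
(* (a) Almost everywhere |[b,T]f| <= C I_(alpha+beta) |f|, so it is enough to
   bound the Riesz potential I_gam between slice spaces.  On Q(x,t) the part of
   f in Q(x,2t) is handled by the Hardy-Littlewood-Sobolev inequality
   L^p -> L^r, and the remaining part is dominated by a Riesz potential, at x,
   of the means of f over cubes of side t, to which the same inequality
   L^q -> L^s applies.
   The Hardy-Littlewood-Sobolev inequality itself is obtained without maximal
   functions: splitting the kernel dyadically at a radius depending on the level
   lam makes the far part at most lam, truncating f at a height depending on lam
   does the same to the near part of the truncation, and Chebyshev's inequality
   for what is left is summed over dyadic levels lam.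

   (b) The kernel has a constant sign on Q(x0,l) - Q(x0 - A l z0, l), where
   Omega(z0) <> 0 and A is large.  Testing the commutator on the indicator of
   the part of Q(x0 - A l z0, l) where b is at most (at least) its median m
   bounds the positive (negative) part of b - m on Q(x0,l), which gives
   int_Q(x0,l) |b - m| <= C l^(n+beta), and hence a Hoelder representative of b
   by Campanato's argument. *)

Require Import Defs.
From mathcomp Require Import all_boot all_order all_algebra.
From mathcomp Require Import all_classical all_reals all_analysis.
From mathcomp Require Import measurable_realfun.
From mathcomp Require Import ring lra.
Import Order.TTheory GRing.Theory Num.Theory.
Import numFieldNormedType.Exports.
Local Open Scope classical_set_scope.
Local Open Scope ring_scope.
Set Implicit Arguments.
Unset Strict Implicit.
Unset Printing Implicit Defensive.

(** * Lower integrals *)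

(** The operator takes values in [\bar R], so [b(x) Tf(x) - T(bf)(x)] becomes a single integral
    against [b(x) - b(y)] only where both terms converge absolutely. The pointwise bound in (a)
    therefore presupposes that [I_alpha |f|] is finite almost everywhere. This comes from the slice
    estimate for [I_alpha] itself, with target exponents [r'] and [s'] fitted to [alpha] instead of
    [alpha + beta]. Kernels are estimated in the sup norm, whose balls are the cubes. The sup
    distance is at most the Euclidean one and the exponents are negative, so this only enlarges the
    kernel. In (b) the side [l] runs over all sizes while [t] is fixed, so no scaling argument
    applies to the slice norms. Hoelder's inequality on the support and the norm of an indicator
    produce powers of [min(l, t) ^ n], [(l + t) ^ n] and [t ^ (- n)], and the two exponent relations
    give all three the same exponent [1 + (alpha + beta) / n]. Since [min(l, t) (l + t) / t <= 2 l],
    only a power of [l] remains. *)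

Section lower_integral.
Context d (T : measurableType d) (R : realType).
Variable mu : {measure set T -> \bar R}.
Local Open Scope ereal_scope.
Import HBNNSimple.

(* The library integral of a nonnegative function is a supremum over the simple
   functions below it, hence monotone without any measurability; this matters
   for [frac_commutator b Omega alpha f], whose measurability is not assumed. *)
Lemma ae_le_integral_lower (f g : T -> \bar R) :
  (forall x, 0 <= f x) -> (forall x, 0 <= g x) ->
  {ae mu, forall x, f x <= g x} -> \int[mu]_x f x <= \int[mu]_x g x.
Proof.
move=> f0 g0 [N [mN N0 sub]].
rewrite [leLHS]ge0_integralTE// [leRHS]ge0_integralTE//.
apply: ge_ereal_sup => _ [h /= hf <-].
(* [h] lies below [f] only and may exceed [g] on the null set [N]; [k] is [h] set to 0 there, which
   puts it below [g] and keeps its integral. *)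
pose k := proj_nnsfun h (measurableC mN).
apply: le_ereal_sup_tmp; exists (sintegral mu k); last first.
  rewrite -2!integralT_nnsfun; apply: ae_ge0_le_integral => //.
  - by move=> x _; rewrite lee_fin.
  - exact/measurable_EFinP.
  - by move=> x _; rewrite lee_fin.
  - exact/measurable_EFinP.
  exists N; split => // x /= xk; apply: contrapT => Nx; apply: xk => _.
  by rewrite /k /= /mindic indicE mem_set// mulr1.
exists k => // x; rewrite /k /= /mindic indicE.
case: (boolP (x \in _)) => [xN|_]; last by rewrite mulr0.
rewrite mulr1; apply: le_trans (hf x) _; apply: contrapT => fg.
by move: xN; rewrite inE; apply; exact: sub.
Qed.

Lemma le_integral_lower (D : set T) (f g : T -> \bar R) :
  (forall x, D x -> 0 <= f x) -> (forall x, D x -> f x <= g x) ->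
  \int[mu]_(x in D) f x <= \int[mu]_(x in D) g x.
Proof.
move=> f0 fg; rewrite 2!(integral_mkcond D); apply: ae_le_integral_lower.
- by move=> x; apply: erestrict_ge0.
- by move=> x; apply: erestrict_ge0 => y Dy; exact: le_trans (f0 _ Dy) (fg _ Dy).
- by apply: aeW => x; apply: lee_restrict.
Qed.

Lemma ae_le_integral_lower_in (D : set T) (f g : T -> \bar R) :
  (forall x, 0 <= f x) -> (forall x, 0 <= g x) ->
  {ae mu, forall x, f x <= g x} ->
  \int[mu]_(x in D) f x <= \int[mu]_(x in D) g x.
Proof.
move=> f0 g0 fg; rewrite 2!(integral_mkcond D); apply: ae_le_integral_lower.
- by move=> x; apply: erestrict_ge0.
- by move=> x; apply: erestrict_ge0.
- by apply: filterS fg => x fgx; rewrite !patchE; case: ifP.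
Qed.

Lemma ge0_le_integral_subset (A B : set T) (f : T -> \bar R) :
  (forall x, 0 <= f x) -> A `<=` B ->
  \int[mu]_(x in A) f x <= \int[mu]_(x in B) f x.
Proof.
move=> f0 AB; rewrite (integral_mkcond A) (integral_mkcond B).
apply: le_integral_lower => x _; first exact: erestrict_ge0.
rewrite !patchE; case: ifPn => [/set_mem/AB xB|_]; first by rewrite mem_set.
by case: ifP.
Qed.

(** Monotonicity is applied to the positive and negative parts. This moves the signed integrals in
    [frac_int] from a Lebesgue measurable function to a Borel representative. *)
Lemma ae_eq_integral_lower_in (D : set T) (f g : T -> \bar R) :
  {ae mu, forall x, f x = g x} ->
  \int[mu]_(x in D) f x = \int[mu]_(x in D) g x.
Proof.
move=> fg; rewrite integralE [RHS]integralE; congr (_ - _).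
  by apply/eqP; rewrite eq_le; apply/andP; split;
    apply: ae_le_integral_lower_in => //; apply: filterS fg => x e;
    rewrite !funeposE e.
by apply/eqP; rewrite eq_le; apply/andP; split;
  apply: ae_le_integral_lower_in => //; apply: filterS fg => x e;
  rewrite !funenegE e.
Qed.

(** Multiplying a simple function below [c f] by [c^-1] gives one below [f]. The function may be
    non-measurable, as happens for potentials formed with an arbitrary distance [u] in
    [hardy_littlewood_sobolev]. *)
Lemma le_integral_lowerZl (c : R) (f : T -> \bar R) : (0 < c)%R ->
  (forall x, 0 <= f x) ->
  \int[mu]_x (c%:E * f x) <= c%:E * \int[mu]_x f x.
Proof.
move=> c0 f0; rewrite [leLHS]ge0_integralTE//; last first.
  by move=> x; rewrite mule_ge0// lee_fin ltW.
apply: ge_ereal_sup => _ [h /= hf <-].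
have ci0 : (0 <= c^-1)%R by rewrite invr_ge0 ltW.
rewrite muleC -lee_pdivrMr// muleC -integralT_nnsfun -ge0_integralZl//; last 2 first.
- exact/measurable_EFinP.
- by move=> x _; rewrite lee_fin.
apply: le_integral_lower => x _; first by rewrite mule_ge0// lee_fin.
by rewrite muleC lee_pdivrMr// muleC.
Qed.

Lemma nneseries_le_partial (u : nat -> \bar R) (c : \bar R) :
  (forall i, 0 <= u i) -> (forall N, \sum_(0 <= i < N) u i <= c) ->
  \sum_(i <oo) u i <= c.
Proof.
move=> u0 uc; apply: lime_le; first exact: is_cvg_nneseries.
exact: nearW.
Qed.

Lemma nneseries_ge_term (u : nat -> \bar R) (j : nat) :
  (forall i, 0 <= u i) -> u j <= \sum_(i <oo) u i.
Proof.
move=> u0; apply: le_trans (nneseries_lim_ge (P := xpredT) j.+1 _); last first.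
  by move=> *; exact: u0.
by rewrite big_nat_recr//= leeDr// sume_ge0.
Qed.

End lower_integral.

(** * Cubes of R^n *)

Section euclidean_cubes.
Context {R : realType} {n : nat}.
Local Notation mu := (@lebesgueRn R n).
Implicit Types (x y : 'rV[R]_n) (rho : R).

Lemma rV_norm_le x e : 0 <= e -> (`|x| <= e) = [forall i, `|x 0 i| <= e].
Proof.
move=> e0; apply/idP/forallP => [xe i|xe].
  apply: le_trans xe; rewrite /Num.norm/= mx_normrE.
  by rewrite (bigD1 (0, i))//= le_max lexx.
rewrite /Num.norm/= mx_normrE; elim/big_ind: _ => //.
  by move=> a b ae be; rewrite ge_max ae.
by move=> [i j] _ /=; rewrite ord1.
Qed.

Lemma coord_le_norm x i : `|x 0 i| <= `|x|.
Proof. by have := lexx `|x|; rewrite {1}rV_norm_le// => /forallP. Qed.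

Lemma cubeE x rho : 0 <= rho -> cube x rho = [set y | `|y - x| <= rho / 2].
Proof.
move=> rho0; apply/seteqP; split => y /=; rewrite /cube/= rV_norm_le ?divr_ge0//.
  by move=> xy; apply/forallP => i; rewrite !mxE.
by move=> /forallP xy i; have := xy i; rewrite !mxE.
Qed.

Lemma cube_sym x y rho : cube x rho y -> cube y rho x.
Proof. by move=> xy i; rewrite distrC. Qed.

Lemma cubeIcc x rho :
  cube x rho = [set y | forall i, `[x 0 i - rho / 2, x 0 i + rho / 2]%classic (y 0 i)].
Proof.
by apply/seteqP; split => y /= xy i; have := xy i; rewrite /= ler_distl in_itv/=.
Qed.

Lemma measurable_cube x rho : measurable (cube x rho).
Proof.
rewrite (_ : cube x rho = \bigcap_(i in [set: 'I_n])
    ((fun y : 'rV[R]_n => y 0 i : measurableTypeR R)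
       @^-1` `[x 0 i - rho / 2, x 0 i + rho / 2]%classic)).
  apply: (@fin_bigcap_measurable _ 'rV[R]_n) => // i _.
  by rewrite -[X in measurable X]setTI; exact: measurable_coord.
by rewrite cubeIcc; apply/seteqP; split=> [y Ay i _|y Ay i]; exact: Ay.
Qed.
Hint Resolve measurable_cube : core.

Lemma mu_cube x rho : 0 <= rho -> mu (cube x rho) = (rho ^+ n)%:E.
Proof.
move=> rho0; rewrite cubeIcc.
rewrite (lebesgueRn_box (A := fun i => `[x 0 i - rho / 2, x 0 i + rho / 2]%classic))//.
under eq_bigr do rewrite lebesgue_measure_itv/= lte_fin.
rewrite (eq_bigr (fun=> rho%:E)); last first.
  move=> i _; case: ifPn => [_|]; first by rewrite -EFinB; congr EFin; lra.
  by rewrite -leNgt => h; congr EFin; lra.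
by rewrite prodEFin prodr_const card_ord.
Qed.

Lemma mu_cube_le x rho : 0 <= rho -> (mu (cube x rho) <= (rho ^+ n)%:E)%E.
Proof. by move=> rho0; rewrite mu_cube. Qed.

Lemma integral_cube_cst x rho (c : \bar R) : 0 <= rho ->
  (\int[mu]_(y in cube x rho) c = c * (rho ^+ n)%:E)%E.
Proof.
move=> rho0; apply: etrans (integral_cst mu (measurable_cube x rho) c) _.
by congr (_ * _)%E; exact: mu_cube.
Qed.

Lemma compact_cube x rho : compact (cube x rho).
Proof.
rewrite cubeIcc.
apply: (@rV_compact R n (fun i => `[x 0 i - rho / 2, x 0 i + rho / 2]%classic)).
move=> i; exact: segment_compact.
Qed.

Lemma measurable_rV_norm : measurable_fun [set: 'rV[R]_n] (fun x => `|x|).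
Proof.
apply: (measurability (@RGenOInfty.G R)); first exact: RGenOInfty.measurableE.
move=> /= _ [_ [a ->] <-]; rewrite setTI.
have [a0|a0] := ltP a 0.
  rewrite (_ : _ @^-1` _ = setT)//; apply/seteqP; split => // x _ /=.
  by rewrite in_itv/= andbT (lt_le_trans a0).
rewrite (_ : _ @^-1` _ = ~` cube 0 (2 * a)); first exact: measurableC.
rewrite cubeE ?mulr_ge0//; apply/seteqP; split => x /=;
  by rewrite in_itv/= andbT subr0 (mulrC 2) mulfK// ltNge => /negP.
Qed.

Lemma measurable_rV_sub : measurable_fun [set: 'rV[R]_n * 'rV[R]_n]
  (fun z => z.1 - z.2).
Proof.
apply/measurable_fun_rVP => i.
rewrite (_ : (fun _ => _) = (fun z : 'rV[R]_n * 'rV[R]_n => z.1 0 i - z.2 0 i)); last first.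
  by apply/funext => z; rewrite !mxE.
apply: measurable_funB.
  exact: (measurableT_comp (measurable_coord i) measurable_fst).
exact: (measurableT_comp (measurable_coord i) measurable_snd).
Qed.

Lemma measurable_rV_dist : measurable_fun [set: 'rV[R]_n * 'rV[R]_n]
  (fun z => `|z.1 - z.2|).
Proof. exact: (measurableT_comp measurable_rV_norm measurable_rV_sub). Qed.

Lemma measurable_cube_graph rho :
  measurable [set z : 'rV[R]_n * 'rV[R]_n | cube z.1 rho z.2].
Proof.
rewrite (_ : [set _ | _] = \bigcap_(i in [set: 'I_n])
    ((fun z : 'rV[R]_n * 'rV[R]_n => `|z.2 0 i - z.1 0 i|)
       @^-1` `]-oo, rho / 2]%classic)).
  apply: fin_bigcap_measurable => // i _.
  rewrite -[X in measurable X]setTI; apply: measurableT_comp => //.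
  apply: measurable_funB.
    exact: (measurableT_comp (measurable_coord i) measurable_snd).
  exact: (measurableT_comp (measurable_coord i) measurable_fst).
by apply/seteqP; split=> z zi i; have := zi i; rewrite /= in_itv/= => h //; exact: h.
Qed.

Section cube_fubini.
Local Open Scope ereal_scope.
Variables (rho : R) (f : 'rV[R]_n -> \bar R).
Hypotheses (f0 : forall x, 0 <= f x) (mf : measurable_fun setT f).

Let C := [set z : 'rV[R]_n * 'rV[R]_n | cube z.1 rho z.2].

Let ker (w : 'rV[R]_n -> \bar R) (z : 'rV[R]_n * 'rV[R]_n) :=
  w z.1 * (f z.2 * (\1_C z)%:E).

Let cubeint (g : 'rV[R]_n -> \bar R) x : \int[mu]_(y in cube x rho) g y =
  \int[mu]_y (g y * (\1_C (x, y))%:E).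
Proof.
rewrite integral_mkcond; apply: eq_integral => y _.
rewrite patchE indicE; case: ifPn => xy.
  by rewrite mem_set ?mule1//; exact: set_mem xy.
by rewrite memNset ?mule0//= => xy'; move/negP: xy; apply; exact/mem_set.
Qed.

Let mker w : measurable_fun setT w -> measurable_fun setT (ker w).
Proof.
move=> mw; apply: emeasurable_funM.
  exact: (measurableT_comp mw measurable_fst).
apply: emeasurable_funM; first exact: (measurableT_comp mf measurable_snd).
apply/measurable_EFinP/measurable_indic; exact: measurable_cube_graph.
Qed.

Let ker0 w : (forall x, 0 <= w x) -> forall z, 0 <= ker w z.
Proof. by move=> w0 z; rewrite !mule_ge0// lee_fin. Qed.

Lemma measurable_cube_integral :
  measurable_fun setT (fun x => \int[mu]_(y in cube x rho) f y).
Proof.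
rewrite [X in measurable_fun _ X](_ : _ = fubini_F mu (ker (cst 1))).
  apply: measurable_fun_fubini_tonelli_F; last exact: ker0.
  by apply: mker.
apply/funext => x; rewrite cubeint /fubini_F; apply: eq_integral => y _.
by rewrite /ker/= mul1e.
Qed.

(** Tonelli's theorem for the indicator of [cube x rho y], which is symmetric in [x] and [y]. It
    moves a sliding average from one factor onto the other. *)
Lemma cube_fubini (w : 'rV[R]_n -> \bar R) :
  (forall x, 0 <= w x) -> measurable_fun setT w ->
  \int[mu]_x (w x * \int[mu]_(y in cube x rho) f y) =
  \int[mu]_y (f y * \int[mu]_(x in cube y rho) w x).
Proof.
move=> w0 mw; have m1C x : measurable_fun setT (fun y => (\1_C (x, y))%:E : \bar R).
  apply/measurable_EFinP; apply: (measurableT_comp _ (pair1_measurable x)) => //.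
  apply: measurable_indic; exact: measurable_cube_graph.
have CE x y : \1_C (x, y) = \1_C (y, x) :> R.
  rewrite !indicE; congr (nat_of_bool _)%:R.
  by apply/idP/idP => /set_mem/= h; apply/mem_set/cube_sym.
transitivity (\int[mu]_x \int[mu]_y ker w (x, y)).
  apply: eq_integral => x _; rewrite cubeint -ge0_integralZl//.
    exact: emeasurable_funM.
  by move=> y _; rewrite mule_ge0// lee_fin.
rewrite (@fubini_tonelli _ _ 'rV[R]_n 'rV[R]_n R mu mu _ (mker mw) (ker0 w0)).
apply: eq_integral => y _; rewrite cubeint -ge0_integralZl//.
- by apply: eq_integral => x _; rewrite /ker/= muleCA CE.
- exact: emeasurable_funM.
- by move=> x _; rewrite mule_ge0// lee_fin.
Qed.

Lemma integral_cube_integral : (0 <= rho)%R ->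
  \int[mu]_x \int[mu]_(y in cube x rho) f y = (rho ^+ n)%:E * \int[mu]_y f y.
Proof.
move=> rho0.
have := @cube_fubini (cst 1) (fun=> lee01) (measurable_cst _).
under eq_integral do rewrite mul1e.
move=> ->; under eq_integral do rewrite integral_cube_cst// mul1e.
by rewrite ge0_integralZr// ?lee_fin ?exprn_ge0// muleC.
Qed.

End cube_fubini.

(** The sigma-algebra comes from the coordinates and not from the topology, so an open set is
    exhausted by countably many cubes: those with rational centre and side [1 / (k + 1)] that lie in
    it, enumerated through [pickle]. *)
Lemma open_measurable_rV (U : set 'rV[R]_n) : open U -> measurable U.
Proof.
move=> oU; pose c (q : 'rV[rat]_n) : 'rV[R]_n := map_mx ratr q.
pose B k : set 'rV[R]_n := if unpickle k is Some qk then
  if `[<cube (c qk.1) (qk.2.+1%:R^-1) `<=` U>] then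
    cube (c qk.1) (qk.2.+1%:R^-1) else set0 else set0.
rewrite (_ : U = \bigcup_k B k).
  apply: bigcup_measurable => k _; rewrite /B.
  by case: unpickle => [qk|//]; case: ifP.
apply/seteqP; split => [x Ux|x [k _]]; last first.
  by rewrite /B; case: unpickle => [qk|//]; case: ifPn => [/asboolP|//]; exact.
have /nbhs_ballP[e /= e0 xeU] : nbhs x U by exact: open_nbhs_nbhs.
have [k ke] : exists k : nat, k.+1%:R^-1 < e.
  have [k _ ke] := near_infty_natSinv_lt (PosNum e0).
  by exists k; apply: ke => /=.
(* Half the side of the cube sought: a rational centre this close to [x] in each coordinate has [x]
   in its cube, and all points of that cube are then within the full side, hence within [e], of
   [x]. *)
have k0 : (0 : R) < k.+1%:R^-1 / 2 by rewrite divr_gt0.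
have q_ i : {q : rat | `|x 0 i - ratr q| < k.+1%:R^-1 / 2}.
  apply: cid.
  have : x 0 i - k.+1%:R^-1 / 2 < x 0 i + k.+1%:R^-1 / 2 by move: k0; set h := _ / 2; lra.
  move=> /rat_in_itvoo[q]; rewrite in_itv/= => xq.
  by exists q; rewrite distrC ltr_distl.
pose qk := (\row_i sval (q_ i), k).
exists (pickle qk) => //; rewrite /B pickleK ifT; last first.
  apply/asboolP => y yq; apply: xeU.
  rewrite -ball_normE/= (le_lt_trans _ ke)// rV_norm_le//.
  apply/forallP => i; have := yq i; rewrite !mxE => yi.
  have := svalP (q_ i) => qi.
  apply: (le_trans (ler_distD (ratr (sval (q_ i))) _ _)).
  by rewrite [leRHS]splitr lerD//; [exact: ltW|rewrite distrC].
by move=> i; rewrite !mxE /=; apply: ltW; exact: (svalP (q_ i)).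
Qed.

Lemma continuous_measurable_rV (f : 'rV[R]_n -> R) :
  continuous f -> measurable_fun setT f.
Proof.
move=> cf; apply: (measurability (@RGenOpens.G R)).
  exact: RGenOpens.measurableE.
move=> /= _ [_ [a [b ->] <-]]; rewrite setTI.
apply: open_measurable_rV; move/continuousP : cf; apply; exact: interval_open.
Qed.

End euclidean_cubes.

(** * Powers, Hoelder's inequality and dyadic sums *)

Section powers.
Context {R : realType}.
Local Open Scope ereal_scope.

Lemma le_poweR (r : R) (x y : \bar R) : (0 <= r)%R -> 0 <= x -> x <= y ->
  x `^ r <= y `^ r.
Proof.
move=> r0 x0 xy; apply: (gt0_ler_poweR r0) => //; rewrite in_itv/= leey andbT//.
exact: le_trans xy.
Qed.

Lemma poweR_powRK (r : R) (x : \bar R) : (r != 0)%R -> 0 <= x ->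
  (x `^ r) `^ r^-1 = x.
Proof. by move=> r0 x0; rewrite -poweRrM mulfV// poweRe1. Qed.

Lemma powR_powRK (r : R) (x : R) : r != 0%R -> (0 <= x)%R ->
  ((x `^ r) `^ r^-1 = x)%R.
Proof. by move=> r0 x0; rewrite -powRrM mulfV// powRr1. Qed.

Lemma powR_powRVK (r : R) (x : R) : r != 0%R -> (0 <= x)%R ->
  ((x `^ r^-1) `^ r = x)%R.
Proof. by move=> r0 x0; rewrite -powRrM mulVf// powRr1. Qed.

Lemma poweR_powRVK (r : R) (x : \bar R) : (r != 0)%R -> 0 <= x ->
  (x `^ r^-1) `^ r = x.
Proof. by move=> r0 x0; rewrite -poweRrM mulVf// poweRe1. Qed.

(** The sum is at most twice the larger term. This crude constant avoids convexity, so exponents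
    below 1, such as [s / r] may be, are covered. *)
Lemma poweRD_le (r : R) (x y : \bar R) : (0 <= r)%R -> 0 <= x -> 0 <= y ->
  (x + y) `^ r <= (2 `^ r)%:E * (x `^ r + y `^ r).
Proof.
move=> r0; wlog yx : x y / y <= x.
  by move=> h x0 y0; case/orP: (le_total x y) => xy; [rewrite addeC (addeC (x `^ r))|]; apply: h.
move=> x0 y0; apply: (@le_trans _ _ ((2%:E * x) `^ r)).
  apply: le_poweR => //; first exact: adde_ge0.
  have -> : 2%:E * x = x + x.
    by rewrite -[2%R]/(1 + 1)%R EFinD ge0_muleDl ?lee_fin// !mul1e.
  exact: leeD2l.
by rewrite poweRM// poweR_EFin lee_wpmul2l ?leeDl ?poweR_ge0// lee_fin powR_ge0.
Qed.

End powers.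

Section holder.
Context d (T : measurableType d) (R : realType).
Variable mu : {measure set T -> \bar R}.
Local Open Scope ereal_scope.

(** When [x] exceeds [a], write [x = x ^ (1 - p) x ^ p] and use that the exponent [1 - p] is
    negative. *)
Lemma le_add_poweR (p a : R) (x : \bar R) : (1 < p)%R -> (0 < a)%R -> 0 <= x ->
  x <= a%:E + (a `^ (1 - p))%:E * x `^ p.
Proof.
move=> p1 a0 x0; have p0 : (0 < p)%R by rewrite (lt_trans _ p1).
case: x x0 => [x|_|//]; last first.
  rewrite poweRyr ?gt_eqF// gt0_muley ?lte_fin ?powR_gt0// addey// leey.
rewrite poweR_EFin -EFinM -EFinD 2!lee_fin => x0.
have [xa|ax] := leP x a; first by rewrite ler_wpDr// mulr_ge0// powR_ge0.
apply: ler_wpDl; first exact: ltW.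
rewrite -opprB powRN -(@mulr_powRB1 _ x p)// mulrCA.
rewrite ler_peMr// mulrC ler_pdivlMr ?powR_gt0// mul1r.
by apply: ge0_ler_powR; rewrite ?nnegrE ?subr_ge0// ltW.
Qed.

(* The factor 2 is immaterial and replaces Young's inequality by the trivial bound
   [x <= a + a^(1 - p) x^p]. *)
Lemma integral_le_holder (D : set T) (G : T -> \bar R) (p M N : R) :
  measurable D -> measurable_fun D G -> (forall x, 0 <= G x) ->
  (1 < p)%R -> (0 < M)%R -> (0 < N)%R -> mu D <= M%:E ->
  \int[mu]_(x in D) (G x `^ p) <= (N `^ p)%:E ->
  \int[mu]_(x in D) G x <= (2 * M `^ (1 - p^-1) * N)%:E.
Proof.
move=> mD mG G0 p1 M0 N0 DM GN; have p0 : (0 < p)%R by rewrite (lt_trans _ p1).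
(* The threshold that balances the two terms: [a M] and [a ^ (1 - p) N ^ p] both equal
   [M ^ (1 - 1/p) N]. *)
pose a := (N * M `^ (- p^-1))%R.
have a0 : (0 < a)%R by rewrite mulr_gt0// powR_gt0.
have mGp : measurable_fun D (fun x => G x `^ p).
  exact: (measurableT_comp (measurable_poweR p) mG).
apply: (@le_trans _ _ (\int[mu]_(x in D) (a%:E + (a `^ (1 - p))%:E * G x `^ p))).
  by apply: le_integral_lower => x _ //; exact: le_add_poweR.
rewrite ge0_integralD//; last 3 first.
- by move=> x _; rewrite lee_fin ltW.
- by move=> x _; rewrite mule_ge0 ?poweR_ge0// lee_fin powR_ge0.
- exact: emeasurable_funM.
rewrite integral_cst// ge0_integralZl//; last 2 first.
- by move=> x _; exact: poweR_ge0.
- by rewrite lee_fin powR_ge0.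
rewrite -mulrA mulrDl mul1r EFinD leeD//.
  apply: (@le_trans _ _ (a%:E * M%:E)); first by rewrite lee_pmul2l// lte_fin.
  rewrite -EFinM lee_fin /a powRD; last by rewrite (gt_eqF M0) implybT.
  by rewrite (powRr1 (ltW M0)) mulrAC -mulrA mulrC.
apply: (@le_trans _ _ ((a `^ (1 - p))%:E * (N `^ p)%:E)).
  by rewrite lee_pmul2l// lte_fin powR_gt0.
rewrite -EFinM lee_fin /a powRM ?powR_ge0 ?(ltW N0)// -powRrM mulrAC -powRD; last first.
  by rewrite (gt_eqF N0) implybT.
rewrite subrK (powRr1 (ltW N0)) mulrC.
rewrite (_ : - p^-1 * (1 - p) = 1 - p^-1)%R//.
by rewrite mulrBr mulr1 mulNr mulVf ?gt_eqF// opprK addrC.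
Qed.

Lemma integral_le_holder_poweR (D : set T) (G : T -> \bar R) (p M : R) :
  measurable D -> measurable_fun D G -> (forall x, 0 <= G x) ->
  (1 < p)%R -> (0 < M)%R -> mu D <= M%:E ->
  \int[mu]_(x in D) G x <=
    (2 * M `^ (1 - p^-1))%:E * (\int[mu]_(x in D) (G x `^ p)) `^ p^-1.
Proof.
move=> mD mG G0 p1 M0 DM; have p0 : (0 < p)%R by rewrite (lt_trans _ p1).
have J0 : 0 <= \int[mu]_(x in D) (G x `^ p) by apply: integral_ge0 => x _; exact: poweR_ge0.
have [->|Jy] := eqVneq (\int[mu]_(x in D) (G x `^ p)) +oo.
  rewrite poweRyr ?invr_neq0 ?gt_eqF// gt0_muley ?leey// lte_fin.
  by rewrite mulr_gt0// powR_gt0.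
have [I E] : exists I : R, \int[mu]_(x in D) (G x `^ p) = I%:E.
  exists (fine (\int[mu]_(x in D) (G x `^ p))).
  by rewrite fineK// ge0_fin_numE// ltey.
have I0 : (0 <= I)%R by rewrite -lee_fin -E.
rewrite E.
have K0 : (0 < 2 * M `^ (1 - p^-1))%R by rewrite mulr_gt0// powR_gt0.
(* The integral may vanish while [integral_le_holder] asks for a positive [N]; so the slack [e],
   divided by the constant in front, is added to the norm. *)
apply/lee_addgt0Pr => e e0.
have N0 : (0 < I `^ p^-1 + e / (2 * M `^ (1 - p^-1)))%R.
  by rewrite ltr_wpDl ?powR_ge0// divr_gt0.
apply: le_trans (@integral_le_holder D G p M _ mD mG G0 p1 M0 N0 DM _) _.
  rewrite E lee_fin -[leLHS](@powR_powRVK _ p)// ?gt_eqF//.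
  by apply: ge0_ler_powR; rewrite ?nnegrE ?powR_ge0//; apply: ltW; rewrite // ltrDl divr_gt0.
rewrite poweR_EFin -EFinM -EFinD lee_fin mulrDr lerD2l.
by rewrite mulrCA divff ?mulr1// gt_eqF.
Qed.

End holder.

Section geometric.
Context {R : realType}.

Lemma geometric_sum_le (x : R) N : 0 <= x < 1 ->
  \sum_(0 <= i < N) x ^+ i <= (1 - x)^-1.
Proof.
move=> /andP[x0 x1]; rewrite -[leRHS]mul1r ler_pdivlMr ?subr_gt0//.
elim: N => [|N IH]; first by rewrite big_geq// mul0r.
suff -> : (\sum_(0 <= i < N.+1) x ^+ i) * (1 - x) = 1 - x ^+ N.+1.
  by rewrite gerBl exprn_ge0.
elim: {IH}N => [|N IH]; first by rewrite big_nat1 expr0 expr1 mul1r.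
by rewrite big_nat_recr//= mulrDl IH; rewrite !exprS; ring.
Qed.

Lemma geometric_series_le (x c : R) (u : nat -> \bar R) :
  0 <= x < 1 -> 0 <= c -> (forall i, 0 <= u i)%E ->
  (forall i, u i <= (c * x ^+ i)%:E)%E ->
  (\sum_(i <oo) u i <= (c / (1 - x))%:E)%E.
Proof.
move=> x01 c0 u0 ux; apply: nneseries_le_partial => // N.
apply: (@le_trans _ _ (\sum_(0 <= i < N) (c * x ^+ i)%:E)%E).
  by apply: lee_sum.
rewrite sumEFin lee_fin -mulr_sumr ler_wpM2l//; exact: geometric_sum_le.
Qed.

Lemma powR_exp2 (i : nat) (e : R) : (2 ^+ i) `^ e = (2 `^ e) ^+ i.
Proof.
rewrite -(@powR_mulrn _ 2 i)//.
rewrite -(@powR_mulrn _ (2 `^ e) i); last exact: powR_ge0.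
by rewrite -powRrM -powRrM mulrC.
Qed.

Lemma powR_antitone (e a b : R) : e <= 0 -> 0 < a -> a <= b -> b `^ e <= a `^ e.
Proof.
move=> e0 a0 ab; rewrite -(opprK e) !(powRN _ (- e)) lef_pV2 ?posrE ?powR_gt0//.
  by apply: ge0_ler_powR; rewrite ?nnegrE ?oppr_ge0// ?(ltW a0)// (le_trans (ltW a0) ab).
exact: lt_le_trans ab.
Qed.

Lemma powR2_lt1 (e : R) : 0 < e -> 0 <= 2 `^ (- e) < 1.
Proof.
move=> e0; rewrite powR_ge0/= powRN invf_lt1 ?powR_gt0//.
have e1 : (1 : R) `^ e = 1 by rewrite powR1.
by rewrite -[ltLHS]e1 gt0_ltr_powR ?nnegrE// ltr1n.
Qed.

Lemma dyadic_floor (u v : R) : 0 < u -> u <= v ->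
  exists i, v / 2 ^+ i.+1 < u <= v / 2 ^+ i.
Proof.
move=> u0 uv.
have [i vi] : exists i : nat, v / 2 ^+ i < u.
  have [k vk] : exists k : nat, v / u < k%:R by exists (Num.trunc (v / u)).+1; exact: truncnS_gt.
  exists k; rewrite ltr_pdivrMr ?exprn_gt0// mulrC -ltr_pdivrMr//.
  by rewrite (lt_trans vk)// -natrX ltr_nat ltn_expl.
elim: i vi => [|i IH]; first by rewrite expr0 divr1 ltNge uv.
by case: (ltP (v / 2 ^+ i) u) => [/IH//|vi vi']; exists i; rewrite vi'.
Qed.

End geometric.

Section dyadic_powers.
Context {R : realType}.

Lemma powR_dyadicM (rho e : R) i : 0 <= rho ->
  (rho * 2 ^+ i) `^ e = rho `^ e * (2 `^ e) ^+ i.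
Proof. by move=> rho0; rewrite powRM ?exprn_ge0// powR_exp2. Qed.

Lemma powR_dyadicV (rho e : R) i : 0 <= rho ->
  (rho / 2 ^+ i) `^ e = rho `^ e * (2 `^ (- e)) ^+ i.
Proof.
move=> rho0; rewrite powRM ?invr_ge0 ?exprn_ge0//; congr *%R.
have p0 : (0 : R) <= 2 ^+ i by rewrite exprn_ge0.
by rewrite -(powR_inv1 p0) -powRrM mulN1r powR_exp2.
Qed.

Lemma powR_exprn (x e : R) n : 0 <= x -> (x ^+ n) `^ e = x `^ (n%:R * e).
Proof. by move=> x0; rewrite -powR_mulrn// powRrM. Qed.

Lemma powR_subn (a g : R) n : 0 < a ->
  a `^ (g - n%:R) * (2 * a) ^+ n = 2 ^+ n * a `^ g.
Proof.
move=> a0; rewrite exprMn mulrCA; congr *%R.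
rewrite -(@powR_mulrn _ a n); last exact: ltW.
by rewrite -powRD ?subrK// (gt_eqF a0) implybT.
Qed.

End dyadic_powers.

(** * The Hardy-Littlewood-Sobolev inequality *)

Section riesz_sum.
Context {R : realType} {n : nat}.
Local Notation mu := (@lebesgueRn R n).
Variable gam : R.
Local Open Scope ereal_scope.

(* With [a] dyadic this is comparable to the integral of
   [`|x - y| `^ (gam - n) * f y] over the part of space that the cubes cover. *)
Definition riesz_sum (a : nat -> R) (f : 'rV[R]_n -> \bar R) (x : 'rV[R]_n) :=
  \sum_(i <oo) (a i `^ (gam - n%:R))%:E * \int[mu]_(y in cube x (2 * a i)) f y.

Definition riesz_near (rho : R) := riesz_sum (fun i => rho / 2 ^+ i)%R.
Definition riesz_far (rho : R) := riesz_sum (fun i => rho * 2 ^+ i)%R.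

Variable a : nat -> R.
Implicit Types f g : 'rV[R]_n -> \bar R.

Lemma riesz_term_ge0 f x i : (forall x, 0 <= f x) ->
  0 <= (a i `^ (gam - n%:R))%:E * \int[mu]_(y in cube x (2 * a i)) f y.
Proof. by move=> f0; rewrite mule_ge0 ?lee_fin ?powR_ge0// integral_ge0. Qed.

Lemma riesz_sum_ge0 f x : (forall x, 0 <= f x) -> 0 <= riesz_sum a f x.
Proof. by move=> f0; apply: nneseries_ge0 => i _ _; exact: riesz_term_ge0. Qed.

Lemma measurable_riesz_term f i : (forall x, 0 <= f x) -> measurable_fun setT f ->
  measurable_fun setT
    (fun x => (a i `^ (gam - n%:R))%:E * \int[mu]_(y in cube x (2 * a i)) f y).
Proof.
move=> f0 mf; apply: emeasurable_funM => //.
exact: measurable_cube_integral.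
Qed.

Lemma measurable_riesz_sum f : (forall x, 0 <= f x) -> measurable_fun setT f ->
  measurable_fun setT (riesz_sum a f).
Proof.
move=> f0 mf; apply: ge0_emeasurable_sum => i *; first exact: riesz_term_ge0.
exact: measurable_riesz_term.
Qed.

Lemma le_riesz_sum f g x : (forall x, 0 <= f x) -> (forall x, f x <= g x) ->
  riesz_sum a f x <= riesz_sum a g x.
Proof.
move=> f0 fg; apply: lee_nneseries => i _ *; first exact: riesz_term_ge0.
rewrite lee_wpmul2l ?lee_fin ?powR_ge0//.
by apply: le_integral_lower => y _.
Qed.

Lemma riesz_sumD f g x : (forall x, 0 <= f x) -> (forall x, 0 <= g x) ->
  measurable_fun setT f -> measurable_fun setT g ->
  riesz_sum a (f \+ g) x = riesz_sum a f x + riesz_sum a g x.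
Proof.
move=> f0 g0 mf mg; rewrite /riesz_sum -nneseriesD; last 2 first.
- by move=> i _ _; exact: riesz_term_ge0.
- by move=> i _ _; exact: riesz_term_ge0.
apply: eq_eseriesr => i _.
rewrite ge0_integralD//.
- by rewrite ge0_muleDr// integral_ge0.
- exact: measurable_cube.
- exact: measurable_funTS.
- exact: measurable_funTS.
Qed.

Lemma integral_riesz_sum f : (forall x, 0 <= f x) -> measurable_fun setT f ->
  (forall i, 0 <= a i)%R ->
  \int[mu]_x riesz_sum a f x =
  \sum_(i <oo) (a i `^ (gam - n%:R) * (2 * a i) ^+ n)%:E * \int[mu]_y f y.
Proof.
move=> f0 mf a0; rewrite integral_nneseries//; last 2 first.
- by move=> i; exact: measurable_riesz_term.
- by move=> i x _; exact: riesz_term_ge0.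
apply: eq_eseriesr => i _; rewrite ge0_integralZl//; last 3 first.
- exact: measurable_cube_integral.
- by move=> x _; rewrite integral_ge0.
- by rewrite lee_fin powR_ge0.
by rewrite integral_cube_integral// ?mulr_ge0// EFinM muleA.
Qed.

End riesz_sum.

Section riesz_near_far.
Context {R : realType} {n : nat}.
Local Notation mu := (@lebesgueRn R n).
Variable gam : R.
Hypothesis gam0 : 0 < gam.
Local Open Scope ereal_scope.
Implicit Types f : 'rV[R]_n -> \bar R.

(** Sum of the geometric series in [near_term], of ratio [2 ^ (- gam)], with [rho ^ gam] left out.
    It bounds the near part both from $L^1$ to $L^1$ and from $L^\infty$ to $L^\infty$. *)
Definition near_const : R := (2 ^+ n / (1 - 2 `^ (- gam)))%R.

Lemma near_const_gt0 : (0 < near_const)%R.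
Proof.
rewrite divr_gt0 ?exprn_gt0// subr_gt0.
by have /andP[] := powR2_lt1 gam0.
Qed.

Lemma near_term (rho : R) i : (0 < rho)%R ->
  ((rho / 2 ^+ i) `^ (gam - n%:R) * (2 * (rho / 2 ^+ i)) ^+ n =
   2 ^+ n * rho `^ gam * (2 `^ (- gam)) ^+ i)%R.
Proof.
move=> rho0; rewrite powR_subn ?divr_gt0 ?exprn_gt0//.
by rewrite powR_dyadicV ?mulrA// ltW.
Qed.

Lemma integral_riesz_near (rho : R) f : (0 < rho)%R ->
  (forall x, 0 <= f x) -> measurable_fun setT f ->
  \int[mu]_x riesz_near gam rho f x <= (near_const * rho `^ gam)%:E * \int[mu]_x f x.
Proof.
move=> rho0 f0 mf; rewrite integral_riesz_sum//; last first.
  by move=> i; rewrite divr_ge0 ?exprn_ge0// ltW.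
have : 0 <= \int[mu]_x f x by exact: integral_ge0.
have [->|Jy] := eqVneq (\int[mu]_x f x) +oo.
  by rewrite gt0_muley ?leey// lte_fin mulr_gt0 ?near_const_gt0 ?powR_gt0.
move=> J0; have Jfin : \int[mu]_x f x \is a fin_num by rewrite ge0_fin_numE// ltey.
rewrite -(fineK Jfin) -EFinM /near_const.
set J := fine _; have J0' : (0 <= J)%R by exact: fine_ge0.
rewrite [leRHS](_ : _ = ((2 ^+ n * rho `^ gam * J) / (1 - 2 `^ (- gam)))%:E); last first.
  by congr EFin; rewrite mulrAC -!mulrA; congr *%R; rewrite mulrC -!mulrA mulrCA.
apply: (@geometric_series_le _ (2 `^ (- gam))); first exact: powR2_lt1.
- by rewrite !mulr_ge0 ?exprn_ge0 ?powR_ge0.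
- by move=> i; rewrite -EFinM lee_fin !mulr_ge0 ?exprn_ge0 ?powR_ge0 ?mulr_ge0 ?divr_ge0 ?exprn_ge0// ltW.
by move=> i; rewrite -EFinM near_term// mulrAC.
Qed.

Lemma riesz_near_le (rho tau : R) f x : (0 < rho)%R -> (0 <= tau)%R ->
  (forall x, 0 <= f x) -> (forall x, f x <= tau%:E) ->
  riesz_near gam rho f x <= (near_const * rho `^ gam * tau)%:E.
Proof.
move=> rho0 tau0 f0 ftau.
rewrite [leRHS](_ : _ = ((2 ^+ n * rho `^ gam * tau) / (1 - 2 `^ (- gam)))%:E); last first.
  by congr EFin; rewrite /near_const mulrAC -!mulrA; congr *%R; rewrite mulrC -!mulrA mulrCA.
apply: (@geometric_series_le _ (2 `^ (- gam))); first exact: powR2_lt1.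
- by rewrite !mulr_ge0 ?exprn_ge0 ?powR_ge0.
- by move=> i; exact: (riesz_term_ge0 gam (fun i => (rho / 2 ^+ i)%R) x i f0).
move=> i; apply: (@le_trans _ _ (((rho / 2 ^+ i) `^ (gam - n%:R))%:E *
    \int[mu]_(y in cube x (2 * (rho / 2 ^+ i))) tau%:E)).
  by rewrite lee_wpmul2l ?lee_fin ?powR_ge0//; apply: le_integral_lower => y _.
rewrite integral_cube_cst ?mulr_ge0 ?divr_ge0 ?exprn_ge0 ?(ltW rho0)//.
rewrite -!EFinM lee_fin mulrCA mulrC near_term//.
by rewrite mulrAC.
Qed.

(** Hoelder's inequality on the cube of side [2 r] gives a term of size [r ^ (gam - n) r ^ (n (1 -
    1/q)) = r ^ (gam - n/q)]. The exponent is negative, so the series over growing radii is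
    geometric and governed by its first term. *)
Lemma riesz_far_le (rho q : R) f x : (0 < rho)%R -> (1 < q)%R ->
  (gam < n%:R / q)%R ->
  (forall x, 0 <= f x) -> measurable_fun setT f ->
  \int[mu]_x (f x `^ q) <= 1 ->
  riesz_far gam rho f x <=
    (2 * 2 `^ (n%:R * (1 - q^-1)) / (1 - 2 `^ (- (n%:R / q - gam))) *
     rho `^ (- (n%:R / q - gam)))%:E.
Proof.
move=> rho0 q1 gq f0 mf fq; set e := (n%:R / q - gam)%R.
have e0 : (0 < e)%R by rewrite subr_gt0.
rewrite -mulrAC.
apply: (@geometric_series_le _ (2 `^ (- e))); first exact: powR2_lt1.
- by rewrite !mulr_ge0 ?powR_ge0.
- by move=> i; exact: (riesz_term_ge0 gam (fun i => (rho * 2 ^+ i)%R) x i f0).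
move=> i; set r := (rho * 2 ^+ i)%R.
have r0 : (0 < r)%R by rewrite mulr_gt0// exprn_gt0.
have rr0 : (0 < 2 * r)%R by rewrite mulr_gt0.
have : \int[mu]_(y in cube x (2 * r)) f y <= (2 * ((2 * r) ^+ n) `^ (1 - q^-1) * 1)%:E.
  apply: integral_le_holder => //.
  - exact: measurable_cube.
  - exact: measurable_funTS.
  - by rewrite exprn_gt0.
  - by apply: mu_cube_le; exact: ltW.
  rewrite powR1; apply: le_trans fq; apply: ge0_le_integral_subset => // y.
  exact: poweR_ge0.
move=> /(lee_wpmul2l (_ : 0 <= (r `^ (gam - n%:R))%:E)) => /(_ _)/le_trans; apply.
  by rewrite lee_fin powR_ge0.
rewrite -EFinM lee_fin mulr1 powR_exprn; last exact: ltW.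
rewrite powRM ?(ltW r0)// mulrCA -!mulrA ler_pM2l// mulrCA ler_pM2l ?powR_gt0//.
rewrite -powRD; last by rewrite (gt_eqF r0) implybT.
rewrite (_ : _ + _ = - e)%R; last by rewrite /e; ring.
by rewrite powR_dyadicM// ltW.
Qed.

End riesz_near_far.

(** * Layer-cake summation over dyadic levels *)

Section layer_cake.
Context {R : realType}.
Local Open Scope ereal_scope.

(** The minimum in the bound is what lets the induction close: splitting off the level [M] leaves
    the same sum for [M / 2], and when [M < L] the two contributions add up exactly. *)
Lemma dyadic_layer_sum (M L del : R) N : (0 < M)%R -> (0 <= L)%R -> (0 < del)%R ->
  (\sum_(0 <= j < N) (if M / 2 ^+ j < L then (M / 2 ^+ j) `^ del else 0) <=
  Num.min M L `^ del / (1 - 2 `^ (- del)))%R.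
Proof.
move=> + L0 del0; have /andP[x0 x1] := powR2_lt1 del0; elim: N M => [|N IH] M M0.
  by rewrite big_geq// divr_ge0 ?powR_ge0// subr_ge0 ltW.
have M20 : (0 < M / 2)%R by rewrite divr_gt0.
rewrite big_nat_recl// expr0 divr1.
under eq_bigr do rewrite exprS invfM mulrA.
apply: (@le_trans _ _ ((if (M < L)%R then M `^ del else 0) +
   (Num.min (M / 2) L `^ del / (1 - 2 `^ (- del))))%R); first by rewrite lerD2l IH.
have x1' : (0 < 1 - 2 `^ (- del))%R by rewrite subr_gt0.
case: ifPn => [ML|].
  have M2L : (M / 2 < L)%R.
    by rewrite (lt_trans _ ML)// ltr_pdivrMr// ltr_pMr// ltr1n.
  rewrite (min_l (ltW ML)) (min_l (ltW M2L)).
  rewrite ler_pdivlMr// mulrDl mulfVK ?gt_eqF//.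
  have := @powR_dyadicV _ M del 1 (ltW M0); rewrite !expr1 => ->.
  by rewrite mulrBr mulr1 subrK.
rewrite -leNgt => LM; rewrite add0r ler_pM2r ?invr_gt0//.
rewrite (min_r LM); apply: ge0_ler_powR; rewrite ?nnegrE ?(ltW del0)//.
  by rewrite le_min L0 (ltW M20).
by rewrite ge_min lexx orbT.
Qed.

Lemma dyadic_layer_series (M L del : R) : (0 < M)%R -> (0 <= L)%R -> (0 < del)%R ->
  \sum_(j <oo) (if M / 2 ^+ j < L then (M / 2 ^+ j) `^ del else 0)%:E <=
  (L `^ del / (1 - 2 `^ (- del)))%:E.
Proof.
move=> M0 L0 del0; have /andP[x0 x1] := powR2_lt1 del0.
apply: nneseries_le_partial => [i|N].
  by rewrite lee_fin; case: ifP => // _; exact: powR_ge0.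
rewrite sumEFin lee_fin; apply: le_trans (dyadic_layer_sum N M0 L0 del0) _.
rewrite ler_pM2r ?invr_gt0 ?subr_gt0//.
by rewrite ge0_ler_powR ?nnegrE ?le_min ?L0 ?(ltW M0) ?(ltW del0)// ge_min lexx orbT.
Qed.

(** For [x > 0] some level [lam = M / 2^j] satisfies [4 lam < x] and [min x M <= 8 lam], and its
    term alone dominates the left side. The truncation at [M] provides a top level, the 4 leaves
    room for the splitting in [near_large], and 8 is twice 4 because consecutive levels differ by a
    factor 2. *)
Lemma layer_cake_le (x : \bar R) (M s : R) (h : nat -> \bar R) :
  0 <= x -> (0 < M)%R -> (0 < s)%R -> (forall j, 0 <= h j) ->
  (forall j, (4 * (M / 2 ^+ j))%:E < x -> 1 <= h j) ->
  mine x M%:E `^ s <=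
    (8 `^ s)%:E * \sum_(j <oo) ((M / 2 ^+ j) `^ s)%:E * h j.
Proof.
move=> x0 M0 s0 h0 hj.
have lam0 j : (0 < M / 2 ^+ j)%R by rewrite divr_gt0// exprn_gt0.
have t0 j : 0 <= ((M / 2 ^+ j) `^ s)%:E * h j by rewrite mule_ge0// lee_fin powR_ge0.
have e80 : 0 <= (8 `^ s)%:E :> \bar R by rewrite lee_fin powR_ge0.
have key j : (4 * (M / 2 ^+ j))%:E < x -> mine x M%:E <= (8 * (M / 2 ^+ j))%:E ->
  mine x M%:E `^ s <= (8 `^ s)%:E * \sum_(j <oo) ((M / 2 ^+ j) `^ s)%:E * h j.
  move=> jx xj; apply: (@le_trans _ _ ((8 * (M / 2 ^+ j))%:E `^ s)).
    by apply: le_poweR; [exact: ltW|rewrite le_min x0 lee_fin ltW|].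
  rewrite poweR_EFin powRM ?(ltW (lam0 j))// EFinM lee_wpmul2l//.
  apply: (@le_trans _ _ (((M / 2 ^+ j) `^ s)%:E * h j)).
    by rewrite lee_pemulr ?hj// lee_fin powR_ge0.
  exact: (@nneseries_ge_term _ (fun j => ((M / 2 ^+ j) `^ s)%:E * h j)).
have [Mx|xM] := ltP (4 * M)%:E x.
  apply: (key 0%N); first by rewrite expr0 divr1.
  by rewrite ge_min lee_fin expr0 divr1 ler_peMl ?orbT ?ler1n// ltW.
case: x x0 xM hj key => [x|//|//]; rewrite !lee_fin => x0 xM hj key.
move: x0; rewrite le_eqVlt => /predU1P[x0|x0].
  rewrite -x0 min_l ?lee_fin ?(ltW M0)// poweR0r ?gt_eqF//.
  by rewrite mule_ge0// nneseries_ge0.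
have [i /andP[ix xi]] := dyadic_floor x0 xM.
apply: (key i.+1); first by rewrite lte_fin mulrA.
rewrite ge_min lee_fin; apply/orP; left; apply: le_trans xi _.
rewrite exprS le_eqVlt; apply/orP; left; apply/eqP; field.
by rewrite expf_neq0.
Qed.

End layer_cake.

Section truncation.
Context d (T : measurableType d) (R : realType).
Variable mu : {measure set T -> \bar R}.
Local Open Scope ereal_scope.
Import HBNNSimple.

(** The integral is a supremum over simple functions, and each of them is bounded, hence below some
    truncation of [F]. The bound thus passes to the limit even for a non-measurable [F]. *)
Lemma integral_le_truncated (F : T -> \bar R) (c : \bar R) :
  (forall x, 0 <= F x) ->
  (forall M : R, (0 < M)%R -> \int[mu]_x mine (F x) M%:E <= c) ->
  \int[mu]_x F x <= c.
Proof.
move=> F0 Fc; rewrite ge0_integralTE//.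
apply: ge_ereal_sup => _ [h /= hF <-].
have [B [_ /(_ (B + 1)%R)]] := simple_bounded h.
rewrite ltrDl ltr01 => /(_ isT) hB.
have B0 : (0 < `|B| + 1)%R by rewrite ltr_wpDl.
apply: le_trans (Fc _ B0); rewrite -integralT_nnsfun.
apply: le_integral_lower => x _; first by rewrite lee_fin.
rewrite le_min hF/= lee_fin; apply: le_trans (ler_norm _) _.
by apply: le_trans (hB x _) _ => //; rewrite lerD2r ler_norm.
Qed.

End truncation.

Section hls.
Context {R : realType} {n : nat}.
Local Notation mu := (@lebesgueRn R n).
Variables gam q s : R.
Hypotheses (n0 : (0 < n)%N) (gam0 : 0 < gam) (q1 : 1 < q) (qs : q < s).
Hypothesis gamE : gam / n%:R = q^-1 - s^-1.

Let n0' : 0 < n%:R :> R. Proof. by rewrite ltr0n. Qed.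
Let q0 : 0 < q. Proof. exact: lt_trans q1. Qed.
Let s0 : 0 < s. Proof. exact: lt_trans qs. Qed.

Let e := n%:R / q - gam.

(** [e] is the rate at which [riesz_far_le] decays in the radius; the scaling relation [gamE]
    identifies it as [n / s], which shows that it is positive. *)
Let eE : e = n%:R / s.
Proof.
have : gam = n%:R * (q^-1 - s^-1) by rewrite -gamE mulrC divfK ?gt_eqF.
by rewrite /e => ->; ring.
Qed.

Let e0 : 0 < e. Proof. by rewrite eE divr_gt0. Qed.

Let CS := @near_const R n gam.
Let CL := 2 * 2 `^ (n%:R * (1 - q^-1)) / (1 - 2 `^ (- e)).

Let CS0 : 0 < CS. Proof. exact: near_const_gt0. Qed.
Let CL0 : 0 < CL.
Proof.
rewrite !mulr_gt0 ?powR_gt0// invr_gt0 subr_gt0.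
by have /andP[] := powR2_lt1 e0.
Qed.

(* [rad lam] makes the bound on the far part equal to [lam], [cut lam] makes the
   near part of a function bounded by [cut lam] at most [lam], and [top] is the
   inverse of [cut]. *)
Let rad lam := (lam / CL) `^ (- e^-1).
Let cut lam := lam / (CS * rad lam `^ gam).
Let top (v : R) := CL * (v / (CL / CS)) `^ (q / s).

Let cc0 : 0 < CL / CS. Proof. exact: divr_gt0. Qed.

Let rad_gt0 lam : 0 < lam -> 0 < rad lam.
Proof. by move=> l0; rewrite powR_gt0// divr_gt0. Qed.

Let cut_gt0 lam : 0 < lam -> 0 < cut lam.
Proof. by move=> l0; rewrite divr_gt0// mulr_gt0// powR_gt0// rad_gt0. Qed.

Let rad_far lam : 0 < lam -> CL * rad lam `^ (- e) = lam.
Proof.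
move=> l0; rewrite /rad -powRrM mulrNN mulVf; last by rewrite gt_eqF.
rewrite (powRr1 (divr_ge0 (ltW l0) (ltW CL0))).
by rewrite mulrC divfK// gt_eqF.
Qed.

Let cutE lam : 0 < lam -> cut lam = CL / CS * (lam / CL) `^ (s / q).
Proof.
move=> l0; rewrite /cut /rad -powRrM mulNr powRN invfM invrK mulrA.
have -> : s / q = 1 + e^-1 * gam.
  have : e = n%:R / s := eE.
  have gE : gam = n%:R / q - e by rewrite /e; ring.
  move=> eE'; rewrite gE eE'; field.
  by rewrite !gt_eqF.
rewrite powRD; last by rewrite (gt_eqF (divr_gt0 l0 CL0)) implybT.
rewrite (powRr1 (divr_ge0 (ltW l0) (ltW CL0))); field.
by rewrite !gt_eqF.
Qed.

Let lt_top lam v : 0 < lam -> cut lam < v -> lam < top v.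
Proof.
move=> l0; rewrite cutE// -(ltr_pdivlMl _ _ cc0) [_^-1 * v]mulrC => lv.
rewrite /top -(ltr_pdivrMl _ _ CL0) [_^-1 * lam]mulrC.
have l1 : 0 <= lam / CL by rewrite divr_ge0// ltW.
rewrite -[ltLHS](@powR_powRK _ (s / q))// ?gt_eqF ?divr_gt0//.
have -> : (s / q)^-1 = q / s by rewrite invf_div.
apply: gt0_ltr_powR => //; rewrite ?nnegrE ?divr_gt0 ?powR_ge0//.
exact: le_trans (powR_ge0 _ _) (ltW lv).
Qed.

Let Kexp := CS * CL `^ (s / q - 1).
Let Kexp_ge0 : 0 <= Kexp.
Proof. by rewrite mulr_ge0 ?powR_ge0// ltW. Qed.

Let del := s - s / q.

Let del0 : 0 < del.
Proof.
by rewrite /del subr_gt0 ltr_pdivrMr// ltr_pMr.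
Qed.

(** The layer-cake weight [lam ^ s], the factor [lam ^ (- 1)] from Chebyshev's inequality and the
    $L^1$ constant [CS * rad lam ^ gam] of the near part multiply to the left side. Since [del > 0],
    the sum over small levels converges. *)
Let weightE lam : 0 < lam -> lam `^ s / cut lam = Kexp * lam `^ del.
Proof.
move=> l0; rewrite cutE// /Kexp /del.
rewrite powRM ?invr_ge0 ?(ltW l0) ?(ltW CL0)//.
have -> : CL^-1 `^ (s / q) = (CL `^ (s / q))^-1.
  by rewrite -(powR_inv1 (ltW CL0)) -powRrM mulN1r powRN.
rewrite (@powRB _ CL); last by rewrite (gt_eqF CL0) implybT.
rewrite powRr1 ?(ltW CL0)// (@powRB _ lam); last by rewrite (gt_eqF l0) implybT.
by field; rewrite !gt_eqF ?powR_gt0.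
Qed.

Let Khls := 8 `^ s * (Kexp * (CL `^ del * (CL / CS) `^ (- (q - 1)) / (1 - 2 `^ (- del)))).

(** The decisive exponent identity is [q / s * del = q - 1]: summing the weights up to the level
    [top v] restores exactly the power [q] of [v]. *)
Let topE v : 0 <= v -> v * top v `^ del = CL `^ del * (CL / CS) `^ (- (q - 1)) * v `^ q.
Proof.
move=> v0; rewrite /top.
have c0 : 0 <= CL / CS by rewrite divr_ge0// ltW.
rewrite powRM ?(ltW CL0) ?powR_ge0// -powRrM.
rewrite (_ : q / s * del = q - 1); last by rewrite /del; field; rewrite !gt_eqF.
rewrite powRM ?invr_ge0//.
have -> : (CL / CS)^-1 `^ (q - 1) = (CL / CS) `^ (- (q - 1)).
  by rewrite -(powR_inv1 c0) -powRrM mulN1r.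
rewrite -(mulr_powRB1 v0 q0); ring.
Qed.

Let Khls_gt0 : 0 < Khls.
Proof.
rewrite !mulr_gt0 ?powR_gt0// invr_gt0 subr_gt0.
  by have /andP[] := powR2_lt1 gam0.
by have /andP[] := powR2_lt1 del0.
Qed.

Section normalized.
Variables (f : 'rV[R]_n -> R) (F : 'rV[R]_n -> \bar R).
Hypotheses (f0 : forall x, 0 <= f x) (mf : measurable_fun setT f).
Hypothesis F0 : forall x, (0 <= F x)%E.
Hypothesis FS : forall rho x, 0 < rho ->
  (F x <= riesz_near gam rho (EFin \o f) x + riesz_far gam rho (EFin \o f) x)%E.
Hypothesis fq1 : (\int[mu]_x (f x `^ q)%:E <= 1)%E.

Let ft tau y := if tau < f y then f y else 0.

Let ft0 tau y : 0 <= ft tau y.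
Proof. by rewrite /ft; case: ifP. Qed.

Let mft tau : measurable_fun setT (EFin \o ft tau).
Proof.
apply/measurable_EFinP; apply: measurable_fun_ifT => //.
by apply: measurable_fun_ltr => //.
Qed.

Let mEf : measurable_fun setT (EFin \o f).
Proof. exact/measurable_EFinP. Qed.

(** By contraposition: the far part is at most [lam] by [rad_far], the near part of the values below
    [cut lam] is at most [lam], and if the remaining part is below [lam] too, then [F x] is at most
    [3 lam]. Using 4 allows the sum to be split evenly. *)
Let near_large lam x : 0 < lam -> ((4 * lam)%:E < F x)%E ->
  (lam%:E <= riesz_near gam (rad lam) (EFin \o ft (cut lam)) x)%E.
Proof.
move=> l0; apply: contraTT; rewrite -ltNge -leNgt => nl.
have r0 := rad_gt0 l0; have c0 := cut_gt0 l0.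
apply: le_trans (FS x r0) _.
rewrite (_ : 4 * lam = (lam + lam) + (lam + lam)); last by ring.
rewrite EFinD leeD//; last first.
  have gq : gam < n%:R / q by rewrite -subr_gt0.
  have f0' y : (0 <= (EFin \o f) y)%E by rewrite lee_fin.
  apply: le_trans (riesz_far_le x r0 q1 gq f0' mEf fq1) _.
  by rewrite lee_fin -/e -/CL rad_far// lerDr ltW.
apply: (@le_trans _ _ (riesz_near gam (rad lam)
    (cst (cut lam)%:E \+ (EFin \o ft (cut lam)))%E x)).
  apply: le_riesz_sum => y /=; rewrite lee_fin// /ft.
  by case: ltP => yc; rewrite ?addr0// lerDr ltW.
rewrite [leLHS]riesz_sumD//; last 2 first.
- by move=> y; rewrite lee_fin ltW.
- by move=> y; rewrite lee_fin.
rewrite EFinD leeD//; last exact: ltW.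
apply: (le_trans (riesz_near_le gam0 x r0 (ltW c0) _ _)).
- by move=> y; rewrite lee_fin ltW.
- by move=> y.
by rewrite lee_fin -/CS /cut mulrC divfK// gt_eqF// mulr_gt0// powR_gt0.
Qed.

Let term M j y := (if M / 2 ^+ j < top (f y) then (M / 2 ^+ j) `^ del else 0).

(** The $L^1$ bound of the near part, with the factor computed by [weightE]. Then [lt_top] turns the
    support condition [cut lam < f y] into [lam < top (f y)], a form in which the levels can be
    summed at fixed [y]. *)
Let layer_integral lam : 0 < lam ->
  ((lam `^ s)%:E * \int[mu]_x ((lam^-1)%:E *
     riesz_near gam (rad lam) (EFin \o ft (cut lam)) x) <=
   \int[mu]_y (Kexp * (f y * if (lam < top (f y))%R then lam `^ del else 0%R))%:E)%E.
Proof.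
move=> l0; have r0 := rad_gt0 l0; have c0 := cut_gt0 l0.
have ft0' y : (0 <= (EFin \o ft (cut lam)) y)%E by rewrite lee_fin.
rewrite ge0_integralZl//; last 3 first.
- exact: measurable_riesz_sum.
- by move=> x _; exact: riesz_sum_ge0.
- by rewrite lee_fin invr_ge0 ltW.
apply: (@le_trans _ _ ((lam `^ s)%:E * ((lam^-1)%:E *
    ((CS * rad lam `^ gam)%:E * \int[mu]_y (ft (cut lam) y)%:E)))%E).
  apply: lee_wpmul2l; first by rewrite lee_fin powR_ge0.
  apply: lee_wpmul2l; first by rewrite lee_fin invr_ge0 ltW.
  exact: integral_riesz_near.
rewrite !muleA -!EFinM.
have -> : lam `^ s / lam * (CS * rad lam `^ gam) = Kexp * lam `^ del.
  by rewrite -weightE// /cut invf_div [RHS]mulrA [LHS]mulrAC.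
have k0 : 0 <= Kexp * lam `^ del.
  by rewrite mulr_ge0 ?powR_ge0.
rewrite -ge0_integralZl//; [|exact: mft|by move=> y _; rewrite lee_fin].
apply: le_integral_lower => y _; first by rewrite mule_ge0// lee_fin.
rewrite -EFinM lee_fin /ft; case: ifPn => [cf|_]; last first.
  rewrite mulr0; apply: mulr_ge0 => //; apply: mulr_ge0 => //.
  by case: ifP => // _; exact: powR_ge0.
by rewrite lt_top// -mulrA (mulrC (f y)).
Qed.

Lemma riesz_hls_truncated (M : R) : 0 < M ->
  (\int[mu]_x (mine (F x) M%:E `^ s) <= Khls%:E * \int[mu]_x (f x `^ q)%:E)%E.
Proof.
move=> M0; pose lam j := M / 2 ^+ j.
have lam0 j : 0 < lam j by rewrite divr_gt0// exprn_gt0.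
pose h j x := ((lam j)^-1%:E *
  riesz_near gam (rad (lam j)) (EFin \o ft (cut (lam j))) x)%E.
have ft0' tau y : (0 <= (EFin \o ft tau) y)%E by rewrite lee_fin.
have h0 j x : (0 <= h j x)%E.
  by rewrite mule_ge0 ?riesz_sum_ge0// lee_fin invr_ge0 ltW.
have mh j : measurable_fun setT (h j).
  by apply: emeasurable_funM => //; exact: measurable_riesz_sum.
have mlh j : measurable_fun setT (fun x => ((lam j `^ s)%:E * h j x)%E).
  exact: emeasurable_funM.
have lh0 j x : (0 <= (lam j `^ s)%:E * h j x)%E.
  by rewrite mule_ge0// lee_fin powR_ge0.
apply: (@le_trans _ _ (\int[mu]_x ((8 `^ s)%:E *
    \sum_(j <oo) ((lam j `^ s)%:E * h j x)))%E).
  apply: le_integral_lower => x _; first exact: poweR_ge0.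
  apply: layer_cake_le => // j jx.
  by rewrite lee_pdivlMl// mule1 near_large.
rewrite ge0_integralZl//; last 2 first.
- by apply: ge0_emeasurable_sum => // j x _ _.
- by move=> x _; exact: nneseries_ge0.
rewrite /Khls EFinM -muleA; apply: lee_wpmul2l; first by rewrite lee_fin powR_ge0.
rewrite integral_nneseries//.
have mtop : measurable_fun setT (fun y => top (f y)).
  apply: measurable_funM => //.
  apply: (measurableT_comp (measurable_powR _)).
  exact: measurable_funM.
have t0 j y : 0 <= Kexp * (f y * term M j y).
  apply: mulr_ge0 => //; apply: mulr_ge0 => //; rewrite /term.
  by case: ifP => // _; exact: powR_ge0.
apply: (@le_trans _ _ (\sum_(j <oo) \int[mu]_y (Kexp * (f y * term M j y))%:E)%E).
  apply: lee_nneseries => [j _ _|j _]; first exact: integral_ge0.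
  rewrite ge0_integralZl// ?lee_fin ?powR_ge0//; exact: layer_integral.
rewrite -integral_nneseries//; last 2 first.
- move=> j; apply/measurable_EFinP; apply: measurable_funM => //.
  apply: measurable_funM => //; apply: measurable_fun_ifT => //.
  by apply: measurable_fun_ltr => //.
- by move=> j x _; rewrite lee_fin.
rewrite -ge0_integralZl//; last 3 first.
- by apply/measurable_EFinP; exact: (measurableT_comp (measurable_powR _)).
- by move=> y _; rewrite lee_fin powR_ge0.
- rewrite lee_fin mulr_ge0// divr_ge0 ?mulr_ge0 ?powR_ge0// subr_ge0.
  by have /andP[_ /ltW] := powR2_lt1 del0.
apply: le_integral_lower => y _; first by apply: nneseries_ge0 => j _ _; rewrite lee_fin.
under eq_eseriesr do rewrite mulrA EFinM.
rewrite nneseriesZl; last first.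
  by move=> j _; rewrite lee_fin /term; case: ifP => // _; exact: powR_ge0.
(* At fixed [y] only levels below [top (f y)] contribute, so the sum is of the size of its largest
   term, with a constant independent of the truncation [M]. *)
apply: (@le_trans _ _ ((Kexp * f y)%:E * (top (f y) `^ del / (1 - 2 `^ (- del)))%:E)%E).
  apply: lee_wpmul2l; first by rewrite lee_fin mulr_ge0.
  apply: dyadic_layer_series => //.
  by rewrite mulr_ge0 ?powR_ge0// ltW.
rewrite -!EFinM lee_fin -[leLHS]mulrA -[leRHS]mulrA; apply: ler_wpM2l => //.
by rewrite [leLHS]mulrA topE// mulrAC.
Qed.

Lemma riesz_hls_untruncated :
  (\int[mu]_x (F x `^ s) <= Khls%:E * \int[mu]_x (f x `^ q)%:E)%E.
Proof.
apply: integral_le_truncated => [x|M M0]; first exact: poweR_ge0.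
have M1 : 0 < M `^ s^-1 by rewrite powR_gt0.
apply: le_trans (riesz_hls_truncated M1).
apply: le_integral_lower => x _; first by rewrite le_min poweR_ge0 lee_fin ltW.
have [FM|MF] := leP (F x) (M `^ s^-1)%:E; first by rewrite ge_min lexx.
by rewrite poweR_EFin powR_powRVK ?(ltW M0) ?gt_eqF// ge_min lexx orbT.
Qed.

End normalized.

(** The domination of [F] is required at every radius because the proof lets the radius depend on
    the level. It is the only link between [F] and a kernel. *)
Lemma riesz_hls_normalized : exists2 K : R, 0 < K &
  forall (f : 'rV[R]_n -> R) (F : 'rV[R]_n -> \bar R),
  (forall x, 0 <= f x) -> measurable_fun setT f -> (forall x, (0 <= F x)%E) ->
  (forall rho x, 0 < rho ->
    (F x <= riesz_near gam rho (EFin \o f) x +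
            riesz_far gam rho (EFin \o f) x)%E) ->
  (\int[mu]_x (f x `^ q)%:E <= 1 -> \int[mu]_x (F x `^ s) <= K%:E)%E.
Proof.
exists Khls => // f F f0 mf F0 FS fq.
apply: (le_trans (riesz_hls_untruncated f0 mf F0 FS fq)).
rewrite -[leRHS]mule1; apply: lee_wpmul2l => //.
by rewrite lee_fin ltW.
Qed.

End hls.

(** * Dyadic domination of the Riesz kernel *)

Section riesz_kernel.
Context {R : realType} {n : nat}.
Local Notation mu := (@lebesgueRn R n).
Variable gam : R.
Hypothesis gamn : gam < n%:R.
Local Open Scope ereal_scope.

Let scale_half (a : R) : (0 < a)%R ->
  ((a / 2) `^ (gam - n%:R) = 2 `^ (n%:R - gam) * a `^ (gam - n%:R))%R.
Proof.
move=> a0; have := @powR_dyadicV _ a (gam - n%:R) 1 (ltW a0).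
by rewrite !expr1 => ->; rewrite opprB mulrC.
Qed.

Let powR_anti (a b : R) : (0 < a)%R -> (a <= b)%R ->
  (b `^ (gam - n%:R) <= a `^ (gam - n%:R))%R.
Proof. by apply: powR_antitone; rewrite subr_le0 ltW. Qed.

Let indicator (a : R) (x y : 'rV[R]_n) : \bar R :=
  (a `^ (gam - n%:R) * \1_(cube x (2 * a)) y)%:E.

(** Some radius [a] of the form [rho / 2^i] or [rho * 2^i] satisfies [a / 2 <= u <= a]. Its cube
    contains [y], and [u ^ (gam - n)] exceeds [a ^ (gam - n)] by a factor of at most
    [2 ^ (n - gam)]. *)
Lemma riesz_kernel_le (rho u : R) (x y : 'rV[R]_n) : (0 < rho)%R ->
  (`|x - y| <= u)%R ->
  (u `^ (gam - n%:R))%:E <= (2 `^ (n%:R - gam))%:E *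
    (\sum_(i <oo) indicator (rho / 2 ^+ i) x y +
     \sum_(i <oo) indicator (rho * 2 ^+ i) x y).
Proof.
move=> rho0 xyu.
have ind0 a : 0 <= indicator a x y by rewrite lee_fin mulr_ge0 ?powR_ge0.
have K0 : 0 <= (2 `^ (n%:R - gam))%:E :> \bar R by rewrite lee_fin powR_ge0.
have xyc a : (0 < a)%R -> (u <= a)%R -> indicator a x y = (a `^ (gam - n%:R))%:E.
  move=> a0 ua; rewrite /indicator indicE mem_set ?mulr1//.
  rewrite cubeE ?mulr_ge0 ?(ltW a0)//= mulrAC mulfV// mul1r distrC.
  exact: le_trans ua.
have : (0 <= u)%R by exact: le_trans xyu.
rewrite le_eqVlt => /predU1P[<-|u0].
  (* By convention 0 raised to the nonzero exponent [gam - n] is 0, so the kernel has no singular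
     value when [u = 0]. *)
  rewrite powR0 ?subr_eq0 ?lt_eqF// mule_ge0// adde_ge0// nneseries_ge0//.
have [ur|ru] := leP u rho.
  have [i /andP[iu ui]] := dyadic_floor u0 ur.
  have r0 : (0 < rho / 2 ^+ i)%R by rewrite divr_gt0// exprn_gt0.
  apply: (@le_trans _ _ ((2 `^ (n%:R - gam))%:E * indicator (rho / 2 ^+ i) x y)).
    rewrite xyc// -EFinM -scale_half// lee_fin; apply: powR_anti; first by rewrite divr_gt0.
    by rewrite -mulrA -invfM -exprSr ltW.
  apply: lee_wpmul2l => //; rewrite -[leLHS]adde0; apply: leeD.
    exact: (nneseries_ge_term (u := fun i => indicator (rho / 2 ^+ i) x y)).
  exact: nneseries_ge0.
have [i /andP[iu ui]] := dyadic_floor rho0 (ltW ru).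
have r0 : (0 < rho * 2 ^+ i.+1)%R by rewrite mulr_gt0// exprn_gt0.
apply: (@le_trans _ _ ((2 `^ (n%:R - gam))%:E * indicator (rho * 2 ^+ i.+1) x y)).
  rewrite xyc//; last by rewrite -ler_pdivrMr ?exprn_gt0// ltW.
  rewrite -EFinM -scale_half// lee_fin exprSr mulrA mulfK//; apply: powR_anti.
    by rewrite mulr_gt0// exprn_gt0.
  by rewrite -ler_pdivlMr ?exprn_gt0.
apply: lee_wpmul2l => //; rewrite -[leLHS]add0e; apply: leeD.
  exact: nneseries_ge0.
exact: (nneseries_ge_term (u := fun i => indicator (rho * 2 ^+ i) x y)).
Qed.

Let integral_indicator (a : nat -> R) (f : 'rV[R]_n -> R) x :
  (forall y, 0 <= f y)%R -> measurable_fun setT f ->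
  \int[mu]_y ((\sum_(i <oo) indicator (a i) x y) * (f y)%:E) =
  riesz_sum gam a (EFin \o f) x.
Proof.
move=> f0 mf.
have mind i : measurable_fun setT (indicator (a i) x).
  apply/measurable_EFinP; apply: measurable_funM => //.
  by apply: measurable_indic; exact: measurable_cube.
have ind0 i y : 0 <= indicator (a i) x y by rewrite lee_fin mulr_ge0 ?powR_ge0.
transitivity (\int[mu]_y \sum_(i <oo) ((f y)%:E * indicator (a i) x y)).
  by apply: eq_integral => y _; rewrite nneseriesZl 1?muleC.
rewrite integral_nneseries//; last 2 first.
- by move=> i; apply: emeasurable_funM => //; exact/measurable_EFinP.
- by move=> i y _; apply: mule_ge0; rewrite ?ind0 ?lee_fin.
apply: eq_eseriesr => i _; rewrite -ge0_integralZl//; last 4 first.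
- exact: measurable_cube.
- by apply: measurable_funTS; exact/measurable_EFinP.
- by move=> y _; rewrite lee_fin.
- by rewrite lee_fin powR_ge0.
rewrite [RHS]integral_mkcond; apply: eq_integral => y _.
rewrite patchE /indicator indicE; case: ifPn => _; rewrite ?mulr1 ?mulr0 ?mule0//.
by rewrite muleC.
Qed.

Lemma riesz_kernel_dominated (u : 'rV[R]_n -> R) (f : 'rV[R]_n -> R) x (rho : R) :
  (0 < rho)%R -> (forall y, `|x - y| <= u y)%R ->
  (forall y, 0 <= f y)%R -> measurable_fun setT f ->
  \int[mu]_y (u y `^ (gam - n%:R) * f y)%:E <=
  (2 `^ (n%:R - gam))%:E *
    (riesz_near gam rho (EFin \o f) x + riesz_far gam rho (EFin \o f) x).
Proof.
move=> rho0 xu f0 mf.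
have mind a : measurable_fun setT (indicator a x).
  apply/measurable_EFinP; apply: measurable_funM => //.
  by apply: measurable_indic; exact: measurable_cube.
have ind0 a y : 0 <= indicator a x y by rewrite lee_fin mulr_ge0 ?powR_ge0.
have mser (a : nat -> R) : measurable_fun setT
    (fun y => (\sum_(i <oo) indicator (a i) x y) * (f y)%:E).
  apply: emeasurable_funM; last exact/measurable_EFinP.
  exact: ge0_emeasurable_sum.
have ser0 (a : nat -> R) y : 0 <= (\sum_(i <oo) indicator (a i) x y) * (f y)%:E.
  by rewrite mule_ge0 ?lee_fin// nneseries_ge0.
rewrite /riesz_near /riesz_far -(integral_indicator (fun i => rho / 2 ^+ i)%R)//.
rewrite -(integral_indicator (fun i => rho * 2 ^+ i)%R)//.
rewrite -ge0_integralD//.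
rewrite -ge0_integralZl//; last 2 first.
- exact: emeasurable_funD.
- by move=> y _; exact: adde_ge0.
apply: le_integral_lower => y _; first by rewrite lee_fin mulr_ge0 ?powR_ge0.
rewrite -ge0_muleDl ?nneseries_ge0// muleA EFinM; apply: lee_wpmul2r; first by rewrite lee_fin.
exact: riesz_kernel_le.
Qed.

End riesz_kernel.

Section hardy_littlewood_sobolev.
Context {R : realType} {n : nat}.
Local Notation mu := (@lebesgueRn R n).
Variables gam q s : R.
Hypotheses (n0 : (0 < n)%N) (gam0 : 0 < gam) (gamn : gam < n%:R) (q1 : 1 < q)
  (qs : q < s).
Hypothesis gamE : gam / n%:R = q^-1 - s^-1.
Local Open Scope ereal_scope.

Lemma riesz_sumZ (a : nat -> R) (c : R) (f : 'rV[R]_n -> \bar R) x : (0 <= c)%R ->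
  (forall x, 0 <= f x) -> measurable_fun setT f ->
  riesz_sum gam a (fun y => c%:E * f y) x = c%:E * riesz_sum gam a f x.
Proof.
move=> c0 f0 mf; rewrite /riesz_sum -nneseriesZl; last first.
  by move=> i _; exact: riesz_term_ge0.
apply: eq_eseriesr => i _; rewrite ge0_integralZl//; last 2 first.
- exact: measurable_cube.
- exact: measurable_funTS.
by rewrite muleCA.
Qed.

(** The distance is any [u x y] above [|x - y|] because two choices are needed later: [|x - y|]
    itself for the local part of a slice estimate and [t + |x - y|] for the part far away. The
    general case follows from the normalized one by homogeneity. *)
Lemma hardy_littlewood_sobolev : exists2 K : R, (0 < K)%R &
  forall (u : 'rV[R]_n -> 'rV[R]_n -> R) (f : 'rV[R]_n -> R),
  (forall x y, `|x - y| <= u x y)%R ->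
  (forall y, 0 <= f y)%R -> measurable_fun setT f ->
  \int[mu]_x ((\int[mu]_y (u x y `^ (gam - n%:R) * f y)%:E) `^ s) <=
  K%:E * (\int[mu]_x (f x `^ q)%:E) `^ (s / q).
Proof.
have q0 : (0 < q)%R := lt_trans ltr01 q1.
have s0 : (0 < s)%R := lt_trans q0 qs.
have [K1 K10 hK1] := riesz_hls_normalized n0 gam0 q1 qs gamE.
set C := (2 `^ (n%:R - gam))%R.
have C0 : (0 < C)%R by rewrite powR_gt0.
exists (K1 * C `^ s)%R; first by rewrite mulr_gt0// powR_gt0.
move=> u f xu f0 mf.
set F := fun x => \int[mu]_y (u x y `^ (gam - n%:R) * f y)%:E.
have F0 x : 0 <= F x by apply: integral_ge0 => y _; rewrite lee_fin mulr_ge0 ?powR_ge0.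
set I := \int[mu]_x (f x `^ q)%:E.
have I0 : 0 <= I by apply: integral_ge0 => y _; rewrite lee_fin powR_ge0.
have mEf : measurable_fun setT (EFin \o f) by exact/measurable_EFinP.
have f0' y : 0 <= (EFin \o f) y by rewrite lee_fin.
(* [N] stands for the $L^q$ norm of [f], and [C] is the constant of [riesz_kernel_dominated];
   dividing [f] by [N] and [F] by [C N] leads to the normalized setting. *)
have key N : (0 < N)%R -> I <= (N `^ q)%:E ->
    \int[mu]_x (F x `^ s) <= (K1 * C `^ s * N `^ s)%:E.
  move=> N0 IN; have CN0 : (0 < C * N)%R by rewrite mulr_gt0.
  have Ni0 : (0 <= N^-1)%R by rewrite invr_ge0 ltW.
  have CNi0 : (0 <= (C * N)^-1)%R by rewrite invr_ge0 ltW.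
  pose f' y := (N^-1 * f y)%R.
  have : \int[mu]_x (((C * N)^-1%:E * F x) `^ s) <= K1%:E.
    apply: (hK1 f') => //.
    - by move=> y; rewrite mulr_ge0.
    - exact: measurable_funM.
    - by move=> x; rewrite mule_ge0// lee_fin.
    - move=> rho x rho0; rewrite lee_pdivrMl// [(C * N)%R]mulrC EFinM -muleA.
      have -> : riesz_near gam rho (EFin \o f') x =
          (N^-1)%:E * riesz_near gam rho (EFin \o f) x.
        by rewrite -riesz_sumZ.
      have -> : riesz_far gam rho (EFin \o f') x =
          (N^-1)%:E * riesz_far gam rho (EFin \o f) x.
        by rewrite -riesz_sumZ.
      rewrite -ge0_muleDr ?riesz_sum_ge0// muleCA (muleA N%:E) -EFinM mulfV ?gt_eqF// mul1e.
      exact: riesz_kernel_dominated.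
    - rewrite (eq_integral (fun x => (N^-1 `^ q)%:E * (f x `^ q)%:E)); last first.
        by move=> x _; rewrite powRM// EFinM.
      rewrite ge0_integralZl//; last 3 first.
      + by apply/measurable_EFinP; exact: (measurableT_comp (measurable_powR _)).
      + by move=> y _; rewrite lee_fin powR_ge0.
      + by rewrite lee_fin powR_ge0.
      have -> : (N^-1 `^ q = (N `^ q)^-1)%R.
        by rewrite -(powR_inv1 (ltW N0)) -powRrM mulN1r powRN.
      by rewrite lee_pdivrMl ?powR_gt0// mule1.
  move=> FK; have CNs : (0 < (C * N) `^ s)%R by rewrite powR_gt0.
  apply: (@le_trans _ _ (((C * N) `^ s)%:E *
      \int[mu]_x (((C * N)^-1%:E * F x) `^ s))).
    apply: le_trans (le_integral_lowerZl _ CNs _) => [|x]; last exact: poweR_ge0.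
    apply: le_integral_lower => x _; first exact: poweR_ge0.
    rewrite poweRM ?lee_fin// poweR_EFin muleA -EFinM -powRM ?(ltW CN0)//.
    by rewrite mulfV ?gt_eqF// powR1 mul1e.
  have -> : (K1 * C `^ s * N `^ s = (C * N) `^ s * K1)%R.
    by rewrite powRM ?(ltW C0) ?(ltW N0)//; ring.
  rewrite EFinM.
  by apply: lee_wpmul2l => //; rewrite lee_fin ltW.
have KC0 : (0 < K1 * C `^ s)%R by rewrite mulr_gt0// powR_gt0.
have sq0 : (0 < s / q)%R by rewrite divr_gt0.
have [->|Iy] := eqVneq I +oo.
  by rewrite poweRyr ?gt_eqF// gt0_muley ?leey// lte_fin.
have [i iE] : exists i : R, I = i%:E.
  by exists (fine I); rewrite fineK// ge0_fin_numE// ltey.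
have i0 : (0 <= i)%R by rewrite -lee_fin -iE.
move: i0; rewrite le_eqVlt => /predU1P[i0|i0].
  (* With a vanishing norm there is nothing to divide by, but every positive [N] is admissible; the
     one chosen makes the bound equal to [eps]. *)
  rewrite iE -i0 poweR0r ?gt_eqF// mule0; apply/lee_addgt0Pr => eps eps0.
  have N0 : (0 < (eps / (K1 * C `^ s)) `^ s^-1)%R by rewrite powR_gt0// divr_gt0.
  apply: le_trans (key _ N0 _) _; first by rewrite iE -i0 lee_fin powR_ge0.
  rewrite powR_powRVK ?gt_eqF// ?divr_ge0 ?(ltW eps0) ?(ltW KC0)//.
  by rewrite mulrC divfK ?gt_eqF// add0e.
have N0 : (0 < i `^ q^-1)%R by rewrite powR_gt0.
apply: le_trans (key _ N0 _) _.
  by rewrite iE powR_powRVK ?gt_eqF// ltW.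
by rewrite iE poweR_EFin -EFinM -powRrM mulrC [(q^-1 * _)%R]mulrC mulrC.
Qed.

End hardy_littlewood_sobolev.

(** * Riesz potentials on slice spaces *)

Section amalgam.
Context {R : realType} {n : nat}.
Local Notation mu := (@lebesgueRn R n).
Local Open Scope ereal_scope.

(* The centers of [5 ^ n] cubes of side [t / 2] that cover [cube x (2 * t)]. *)
Let shift (t : R) (x : 'rV[R]_n) (k : {ffun 'I_n -> 'I_5}) : 'rV[R]_n :=
  \row_i (x 0 i + ((k i)%:R - 2) * (t / 2))%R.

(** [k - 2] is an integer nearest to [v], obtained as the integer part of [v + 5 / 2] shifted by
    2. *)
Let near_int (v : R) : (-2 <= v <= 2)%R ->
  {k : 'I_5 | (`|v - (k%:R - 2)| <= 2^-1)%R}.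
Proof.
move=> /andP[v1 v2]; have w0 : (0 <= v + 5 / 2)%R by lra.
have /andP[k1 k2] := truncn_itv w0.
have k5 : (Num.trunc (v + 5 / 2) < 5)%N.
  by rewrite -(ltr_nat R); apply: le_lt_trans k1 _; lra.
exists (Ordinal k5) => /=; rewrite ler_norml; apply/andP; split.
  by move: k1 k2; rewrite -natr1; lra.
by move: k1 k2; rewrite -natr1; lra.
Qed.

Let cube_cover (t : R) (x : 'rV[R]_n) : (0 < t)%R ->
  cube x (2 * t) `<=` \bigcup_k cube (shift t x k) (t / 2).
Proof.
move=> t0 y xy.
have vi i : (-2 <= (y 0 i - x 0 i) / (t / 2) <= 2)%R.
  rewrite -ler_norml normrM [X in (_ * X)%R]gtr0_norm ?invr_gt0 ?divr_gt0//.
  rewrite ler_pdivrMr ?divr_gt0//; apply: le_trans (xy i) _.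
  by rewrite mulrA.
exists [ffun i => sval (near_int (vi i))] => // i; rewrite mxE ffunE.
have := svalP (near_int (vi i)); set k := sval _ => kv.
have -> : (y 0 i - (x 0 i + (k%:R - 2) * (t / 2)) =
   ((y 0 i - x 0 i) / (t / 2) - (k%:R - 2)) * (t / 2))%R.
  by field; rewrite gt_eqF.
rewrite normrM (gtr0_norm (divr_gt0 t0 _))// mulrC.
by rewrite ler_pM2l// divr_gt0.
Qed.

Let shift_sub (t : R) (x : 'rV[R]_n) k : (0 < t)%R ->
  cube (shift t x k) (t / 2) `<=` cube x (3 * t).
Proof.
move=> t0 y xy i; have := xy i; rewrite mxE.
have : (k i <= 4)%N by rewrite -ltnS.
rewrite -(ler_nat R) => k4; have k0 : (0 <= (k i)%:R :> R)%R by [].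
rewrite !ler_norml; nra.
Qed.

Let shift_mid (t : R) (c y w : 'rV[R]_n) : (0 < t)%R ->
  cube c (t / 2) y -> cube c (t / 2) w -> cube w t y.
Proof.
by move=> t0 cy cw i; move: (cy i) (cw i); rewrite !ler_norml; lra.
Qed.

Variables (t a b : R).
Hypotheses (t0 : (0 < t)%R) (a0 : (0 < a)%R) (b1 : (1 < b)%R).

Let NK : R := #|{ffun 'I_n -> 'I_5}|%:R.

(** A cube of side [t / 2] lies in [cube w t] for each of its points [w], so the integral over it is
    at most the [a]-mean over these [w] of the integrals over [cube w t]. Summing over the covering
    family of [NK] cubes costs [NK ^ a]. *)
Lemma cube_integral_le (psi : 'rV[R]_n -> \bar R) (x : 'rV[R]_n) :
  (forall y, 0 <= psi y) -> measurable_fun setT psi ->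
  (\int[mu]_(y in cube x (2 * t)) psi y) `^ a <=
  ((NK `^ a) * ((t / 2) ^+ n)^-1)%:E *
  \int[mu]_(w in cube x (3 * t)) ((\int[mu]_(y in cube w t) psi y) `^ a).
Proof.
move=> psi0 mpsi.
set J := \int[mu]_(w in cube x (3 * t)) _.
have U0 w : 0 <= \int[mu]_(y in cube w t) psi y by exact: integral_ge0.
have J0 : 0 <= J by apply: integral_ge0 => w _; exact: poweR_ge0.
have t2 : (0 < (t / 2) ^+ n)%R by rewrite exprn_gt0// divr_gt0.
have E0 k : 0 <= \int[mu]_(y in cube (shift t x k) (t / 2)) psi y by exact: integral_ge0.
have EJ k : \int[mu]_(y in cube (shift t x k) (t / 2)) psi y <=
    (((t / 2) ^+ n)^-1%:E * J) `^ a^-1.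
  rewrite -[leLHS](@poweR_powRK _ a)// ?gt_eqF//.
  apply: le_poweR; [by rewrite invr_ge0 ltW|exact: poweR_ge0|].
  rewrite lee_pdivlMl// muleC -(integral_cube_cst (shift t x k)); last first.
    by rewrite divr_ge0// ltW.
  apply: (@le_trans _ _ (\int[mu]_(w in cube (shift t x k) (t / 2))
      ((\int[mu]_(y in cube w t) psi y) `^ a))).
    apply: le_integral_lower => w wk; first exact: poweR_ge0.
    apply: le_poweR => //; first exact: ltW.
    apply: ge0_le_integral_subset => // y yk; exact: shift_mid yk wk.
  apply: ge0_le_integral_subset; last exact: shift_sub.
  by move=> w; exact: poweR_ge0.
apply: (@le_trans _ _ ((\sum_(k : {ffun 'I_n -> 'I_5})
     \int[mu]_(y in cube (shift t x k) (t / 2)) psi y) `^ a)).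
  apply: le_poweR; [exact: ltW|exact: integral_ge0|].
  pose psik k y := psi y * (\1_(cube (shift t x k) (t / 2)) y)%:E.
  have psik0 k y : 0 <= psik k y by rewrite mule_ge0// lee_fin.
  have -> : \sum_(k : {ffun 'I_n -> 'I_5})
      \int[mu]_(y in cube (shift t x k) (t / 2)) psi y =
      \int[mu]_y \sum_(k : {ffun 'I_n -> 'I_5}) psik k y.
    rewrite ge0_integral_sum//; last first.
      move=> k; apply: emeasurable_funM => //; apply/measurable_EFinP.
      by apply: measurable_indic; exact: measurable_cube.
    apply: eq_bigr => k _; rewrite [LHS]integral_mkcond; apply: eq_integral => y _.
    by rewrite patchE /psik indicE; case: ifP => _; rewrite ?mule1 ?mule0.
  rewrite integral_mkcond; apply: le_integral_lower => y _; first exact: erestrict_ge0.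
  rewrite patchE; case: ifPn => [/set_mem/(cube_cover t0)[k _ yk]|_]; last exact: sume_ge0.
  rewrite (bigD1 k)//= {1}/psik indicE mem_set// mule1 leeDl//.
  exact: sume_ge0.
apply: (@le_trans _ _ ((NK%:E * (((t / 2) ^+ n)^-1%:E * J) `^ a^-1) `^ a)).
  apply: le_poweR; [exact: ltW|exact: sume_ge0|].
  apply: le_trans (lee_sum _ (fun k _ => EJ k)) _.
  rewrite (eq_bigr (fun=> 1%:E * (((t / 2) ^+ n)^-1%:E * J) `^ a^-1)); last first.
    by move=> k _; rewrite mul1e.
  rewrite -ge0_sume_distrl; last by move=> k _; rewrite lee_fin.
  by rewrite sumEFin sumr_const.
rewrite poweRM ?poweR_ge0//; last by rewrite lee_fin ler0n.
rewrite poweR_powRVK ?gt_eqF// ?mule_ge0// ?lee_fin ?invr_ge0 ?(ltW t2)//.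
by rewrite poweR_EFin EFinM muleA.
Qed.

Let poweR_split (x : \bar R) : 0 <= x -> x `^ b = x * x `^ (b - 1).
Proof.
have b0 : (0 < b)%R := lt_trans ltr01 b1.
have bm0 : (0 < b - 1)%R by rewrite subr_gt0.
case: x => [x|_|//]; last by rewrite !poweRyr ?gt_eqF// mulyy.
by rewrite lee_fin => x0; rewrite !poweR_EFin -EFinM mulr_powRB1.
Qed.

(** A continuous form of the inclusion $\ell^a \subset \ell^{ab}$. In [J ^ b = J * J ^ (b - 1)],
    with [J] the local integral of [U], the second factor is at most a power of the global integral
    [I], and the first one integrates to a multiple of [I]. *)
Lemma amalgam_embedding (psi : 'rV[R]_n -> \bar R) :
  (forall y, 0 <= psi y) -> measurable_fun setT psi ->
  \int[mu]_x ((\int[mu]_(y in cube x (2 * t)) psi y) `^ (a * b)) <=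
  ((NK `^ a * ((t / 2) ^+ n)^-1) `^ b * (3 * t) ^+ n)%:E *
  (\int[mu]_x ((\int[mu]_(y in cube x t) psi y) `^ a)) `^ b.
Proof.
move=> psi0 mpsi; set C := (NK `^ a * _)%R.
have C0 : (0 <= C)%R.
  by rewrite mulr_ge0 ?powR_ge0// invr_ge0 exprn_ge0// divr_ge0// ltW.
have t30 : (0 <= 3 * t)%R by rewrite mulr_ge0// ltW.
pose U w := (\int[mu]_(y in cube w t) psi y) `^ a.
have U0 w : 0 <= U w by exact: poweR_ge0.
have mU : measurable_fun setT U.
  apply: (measurableT_comp (measurable_poweR a)).
  exact: measurable_cube_integral.
pose J x := \int[mu]_(w in cube x (3 * t)) U w.
have J0 x : 0 <= J x by exact: integral_ge0.
have mJ : measurable_fun setT J by exact: measurable_cube_integral.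
set I := \int[mu]_x (U x).
have I0 : 0 <= I by exact: integral_ge0.
have Cb0 : 0 <= (C `^ b)%:E by rewrite lee_fin powR_ge0.
apply: (@le_trans _ _ (\int[mu]_x ((C `^ b)%:E * (J x * I `^ (b - 1))))).
  apply: le_integral_lower => x _; first exact: poweR_ge0.
  rewrite poweRrM; apply: (@le_trans _ _ ((C%:E * J x) `^ b)).
    apply: le_poweR; [by rewrite ltW// (lt_trans ltr01)|exact: poweR_ge0|].
    exact: cube_integral_le.
  rewrite poweRM ?lee_fin// poweR_EFin; apply: lee_wpmul2l => //.
  rewrite poweR_split//; apply: lee_wpmul2l => //.
  apply: le_poweR => //; first by rewrite subr_ge0 ltW.
  exact: ge0_le_integral_subset.
rewrite ge0_integralZl//; last 2 first.
- by apply: emeasurable_funM.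
- by move=> x _; rewrite mule_ge0 ?poweR_ge0.
rewrite EFinM -muleA; apply: lee_wpmul2l => //.
rewrite ge0_integralZr ?poweR_ge0// integral_cube_integral//.
by rewrite -muleA -poweR_split.
Qed.

End amalgam.

Section riesz_potential.
Context {R : realType} {n : nat}.
Local Notation mu := (@lebesgueRn R n).
Local Notation V := 'rV[R]_n.
Local Open Scope ereal_scope.

Definition riesz_potential (gam : R) (u : V -> V -> R) (f : V -> R) (x : V) : \bar R :=
  \int[mu]_y (u x y `^ (gam - n%:R) * f y)%:E.

Definition sup_dist (x y : V) : R := `|(x - y)%R|.

Lemma riesz_potential_ge0 gam u f x : (forall y, 0 <= f y)%R ->
  0 <= riesz_potential gam u f x.
Proof.
by move=> f0; apply: integral_ge0 => y _; rewrite lee_fin mulr_ge0 ?powR_ge0.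
Qed.

Lemma measurable_riesz_kernel gam u (f : V -> R) :
  measurable_fun [set: V * V] (fun z => u z.1 z.2) -> measurable_fun setT f ->
  measurable_fun [set: V * V] (fun z => (u z.1 z.2 `^ (gam - n%:R) * f z.2)%:E).
Proof.
move=> mu' mf; apply/measurable_EFinP; apply: measurable_funM.
  exact: (measurableT_comp (measurable_powR _) mu').
exact: (measurableT_comp mf measurable_snd).
Qed.

Lemma measurable_riesz_potential gam u (f : V -> R) :
  measurable_fun [set: V * V] (fun z => u z.1 z.2) ->
  (forall y, 0 <= f y)%R -> measurable_fun setT f ->
  measurable_fun setT (riesz_potential gam u f).
Proof.
move=> mu' f0 mf.
pose k (z : V * V) := (u z.1 z.2 `^ (gam - n%:R) * f z.2)%:E.
rewrite (_ : riesz_potential gam u f = fubini_F mu k)//.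
apply: measurable_fun_fubini_tonelli_F; first exact: measurable_riesz_kernel.
by move=> z; rewrite lee_fin mulr_ge0 ?powR_ge0.
Qed.

Variables (gam t : R).
Hypotheses (gamn : (gam < n%:R)%R) (t0 : (0 < t)%R).

Let tn0 : (0 < t ^+ n)%R. Proof. exact: exprn_gt0. Qed.

Definition cube_mean (f : V -> R) (w : V) : R :=
  fine ((t ^+ n)^-1%:E * \int[mu]_(z in cube w t) (f z)%:E).

Section split.
Variable f : V -> R.
Hypotheses (f0 : (forall y, 0 <= f y)%R) (mf : measurable_fun setT f).
Hypothesis fint : forall x, \int[mu]_(z in cube x t) (f z)%:E < +oo.

Lemma cube_meanE w :
  (cube_mean f w)%:E = (t ^+ n)^-1%:E * \int[mu]_(z in cube w t) (f z)%:E.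
Proof.
rewrite fineK// ge0_fin_numE.
  by rewrite lte_mul_pinfty ?lee_fin ?invr_ge0 ?(ltW tn0).
rewrite mule_ge0 ?lee_fin ?invr_ge0 ?(ltW tn0)//; apply: integral_ge0 => y _.
by rewrite lee_fin.
Qed.

Lemma cube_mean_ge0 w : (0 <= cube_mean f w)%R.
Proof.
rewrite -lee_fin cube_meanE mule_ge0 ?lee_fin ?invr_ge0 ?(ltW tn0)//.
by apply: integral_ge0 => y _; rewrite lee_fin.
Qed.

Lemma measurable_cube_mean : measurable_fun setT (cube_mean f).
Proof.
apply/measurable_EFinP; rewrite (_ : EFin \o _ =
    fun w => (t ^+ n)^-1%:E * \int[mu]_(z in cube w t) (f z)%:E); last first.
  by apply/funext => w /=; rewrite cube_meanE.
apply: emeasurable_funM => //; apply: measurable_cube_integral.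
  by move=> y; rewrite lee_fin.
exact/measurable_EFinP.
Qed.

(** Here [|y - z| > t / 2], so [t + |x - w| <= 2 t + |y - z| <= 5 |y - z|] for every [w] in
    [cube z t]; this is the origin of the 5. Averaging over [w] prepares the exchange that replaces
    [f] by its cube means. *)
Let far_kernel (x y z : V) : cube x t y -> ~ cube x (2 * t) z ->
  (sup_dist y z `^ (gam - n%:R))%:E <= (5 `^ (n%:R - gam) / t ^+ n)%:E *
  \int[mu]_(w in cube z t) ((t + sup_dist x w) `^ (gam - n%:R))%:E.
Proof.
move=> cxy cxz.
have xy : (`|y - x| <= t / 2)%R by move: cxy; rewrite cubeE ?(ltW t0).
have xz : (t < `|z - x|)%R.
  rewrite ltNge; apply/negP => zx; apply: cxz.
  by rewrite cubeE ?mulr_ge0 ?(ltW t0)//= mulrAC mulfV// mul1r.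
have yz : (t / 2 < `|y - z|)%R.
  have : (`|z - x| <= `|y - z| + `|y - x|)%R.
    by rewrite (distrC y z) -(subrKA y) ler_normD.
  by move: xy xz; lra.
pose k := (sup_dist y z `^ (gam - n%:R))%R.
pose c := (5 `^ (n%:R - gam) / t ^+ n)%R.
have c0 : (0 < c)%R by rewrite divr_gt0// powR_gt0.
rewrite (_ : k%:E = c%:E * (5 `^ (gam - n%:R) * k)%:E * (t ^+ n)%:E).
  rewrite -muleA; apply: lee_wpmul2l; first by rewrite lee_fin ltW.
  rewrite -(integral_cube_cst z); last exact: ltW.
  apply: le_integral_lower => w; rewrite cubeE ?(ltW t0)//= => zw.
    by rewrite lee_fin mulr_ge0 ?powR_ge0.
  rewrite lee_fin -powRM ?normr_ge0//; apply: powR_antitone.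
  - by rewrite subr_le0 ltW.
  - by rewrite ltr_wpDr// normr_ge0.
  rewrite /sup_dist; have : (`|x - w| <= `|y - x| + `|y - z| + `|w - z|)%R.
    rewrite (distrC y x) (distrC w z) -(subrKA y) (le_trans (ler_normD _ _))//.
    by rewrite -addrA lerD2l -(subrKA z) ler_normD.
  by move: xy yz zw; lra.
rewrite -!EFinM; congr EFin; rewrite -/k /c.
have -> : (5 `^ (gam - n%:R) = (5 `^ (n%:R - gam))^-1)%R by rewrite -powRN opprB.
by field; rewrite !gt_eqF// powR_gt0.
Qed.

Lemma riesz_potential_split (x y : V) : cube x t y ->
  riesz_potential gam sup_dist f y <=
  riesz_potential gam sup_dist (fun z => f z * \1_(cube x (2 * t)) z)%R y +
  (5 `^ (n%:R - gam))%:E *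
  riesz_potential gam (fun x w => t + sup_dist x w)%R (cube_mean f) x.
Proof.
move=> xy; pose Q := cube x (2 * t).
have mQ : measurable Q by exact: measurable_cube.
pose k1 z := (sup_dist y z `^ (gam - n%:R) * (f z * \1_Q z))%R.
pose kx w := ((t + sup_dist x w) `^ (gam - n%:R))%R.
pose B z := (5 `^ (n%:R - gam) / t ^+ n)%:E * \int[mu]_(w in cube z t) (kx w)%:E.
have kx0 w : 0 <= (kx w)%:E by rewrite lee_fin powR_ge0.
have mdist w : measurable_fun setT (sup_dist w).
  exact: (measurableT_comp measurable_rV_dist (pair1_measurable w)).
have mkx : measurable_fun setT (EFin \o kx).
  apply/measurable_EFinP; apply: (measurableT_comp (measurable_powR _)).
  exact: measurable_funD.
have c0 : 0 <= (5 `^ (n%:R - gam) / t ^+ n)%:E.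
  by rewrite lee_fin divr_ge0 ?powR_ge0 ?(ltW tn0).
have mf' : measurable_fun setT (EFin \o f) by exact/measurable_EFinP.
have B0 z : 0 <= B z by rewrite mule_ge0// integral_ge0.
have mB : measurable_fun setT B.
  by apply: emeasurable_funM => //; exact: measurable_cube_integral.
apply: (@le_trans _ _ (\int[mu]_z ((k1 z)%:E + (f z)%:E * B z))).
  apply: le_integral_lower => z _; first by rewrite lee_fin mulr_ge0 ?powR_ge0.
  rewrite /k1 indicE; case: (boolP (z \in Q)) => zQ.
    by rewrite mulr1 leeDl// mule_ge0// lee_fin.
  rewrite !mulr0 add0e mulrC EFinM; apply: lee_wpmul2l; first by rewrite lee_fin.
  by apply: far_kernel => // Qz; move/negP: zQ; apply; exact/mem_set.
rewrite ge0_integralD//; last 4 first.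
- by move=> z _; rewrite lee_fin mulr_ge0 ?powR_ge0// mulr_ge0.
- apply/measurable_EFinP; apply: measurable_funM; last first.
    by apply: measurable_funM => //; exact: measurable_indic.
  exact: (measurableT_comp (measurable_powR _)).
- by move=> z _; rewrite mule_ge0// lee_fin.
- by apply: emeasurable_funM.
apply: leeD => //.
rewrite (eq_integral (fun z => (5 `^ (n%:R - gam) / t ^+ n)%:E *
  ((f z)%:E * \int[mu]_(w in cube z t) (kx w)%:E))); last first.
  by move=> z _; rewrite /B muleCA.
rewrite ge0_integralZl//; last 2 first.
- by apply: emeasurable_funM => //; exact: measurable_cube_integral.
- by move=> z _; rewrite mule_ge0 ?lee_fin ?integral_ge0.
(* The average over cubes passes from the kernel to [f], where together with the factor [1 / t^n] it
   forms [cube_mean]. *)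
rewrite -(@cube_fubini _ _ t (EFin \o f))//.
rewrite EFinM -muleA; apply: lee_wpmul2l; first by rewrite lee_fin powR_ge0.
rewrite -ge0_integralZl//; last 3 first.
- by apply: emeasurable_funM => //; apply: measurable_cube_integral.
- by move=> z _; apply: mule_ge0 => //; apply: integral_ge0 => w _; rewrite lee_fin.
- by rewrite lee_fin invr_ge0 ltW.
rewrite le_eqVlt; apply/orP; left; apply/eqP; apply: eq_integral => w _.
by rewrite [RHS]EFinM cube_meanE muleCA.
Qed.

End split.

End riesz_potential.

Section slice_hls.
Context {R : realType} {n : nat}.
Local Notation mu := (@lebesgueRn R n).
Local Notation V := 'rV[R]_n.
Variables gam t p q r s : R.
Hypotheses (n0 : (0 < n)%N) (gam0 : 0 < gam) (gamn : gam < n%:R) (t0 : 0 < t)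
  (p1 : 1 < p) (pr : p < r) (q1 : 1 < q) (qs : q < s).
Hypotheses (gampr : gam / n%:R = p^-1 - r^-1) (gamqs : gam / n%:R = q^-1 - s^-1).
Local Open Scope ereal_scope.

Let p0 : (0 < p)%R. Proof. exact: lt_trans p1. Qed.
Let q0 : (0 < q)%R. Proof. exact: lt_trans q1. Qed.
Let r0 : (0 < r)%R. Proof. exact: lt_trans pr. Qed.
Let s0 : (0 < s)%R. Proof. exact: lt_trans qs. Qed.
Let tn0 : (0 < t ^+ n)%R. Proof. exact: exprn_gt0. Qed.

Let measurable_sup_dist : measurable_fun [set: V * V] (fun z => sup_dist z.1 z.2).
Proof. exact: measurable_rV_dist. Qed.

(** Hoelder's inequality on one cube; integrated over [w], it controls the $L^q$ norm of the means
    by the slice norm of [f]. *)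
Lemma cube_mean_power_le (f : V -> R) w :
  (forall y, 0 <= f y)%R -> measurable_fun setT f ->
  (forall x, \int[mu]_(z in cube x t) (f z)%:E < +oo) ->
  (cube_mean t f w `^ q)%:E <=
  (((t ^+ n)^-1 * (2 * (t ^+ n) `^ (1 - p^-1))) `^ q)%:E *
  (\int[mu]_(y in cube w t) (f y `^ p)%:E) `^ (q / p).
Proof.
move=> f0 mf fint; set c := (_ * _)%R.
have c0 : (0 <= c)%R by rewrite mulr_ge0 ?invr_ge0 ?(ltW tn0)// mulr_ge0// powR_ge0.
set U := \int[mu]_(y in cube w t) (f y `^ p)%:E.
have U0 : 0 <= U by apply: integral_ge0 => y _; rewrite lee_fin powR_ge0.
rewrite (_ : (q / p)%R = (p^-1 * q)%R); last by rewrite mulrC.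
rewrite poweRrM -poweR_EFin -[X in X * _]poweR_EFin -poweRM ?lee_fin ?poweR_ge0//.
apply: le_poweR; [exact: ltW|by rewrite lee_fin cube_mean_ge0|].
rewrite cube_meanE// EFinM -muleA; apply: lee_wpmul2l; first by rewrite lee_fin invr_ge0 ltW.
have := @integral_le_holder_poweR _ V R mu (cube w t) (EFin \o f) p (t ^+ n)%R
  (measurable_cube w t).
apply => //.
- by apply: measurable_funTS; exact/measurable_EFinP.
- by apply: mu_cube_le; exact: ltW.
Qed.

(** The local part leads to the integral of [A ^ (s / p)] over cubes of side [2 t], whereas the
    slice norm of [f] has the power [q / p] and cubes of side [t]. Both discrepancies are removed by
    [amalgam_embedding] with [a = q / p] and [b = s / q]. *)
Lemma slice_riesz_potential : exists2 K : R, (0 <= K)%R & forall f : V -> R,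
  (forall y, 0 <= f y)%R -> measurable_fun setT f ->
  (forall x, \int[mu]_(z in cube x t) (f z)%:E < +oo) ->
  \int[mu]_x ((\int[mu]_(y in cube x t) (riesz_potential gam sup_dist f y `^ r)) `^ (s / r)) <=
  K%:E * (\int[mu]_x ((\int[mu]_(y in cube x t) (f y `^ p)%:E) `^ (q / p))) `^ (s / q).
Proof.
have [K1 K10 hK1] := hardy_littlewood_sobolev n0 gam0 gamn p1 pr gampr.
have [K2 K20 hK2] := hardy_littlewood_sobolev n0 gam0 gamn q1 qs gamqs.
pose C5 := (5 `^ (n%:R - gam))%R.
pose C1 := (2 `^ r * (K1 + t ^+ n * C5 `^ r))%R.
pose K3 := ((#|{ffun 'I_n -> 'I_5}|%:R `^ (q / p) * ((t / 2) ^+ n)^-1) `^ (s / q)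
  * (3 * t) ^+ n)%R.
pose C4 := (((t ^+ n)^-1 * (2 * (t ^+ n) `^ (1 - p^-1))) `^ q)%R.
have C50 : (0 <= C5)%R by exact: powR_ge0.
have C10 : (0 <= C1)%R.
  by rewrite mulr_ge0 ?powR_ge0// addr_ge0 ?(ltW K10)// mulr_ge0 ?powR_ge0// ltW.
have K30 : (0 <= K3)%R by rewrite mulr_ge0 ?powR_ge0// exprn_ge0// mulr_ge0// ltW.
have C40 : (0 <= C4)%R by exact: powR_ge0.
have sr0 : (0 < s / r)%R by rewrite divr_gt0.
have sq0 : (0 < s / q)%R by rewrite divr_gt0.
exists (C1 `^ (s / r) * 2 `^ (s / r) * (K3 + K2 * C4 `^ (s / q)))%R.
  by rewrite mulr_ge0 ?mulr_ge0 ?powR_ge0// addr_ge0// mulr_ge0 ?powR_ge0// ltW.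
move=> f f0 mf fint.
pose psi y := (f y `^ p)%:E.
have psi0 y : 0 <= psi y by rewrite lee_fin powR_ge0.
have mpsi : measurable_fun setT psi.
  by apply/measurable_EFinP; exact: (measurableT_comp (measurable_powR _)).
pose A x := \int[mu]_(y in cube x (2 * t)) psi y.
pose U x := \int[mu]_(y in cube x t) psi y.
have A0 x : 0 <= A x by exact: integral_ge0.
have U0 x : 0 <= U x by exact: integral_ge0.
have mA : measurable_fun setT A by exact: measurable_cube_integral.
have mU : measurable_fun setT U by exact: measurable_cube_integral.
set Y := \int[mu]_x (U x `^ (q / p)).
have Y0 : 0 <= Y by apply: integral_ge0 => x _; exact: poweR_ge0.
pose g := cube_mean t f.
have g0 w : (0 <= g w)%R by exact: cube_mean_ge0.
have mg : measurable_fun setT g by exact: measurable_cube_mean.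
pose H := riesz_potential gam (fun x w => t + sup_dist x w)%R g.
have H0 x : 0 <= H x by exact: riesz_potential_ge0.
have mH : measurable_fun setT H.
  apply: measurable_riesz_potential => //; exact: measurable_funD.
have C10' : 0 <= C1%:E by rewrite lee_fin.
have inner x : \int[mu]_(y in cube x t) (riesz_potential gam sup_dist f y `^ r) <=
    C1%:E * (A x `^ (r / p) + H x `^ r).
  pose f1 z := (f z * \1_(cube x (2 * t)) z)%R.
  have f10 z : (0 <= f1 z)%R by rewrite mulr_ge0.
  have mf1 : measurable_fun setT f1.
    by apply: measurable_funM => //; apply: measurable_indic; exact: measurable_cube.
  pose I1 := riesz_potential gam sup_dist f1.
  have I10 y : 0 <= I1 y by exact: riesz_potential_ge0.
  have mI1 : measurable_fun setT I1 by exact: measurable_riesz_potential.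
  have mI1r : measurable_fun setT (fun y => I1 y `^ r).
    exact: (measurableT_comp (measurable_poweR r)).
  have CH0 : 0 <= C5%:E * H x by rewrite mule_ge0 ?lee_fin.
  apply: (@le_trans _ _ (\int[mu]_(y in cube x t)
      ((2 `^ r)%:E * (I1 y `^ r + (C5%:E * H x) `^ r)))).
    apply: le_integral_lower => y yx; first exact: poweR_ge0.
    apply: le_trans (poweRD_le (ltW r0) (I10 y) CH0).
    apply: le_poweR; [exact: ltW|exact: riesz_potential_ge0|].
    exact: riesz_potential_split.
  rewrite ge0_integralZl//; last 3 first.
  - exact: measurable_cube.
  - by apply: measurable_funTS; apply: emeasurable_funD.
  - by move=> y _; rewrite adde_ge0 ?poweR_ge0.
  rewrite /C1 [in leRHS]EFinM -[leRHS]muleA.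
  apply: lee_wpmul2l; first by rewrite lee_fin powR_ge0.
  rewrite ge0_integralD//; last 4 first.
  - exact: measurable_cube.
  - by move=> y _; exact: poweR_ge0.
  - exact: measurable_funTS.
  - by move=> y _; exact: poweR_ge0.
  rewrite integral_cube_cst ?(ltW t0)//.
  have K1C : 0 <= K1%:E /\ 0 <= (t ^+ n * C5 `^ r)%:E.
    by rewrite !lee_fin mulr_ge0 ?powR_ge0 ?(ltW tn0) ?(ltW K10).
  apply: (@le_trans _ _ (K1%:E * A x `^ (r / p) + (t ^+ n * C5 `^ r)%:E * H x `^ r)).
    apply: leeD; last by rewrite poweRM ?lee_fin// poweR_EFin EFinM muleC muleA.
    apply: (@le_trans _ _ (\int[mu]_y (I1 y `^ r))).
      by apply: ge0_le_integral_subset => // y; exact: poweR_ge0.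
    have dd (x' y' : V) : (`|(x' - y')%R| <= sup_dist x' y')%R by [].
    have h1 := hK1 sup_dist f1 dd f10 mf1.
    apply: (le_trans h1).
    apply: lee_wpmul2l; first exact: K1C.1.
    apply: le_poweR; first by rewrite ltW// divr_gt0.
      by apply: integral_ge0 => y _; rewrite lee_fin powR_ge0.
    rewrite /A [leRHS]integral_mkcond; apply: le_integral_lower => y _.
      by rewrite lee_fin powR_ge0.
    rewrite /f1 indicE patchE; case: ifP => _; first by rewrite mulr1.
    by rewrite mulr0 powR0// gt_eqF.
  have X0 : 0 <= A x `^ (r / p) by exact: poweR_ge0.
  have Z0 : 0 <= H x `^ r by exact: poweR_ge0.
  rewrite EFinD ge0_muleDl; [|exact: K1C.1|exact: K1C.2].
  apply: leeD; apply: lee_wpmul2l; rewrite ?K1C.1 ?K1C.2 ?leeDl ?leeDr//.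
have mAs : measurable_fun setT (fun x => A x `^ (q / p * (s / q))).
  exact: (measurableT_comp (measurable_poweR _)).
have mHs : measurable_fun setT (fun x => H x `^ s).
  exact: (measurableT_comp (measurable_poweR _)).
apply: (@le_trans _ _ (\int[mu]_x ((C1 `^ (s / r) * 2 `^ (s / r))%:E *
    (A x `^ (q / p * (s / q)) + H x `^ s)))).
  apply: le_integral_lower => x _; first exact: poweR_ge0.
  apply: le_trans (le_poweR (ltW sr0) _ (inner x)) _.
    by apply: integral_ge0 => y _; exact: poweR_ge0.
  rewrite poweRM ?adde_ge0 ?poweR_ge0// poweR_EFin EFinM -muleA.
  apply: lee_wpmul2l; first by rewrite lee_fin powR_ge0.
  apply: le_trans (poweRD_le (ltW sr0) (poweR_ge0 _ _) (poweR_ge0 _ _)) _.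
  apply: lee_wpmul2l; first by rewrite lee_fin powR_ge0.
  rewrite -!poweRrM (_ : r / p * (s / r) = q / p * (s / q))%R; last by field; rewrite !gt_eqF.
  by rewrite (_ : r * (s / r) = s)%R//; field; rewrite gt_eqF.
rewrite ge0_integralZl//; last 3 first.
- exact: emeasurable_funD.
- by move=> x _; rewrite adde_ge0 ?poweR_ge0.
- by rewrite lee_fin mulr_ge0 ?powR_ge0.
rewrite [in leRHS]EFinM -[leRHS]muleA; apply: lee_wpmul2l; first by rewrite lee_fin mulr_ge0 ?powR_ge0.
rewrite ge0_integralD//; last 2 first.
- by move=> x _; exact: poweR_ge0.
- by move=> x _; exact: poweR_ge0.
have Ysq0 : 0 <= Y `^ (s / q) by exact: poweR_ge0.
have K2C : (0 <= K2 * C4 `^ (s / q))%R by rewrite mulr_ge0 ?powR_ge0// ltW.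
rewrite EFinD ge0_muleDl; [|by rewrite lee_fin|by rewrite lee_fin].
apply: leeD.
  apply: amalgam_embedding => //; first by rewrite divr_gt0.
  by rewrite ltr_pdivlMr// mul1r.
apply: le_trans (hK2 (fun x w => t + sup_dist x w)%R g _ g0 mg) _.
  by move=> x y; rewrite lerDr ltW.
rewrite EFinM -muleA; apply: lee_wpmul2l; first by rewrite lee_fin ltW.
rewrite -poweR_EFin -poweRM ?lee_fin//; apply: le_poweR; first exact: ltW.
  by apply: integral_ge0 => y _; rewrite lee_fin powR_ge0.
rewrite -ge0_integralZl//; last 2 first.
- exact: (measurableT_comp (measurable_poweR _)).
- by move=> y _; exact: poweR_ge0.
apply: le_integral_lower => w _; first by rewrite lee_fin powR_ge0.
exact: cube_mean_power_le.
Qed.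

End slice_hls.

(** * The rough kernel and sufficiency of the Lipschitz condition *)

Section enorm.
Context {R : realType} {n : nat}.
Local Notation V := 'rV[R]_n.
Implicit Types x y z : V.

Lemma enorm_ge0 x : 0 <= enorm x. Proof. exact: sqrtr_ge0. Qed.

Lemma sqr_enorm x : enorm x ^+ 2 = \sum_(i < n) x 0 i ^+ 2.
Proof. by rewrite sqr_sqrtr// sumr_ge0// => i _; exact: sqr_ge0. Qed.

Lemma norm_le_enorm x : `|x| <= enorm x.
Proof.
rewrite rV_norm_le ?enorm_ge0//; apply/forallP => i.
rewrite -sqrtr_sqr ler_wsqrtr// (bigD1 i)//= lerDl sumr_ge0// => j _.
exact: sqr_ge0.
Qed.

Lemma enorm_le_norm x : enorm x <= n%:R * `|x|.
Proof.
rewrite -(@ler_pXn2r _ 2)// ?nnegrE ?enorm_ge0 ?mulr_ge0// sqr_enorm exprMn.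
apply: (@le_trans _ _ (\sum_(i < n) `|x| ^+ 2)).
  apply: ler_sum => i _; rewrite -(@real_normK _ (x 0 i)) ?num_real// ler_pXn2r ?nnegrE//.
  exact: coord_le_norm.
rewrite sumr_const card_ord -[leLHS]mulr_natl ler_wpM2r ?sqr_ge0//.
by rewrite -natrX ler_nat; case: n => // k; rewrite expnS expn1 leq_pmulr.
Qed.

Lemma enorm0 : enorm (0 : V) = 0.
Proof. by rewrite /enorm big1 ?sqrtr0// => i _; rewrite mxE expr0n. Qed.

Lemma enorm_gt0 x : (0 < enorm x) = (x != 0).
Proof.
have [->|x0] := eqVneq; first by rewrite enorm0 ltxx.
by apply: lt_le_trans (norm_le_enorm x); rewrite normr_gt0.
Qed.

Lemma enormZ (c : R) x : enorm (c *: x) = `|c| * enorm x.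
Proof.
rewrite /enorm -sqrtr_sqr -sqrtrM ?sqr_ge0// mulr_sumr; congr Num.sqrt.
by apply: eq_bigr => i _; rewrite mxE exprMn.
Qed.

Lemma sphere_unit x : x != 0 -> sphere ((enorm x)^-1 *: x).
Proof.
rewrite -enorm_gt0 => x0; rewrite /sphere/= enormZ ger0_norm ?invr_ge0 ?(ltW x0)//.
by rewrite mulVf// gt_eqF.
Qed.

Lemma continuous_enorm : continuous (@enorm R n).
Proof.
have csum : continuous (fun x : V => \sum_(i < n) x 0 i ^+ 2 : R).
  apply: continuous_big => [|i _ x].
    by move=> z; apply: cvgD; [exact: cvg_fst|exact: cvg_snd].
  apply: (@continuous_comp _ _ _ (fun x : V => x 0 i) (fun y : R => y ^+ 2)).
    exact: coord_continuous.
  exact: exprn_continuous.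
move=> x; apply: (@continuous_comp _ _ _ _ (@Num.sqrt R)); first exact: csum.
exact: sqrt_continuous.
Qed.

End enorm.

Section rough_kernel.
Context {R : realType} {n : nat}.
Local Notation V := 'rV[R]_n.
Variables (alpha : R) (Omega : V -> R).
Hypothesis hhomog : forall (lambda : R) x, 0 < lambda -> sphere x ->
  Omega (lambda *: x) = Omega x.
Hypothesis hlip : lipschitz_on_sphere Omega.

Lemma Omega_unit x : x != 0 -> Omega x = Omega ((enorm x)^-1 *: x).
Proof.
move=> x0; have e0 : 0 < enorm x by rewrite enorm_gt0.
rewrite -(hhomog e0 (sphere_unit x0)) scalerA mulfV ?gt_eqF// scale1r//.
Qed.

(** Comparison with one fixed point of the sphere, using that unit vectors are at sup distance at
    most 2. If the sphere is empty, there is no nonzero vector either. *)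
Lemma Omega_bounded : exists2 M : R, 0 < M & forall x, x != 0 -> `|Omega x| <= M.
Proof.
have [C hC] := hlip.
have [[e se]|noe] := pselect (exists e : V, sphere e); last first.
  by exists 1 => // x x0; exfalso; apply: noe; exists ((enorm x)^-1 *: x); exact: sphere_unit.
exists (`|Omega e| + `|C| * (n%:R * 2) + 1).
  by rewrite ltr_wpDl// addr_ge0// mulr_ge0// mulr_ge0.
move=> x x0; rewrite (Omega_unit x0); set u := _ *: x.
have su : sphere u by exact: sphere_unit.
rewrite -(subrK (Omega e) (Omega u)) (le_trans (ler_normD _ _))// addrC.
rewrite -addrA lerD2l ler_wpDr//; apply: le_trans (hC _ _ su se) _.
apply: (@le_trans _ _ (`|C| * enorm (u - e))).
  by rewrite ler_wpM2r ?enorm_ge0// ler_norm.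
apply: ler_wpM2l => //; apply: le_trans (enorm_le_norm _) _.
apply: ler_wpM2l => //; apply: le_trans (ler_normB _ _) _.
have := norm_le_enorm u; have := norm_le_enorm e.
by rewrite se su; move=> h1 h2; rewrite (le_trans (lerD h2 h1))// -natr1.
Qed.

Definition rough_kernel (z : V) : R := Omega z / enorm z `^ (n%:R - alpha).

Hypothesis alphan : alpha < n%:R.

(** A matter of conventions: 0 to a nonzero power is 0, and so is the inverse of 0. The diagonal
    contributes nothing, whatever [Omega 0] is. *)
Lemma rough_kernel0 : rough_kernel 0 = 0.
Proof.
by rewrite /rough_kernel enorm0 powR0 ?invr0 ?mulr0// subr_eq0 gt_eqF.
Qed.

Lemma rough_kernel_le M (z : V) : 0 <= M -> (forall x, x != 0 -> `|Omega x| <= M) ->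
  `|rough_kernel z| <= M * enorm z `^ (alpha - n%:R).
Proof.
move=> M0 hM; have [->|z0] := eqVneq z 0.
  by rewrite rough_kernel0 normr0 mulr_ge0 ?powR_ge0.
rewrite /rough_kernel -powRN opprB normrM [X in _ * X <= _]ger0_norm ?powR_ge0//.
by apply: ler_wpM2r; [exact: powR_ge0|exact: hM].
Qed.

Lemma enorm_powR_le e (z : V) : e < 0 -> enorm z `^ e <= `|z| `^ e.
Proof.
move=> e0; have [->|z0] := eqVneq z 0; first by rewrite enorm0 normr0.
by apply: powR_antitone; [exact: ltW|rewrite normr_gt0|exact: norm_le_enorm].
Qed.

Lemma near_neq0 (z : V) : z != 0 -> \forall y \near z, y != 0.
Proof.
move=> z0; apply/nbhs_ballP; exists `|z| => /=; first by rewrite normr_gt0.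
move=> y; rewrite -ball_normE/=; apply: contraTneq => ->.
by rewrite subr0 ltxx.
Qed.

(** The Lipschitz bound holds on the sphere only; homogeneity factors [Omega] through the radial
    projection, which is continuous away from 0. *)
Lemma Omega_continuous z : z != 0 -> {for z, continuous Omega}.
Proof.
move=> z0; have [C hC] := hlip.
pose u (y : V) := (enorm y)^-1 *: y.
have uz : {for z, continuous u}.
  apply: continuousZ; last exact: cvg_id.
  by apply: continuousV; [rewrite gt_eqF// enorm_gt0|exact: continuous_enorm].
pose h (y : V) := `|C| * enorm (u y - u z).
have hz : {for z, continuous h}.
  apply: continuousM; first exact: cst_continuous.
  apply: (@continuous_comp _ _ _ (fun y => u y - u z) (@enorm R n)); last exact: continuous_enorm.
  by apply: continuousB; [exact: uz|exact: cst_continuous].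
have hz0 : h z = 0 by rewrite /h subrr enorm0 mulr0.
have FF : Filter (nbhs z) by apply: nbhs_filter.
apply/(@cvgrPdist_le _ _ _ (nbhs z) FF) => eps eps0; near=> y.
have y0 : y != 0.
  by near: y; exact: near_neq0.
rewrite distrC (Omega_unit y0) (Omega_unit z0).
apply: le_trans (hC _ _ (sphere_unit y0) (sphere_unit z0)) _.
apply: (@le_trans _ _ (h y)).
  by rewrite ler_wpM2r ?enorm_ge0// ler_norm.
near: y; move/cvgrPdist_le : hz => /(_ _ eps0); apply: filterS => y.
by rewrite hz0 sub0r normrN; apply: le_trans; exact: ler_norm.
Unshelve. all: by end_near. Qed.

(** Continuity of [Omega] is known off the origin only. As the kernel vanishes at 0, [Omega] may be
    replaced by [Psi], for which the preimage of an interval is an open set together with at most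
    the point 0. *)
Lemma measurable_rough_kernel : measurable_fun setT rough_kernel.
Proof.
pose Psi z := if z == 0 then 0 else Omega z.
have -> : rough_kernel = fun z => Psi z * enorm z `^ (- (n%:R - alpha)).
  apply/funext => z; rewrite /rough_kernel /Psi powRN; case: eqVneq => [->|//].
  by rewrite enorm0 powR0 ?invr0 ?mulr0// subr_eq0 gt_eqF.
apply: measurable_funM; last first.
  exact: (measurableT_comp (measurable_powR _) measurable_enorm).
have m0 : measurable [set 0 : V].
  rewrite (_ : [set 0] = cube 0 0); first exact: measurable_cube.
  rewrite cubeE//; apply/seteqP; split => z /=; rewrite mul0r subr0.
    by move=> ->; rewrite normr0.
  by rewrite normr_le0 => /eqP.
apply: (measurability (@RGenOpens.G R)); first exact: RGenOpens.measurableE.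
move=> /= _ [_ [a [b ->] <-]]; rewrite setTI.
set O := [set` `]a, b[].
have oO : open O by exact: interval_open.
rewrite (_ : Psi @^-1` O = ((~` [set 0]) `&` Omega @^-1` O) `|` ([set 0] `&` Psi @^-1` O)); last first.
  apply/seteqP; split => z /=; rewrite /Psi.
    by case: eqVneq => [->|z0] Oz; [right|left; split => //; exact/eqP].
  by case=> [[/eqP/negPf -> //]|[->]]; rewrite eqxx.
apply: measurableU.
  apply: open_measurable_rV; rewrite openE => z [/= z0 Oz].
  apply: filterI.
    by apply: filterS (near_neq0 (introN eqP z0)) => y /eqP.
  apply: Omega_continuous; first exact/eqP.
  exact: open_nbhs_nbhs.
have [Oz|Oz] := pselect (O 0).
  rewrite (_ : _ `&` _ = [set 0])//; apply/seteqP; split => z /=; first by case.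
  by move=> ->; rewrite /Psi eqxx.
rewrite (_ : _ `&` _ = set0)//; apply/seteqP; split => z //= [->].
by rewrite /Psi eqxx.
Qed.

End rough_kernel.

(** * Pointwise control of the commutator *)

Section commutator_bound.
Context {R : realType} {n : nat}.
Local Notation mu := (@lebesgueRn R n).
Local Notation V := 'rV[R]_n.

Lemma holder_continuous (C beta : R) (h : V -> R) : 0 < C -> 0 < beta ->
  (forall x y, `|h x - h y| <= C * enorm (x - y) `^ beta) -> continuous h.
Proof.
move=> C0 beta0 hC x; have FF : Filter (nbhs x) by apply: nbhs_filter.
apply/(@cvgrPdist_le _ _ _ (nbhs x) FF) => eps eps0.
pose d := (eps / C) `^ beta^-1 / n.+1%:R.
have d0 : 0 < d by rewrite divr_gt0 ?powR_gt0 ?divr_gt0.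
apply/nbhs_ballP; exists d => // y; rewrite -ball_normE/= => xy.
apply: le_trans (hC _ _) _; rewrite mulrC -ler_pdivlMr//.
rewrite -[leRHS](@powR_powRVK _ beta) ?gt_eqF// ?divr_ge0 ?(ltW eps0) ?(ltW C0)//.
apply: ge0_ler_powR; rewrite ?nnegrE ?powR_ge0 ?enorm_ge0 ?(ltW beta0)//.
apply: le_trans (enorm_le_norm _) _.
have : n.+1%:R * `|x - y| <= (eps / C) `^ beta^-1.
  by rewrite mulrC -ler_pdivlMr// ltW.
by apply: le_trans; rewrite ler_wpM2r// ler_nat.
Qed.

(** The two integrability conditions make both terms of the commutator finite, so that their
    difference in [\bar R] can be computed as a difference of reals. *)
Lemma frac_commutatorE (alpha : R) (Omega b b' f g : V -> R) (x : V) :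
  {ae mu, forall y, b y = b' y} -> {ae mu, forall y, f y = g y} -> b x = b' x ->
  mu.-integrable setT
    (fun y => (rough_kernel alpha Omega (x - y) * g y)%:E) ->
  mu.-integrable setT
    (fun y => (rough_kernel alpha Omega (x - y) * (b' x - b' y) * g y)%:E) ->
  frac_commutator b Omega alpha f x =
  (\int[mu]_y (rough_kernel alpha Omega (x - y) * (b' x - b' y) * g y)%:E)%E.
Proof.
move=> bb' fg bx; pose k (y : V) := rough_kernel alpha Omega (x - y).
pose k1 (y : V) := k y * g y; pose k2 (y : V) := k y * (b' x - b' y) * g y.
rewrite -/(k1 _) -/(k2 _) => ik1 ik2.
have E1 : frac_int Omega alpha f x = (\int[mu]_y (k1 y)%:E)%E.
  by apply: ae_eq_integral_lower_in; apply: filterS fg => y ->.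
have E2 : frac_int Omega alpha (fun y => b y * f y) x =
    ((b' x)%:E * \int[mu]_y (k1 y)%:E - \int[mu]_y (k2 y)%:E)%E.
  rewrite -integralZl// -integralB//; last exact: integrableZl.
  apply: ae_eq_integral_lower_in; apply: filterS2 fg bb' => y -> -> /=.
  by congr EFin; rewrite /k2 /k1 -/(rough_kernel alpha Omega (x - y)) /k; ring.
rewrite /frac_commutator E1 E2 bx.
have f1 : (\int[mu]_y (k1 y)%:E \is a fin_num)%E by exact: integrable_fin_num ik1.
have f2 : (\int[mu]_y (k2 y)%:E \is a fin_num)%E by exact: integrable_fin_num ik2.
move: f1 f2; move: (\int[mu]_y (k1 y)%:E)%E (\int[mu]_y (k2 y)%:E)%E.
by move=> [A| |] [B| |] // _ _; rewrite -EFinM /=; congr EFin; ring.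
Qed.

Variables (alpha beta C : R) (Omega b b' : V -> R).
Hypotheses (beta0 : 0 < beta) (C0 : 0 < C) (alphabetan : alpha + beta < n%:R).
Hypothesis hhomog : forall (lambda : R) (x : V), 0 < lambda -> sphere x ->
  Omega (lambda *: x) = Omega x.
Hypothesis hlip : lipschitz_on_sphere Omega.
Hypothesis bb' : \forall x \ae mu, b x = b' x.
Hypothesis holder : forall x y, `|b' x - b' y| <= C * enorm (x - y) `^ beta.

Let alphan : alpha < n%:R.
Proof. by apply: lt_trans alphabetan; rewrite ltrDl. Qed.

Let mb' : measurable_fun setT b'.
Proof. by apply: continuous_measurable_rV; exact: holder_continuous holder. Qed.

Lemma measurable_rough_kernelB (x : V) :
  measurable_fun setT (fun y : V => rough_kernel alpha Omega (x - y)).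
Proof.
apply: (measurableT_comp (measurable_rough_kernel hhomog hlip alphan)).
exact: (measurableT_comp measurable_rV_sub (pair1_measurable x)).
Qed.

Lemma commutator_pointwise (M : R) (f g : V -> R) (x : V) :
  0 < M -> (forall x, x != 0 -> `|Omega x| <= M) ->
  measurable_fun setT g -> (\forall x \ae mu, f x = g x) -> b x = b' x ->
  (riesz_potential alpha sup_dist (fun y : V => `|g y|%R) x < +oo)%E ->
  (`| frac_commutator b Omega alpha f x | <=
   (M * C)%:E * riesz_potential (alpha + beta) sup_dist (fun y : V => `|g y|%R) x)%E.
Proof.
move=> M0 hM mg fg bx Iafin; have MC0 : 0 < M * C by rewrite mulr_gt0.
(* If this potential is infinite the bound is trivial; otherwise its finiteness yields the
   integrability of [k2]. *)
have [->|Ify] := eqVneq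
    (riesz_potential (alpha + beta) sup_dist (fun y : V => `|g y|%R) x) +oo%E.
  by rewrite gt0_muley ?leey// lte_fin.
have Igfin : (riesz_potential (alpha + beta) sup_dist (fun y : V => `|g y|%R) x < +oo)%E.
  by rewrite ltey.
pose k (y : V) := rough_kernel alpha Omega (x - y).
have mk : measurable_fun setT k by exact: measurable_rough_kernelB.
pose k1 (y : V) := k y * g y.
pose k2 (y : V) := k y * (b' x - b' y) * g y.
have mk1 : measurable_fun setT k1 by exact: measurable_funM.
have mk2 : measurable_fun setT k2.
  by apply: measurable_funM => //; apply: measurable_funM => //; exact: measurable_funB.
have mag : measurable_fun setT (fun y : V => `|g y|%R) by exact: measurableT_comp.
have mpot e : measurable_fun setT
    (fun y : V => (sup_dist x y `^ (e - n%:R) * `|g y|)%:E).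
  apply/measurable_EFinP; apply: measurable_funM => //.
  apply: (measurableT_comp (measurable_powR _)).
  exact: (measurableT_comp measurable_rV_dist (pair1_measurable x)).
have pot0 e y : (0 <= (sup_dist x y `^ (e - n%:R) * `|g y|)%:E)%E.
  by rewrite lee_fin mulr_ge0 ?powR_ge0.
have k1le : (\int[mu]_y `|(k1 y)%:E| <= M%:E * riesz_potential alpha sup_dist (fun y : V => `|g y|%R) x)%E.
  rewrite -ge0_integralZl// ?lee_fin ?(ltW M0)//.
  apply: le_integral_lower => y _; first exact: abse_ge0.
  rewrite -EFinM lee_fin normrM mulrA; apply: ler_wpM2r => //.
  apply: le_trans (rough_kernel_le alphan _ (ltW M0) hM) _.
  by apply: ler_wpM2l; [exact: ltW|apply: enorm_powR_le; rewrite subr_lt0].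
have k2le : (\int[mu]_y `|(k2 y)%:E| <= (M * C)%:E *
    riesz_potential (alpha + beta) sup_dist (fun y : V => `|g y|%R) x)%E.
  rewrite -ge0_integralZl// ?lee_fin ?(ltW MC0)//.
  apply: le_integral_lower => y _; first exact: abse_ge0.
  rewrite -EFinM lee_fin mulrA (normrM (k y * (b' x - b' y)) (g y)) (normrM (k y)).
  apply: ler_wpM2r => //.
  apply: (@le_trans _ _ ((M * enorm (x - y) `^ (alpha - n%:R)) *
      (C * enorm (x - y) `^ beta))).
    by apply: ler_pM => //; apply: rough_kernel_le => //; exact: ltW.
  rewrite mulrACA; apply: ler_wpM2l; first exact: ltW.
  apply: (@le_trans _ _ (enorm (x - y) `^ (alpha + beta - n%:R))); last first.
    by apply: enorm_powR_le; rewrite subr_lt0.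
  rewrite (_ : alpha + beta - n%:R = alpha - n%:R + beta); last by ring.
  (* Adding exponents of [powR] requires a nonzero base. On the diagonal the left side is 0 because
     [beta] is positive. *)
  have [->|xy] := eqVneq (x - y) 0.
    by rewrite enorm0 (@powR0 _ beta) ?mulr0 ?powR_ge0// gt_eqF.
  rewrite (@powRD _ _ (alpha - n%:R) beta)//.
  by rewrite (gt_eqF (_ : 0 < enorm (x - y))) ?implybT// enorm_gt0.
have ik1 : mu.-integrable setT (EFin \o k1).
  apply/integrableP; split; first exact/measurable_EFinP.
  by apply: le_lt_trans k1le _; rewrite lte_mul_pinfty ?lee_fin ?(ltW M0).
have ik2 : mu.-integrable setT (EFin \o k2).
  apply/integrableP; split; first exact/measurable_EFinP.
  by apply: le_lt_trans k2le _; rewrite lte_mul_pinfty ?lee_fin ?(ltW MC0).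
rewrite (frac_commutatorE bb' fg bx ik1 ik2).
apply: le_trans k2le; apply: le_trans (le_abse_integral mu measurableT _) _ => //.
exact/measurable_EFinP.
Qed.

End commutator_bound.

Section slice_norm.
Context {R : realType} {n : nat}.
Local Notation mu := (@lebesgueRn R n).
Local Notation V := 'rV[R]_n.
Variables t p q : R.
Hypotheses (t0 : 0 < t) (p0 : 0 < p) (q0 : 0 < q).
Local Open Scope ereal_scope.
Implicit Types F G : V -> \bar R.

Let tn0 : (0 < t ^+ n)%R. Proof. exact: exprn_gt0. Qed.

Let cE (x : V) : fine (mu (cube x t)) = (t ^+ n)%R.
Proof. by rewrite mu_cube// ltW. Qed.

Lemma slice_norm_ge0 F : 0 <= slice_norm t p q F.
Proof. exact: poweR_ge0. Qed.

(** Both nested integrals are monotone without measurability, so the commutator itself may stand on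
    either side. *)
Lemma slice_norm_ae_le F G : {ae mu, forall x, `|F x| <= `|G x|} ->
  slice_norm t p q F <= slice_norm t p q G.
Proof.
move=> FG; apply: le_poweR; first by rewrite invr_ge0 ltW.
  by apply: integral_ge0 => x _; exact: poweR_ge0.
apply: le_integral_lower => x _; first exact: poweR_ge0.
apply: le_poweR; first by rewrite divr_ge0 ?(ltW q0) ?(ltW p0).
  rewrite mule_ge0// ?lee_fin ?invr_ge0 ?cE ?(ltW tn0)//.
  by apply: integral_ge0 => y _; exact: poweR_ge0.
apply: lee_wpmul2l; first by rewrite lee_fin invr_ge0 cE ltW.
apply: ae_le_integral_lower_in => [y|y|]; [exact: poweR_ge0..|].
by apply: filterS FG => y; apply: le_poweR; rewrite ?abse_ge0 ?(ltW p0).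
Qed.

Lemma slice_norm_ae_eq F G : {ae mu, forall x, `|F x| = `|G x|} ->
  slice_norm t p q F = slice_norm t p q G.
Proof.
move=> FG; apply/eqP; rewrite eq_le !slice_norm_ae_le//.
  by apply: filterS FG => y ->.
by apply: filterS FG => y ->.
Qed.

Let measurable_slice G : (forall x, 0 <= G x) -> measurable_fun setT G ->
  measurable_fun setT (fun x => (\int[mu]_(y in cube x t) (G y `^ p)) `^ (q / p)).
Proof.
move=> G0 mG; apply: (measurableT_comp (measurable_poweR _)).
apply: measurable_cube_integral => [x|]; first exact: poweR_ge0.
exact: (measurableT_comp (measurable_poweR _)).
Qed.

Lemma slice_normE G : (forall x, 0 <= G x) -> measurable_fun setT G ->
  slice_norm t p q G = ((t ^+ n) `^ (- p^-1))%:E *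
    (\int[mu]_x ((\int[mu]_(y in cube x t) (G y `^ p)) `^ (q / p))) `^ q^-1.
Proof.
move=> G0 mG; rewrite /slice_norm.
have I0 x : 0 <= \int[mu]_(y in cube x t) (G y `^ p).
  by apply: integral_ge0 => y _; exact: poweR_ge0.
rewrite (eq_integral (fun x => (((t ^+ n) `^ (- (q / p)))%:E *
    (\int[mu]_(y in cube x t) (G y `^ p)) `^ (q / p)))); last first.
  move=> x _; rewrite cE (eq_integral (fun y => G y `^ p)); last first.
    by move=> y _; rewrite gee0_abs.
  rewrite poweRM ?lee_fin ?invr_ge0 ?(ltW tn0)// poweR_EFin.
  by rewrite -(powR_inv1 (ltW tn0)) -powRrM mulN1r.
rewrite ge0_integralZl//; last 3 first.
- exact: measurable_slice.
- by move=> x _; exact: poweR_ge0.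
- by rewrite lee_fin powR_ge0.
rewrite poweRM ?lee_fin ?powR_ge0//; last first.
  by apply: integral_ge0 => x _; exact: poweR_ge0.
rewrite poweR_EFin -powRrM (_ : - (q / p) * q^-1 = - p^-1)%R//.
by field; rewrite !gt_eqF.
Qed.

Lemma slice_normZ (c : R) G : (0 <= c)%R -> (forall x, 0 <= G x) ->
  measurable_fun setT G ->
  slice_norm t p q (fun x => c%:E * G x) = c%:E * slice_norm t p q G.
Proof.
move=> c0 G0 mG.
have mcG : measurable_fun setT (fun x => c%:E * G x) by exact: emeasurable_funM.
rewrite !slice_normE//; last by move=> x; rewrite mule_ge0.
have I0 x : 0 <= \int[mu]_(y in cube x t) (G y `^ p).
  by apply: integral_ge0 => y _; exact: poweR_ge0.
rewrite muleCA; congr (_ * _).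
rewrite (eq_integral (fun x => (c `^ q)%:E *
    (\int[mu]_(y in cube x t) (G y `^ p)) `^ (q / p))); last first.
  move=> x _; rewrite (eq_integral (fun y => (c `^ p)%:E * G y `^ p)); last first.
    by move=> y _; rewrite poweRM// poweR_EFin.
  rewrite ge0_integralZl//; last 4 first.
  - exact: measurable_cube.
  - by apply: measurable_funTS; exact: (measurableT_comp (measurable_poweR _)).
  - by move=> y _; exact: poweR_ge0.
  - by rewrite lee_fin powR_ge0.
  rewrite poweRM ?lee_fin ?powR_ge0// poweR_EFin -powRrM.
  by rewrite (_ : p * (q / p) = q)%R//; field; rewrite gt_eqF.
rewrite ge0_integralZl//; last 3 first.
- exact: measurable_slice.
- by move=> x _; exact: poweR_ge0.
- by rewrite lee_fin powR_ge0.
rewrite poweRM ?lee_fin ?powR_ge0//; last first.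
  by apply: integral_ge0 => x _; exact: poweR_ge0.
by rewrite poweR_EFin powR_powRK// gt_eqF.
Qed.

End slice_norm.

Section riesz_ae_finite.
Context {R : realType} {n : nat}.
Local Notation mu := (@lebesgueRn R n).
Local Notation V := 'rV[R]_n.
Variables gam t p q r s : R.
Hypotheses (n0 : (0 < n)%N) (gam0 : 0 < gam) (gamn : gam < n%:R) (t0 : 0 < t)
  (p1 : 1 < p) (pr : p < r) (q1 : 1 < q) (qs : q < s).
Hypotheses (gampr : gam / n%:R = p^-1 - r^-1) (gamqs : gam / n%:R = q^-1 - s^-1).
Local Open Scope ereal_scope.

(** Integrability of [Z ^ (s / r)] makes [Z] finite almost everywhere. If the set [N] of infinite
    values met [cube x t] in positive measure, [Z x] would be infinite. So almost every cube meets
    [N] in a null set, and integrating over the centres gives [t^n mu N = 0]. *)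
Lemma riesz_potential_ae_finite (f : V -> R) :
  (forall y, 0 <= f y)%R -> measurable_fun setT f ->
  (forall x, \int[mu]_(z in cube x t) (f z)%:E < +oo) ->
  \int[mu]_x ((\int[mu]_(y in cube x t) (f y `^ p)%:E) `^ (q / p)) < +oo ->
  \forall x \ae mu, riesz_potential gam sup_dist f x < +oo.
Proof.
move=> f0 mf fint Yfin.
have r0 : (0 < r)%R by rewrite (lt_trans _ pr)// (lt_trans _ p1).
have s0 : (0 < s)%R by rewrite (lt_trans _ qs)// (lt_trans _ q1).
have [K K0 hK] := slice_riesz_potential n0 gam0 gamn t0 p1 pr q1 qs gampr gamqs.
set P := riesz_potential gam sup_dist f.
have P0 x : 0 <= P x by exact: riesz_potential_ge0.
have mP : measurable_fun setT P.
  by apply: measurable_riesz_potential => //; exact: measurable_rV_dist.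
have mPr : measurable_fun setT (fun y => P y `^ r).
  exact: (measurableT_comp (measurable_poweR _)).
pose Z x := \int[mu]_(y in cube x t) (P y `^ r).
have Z0 x : 0 <= Z x by apply: integral_ge0 => y _; exact: poweR_ge0.
have mZ : measurable_fun setT Z.
  by apply: measurable_cube_integral => // x; exact: poweR_ge0.
have Zint : mu.-integrable setT (fun x => Z x `^ (s / r)).
  apply/integrableP; split.
    exact: (measurableT_comp (measurable_poweR _)).
  rewrite (eq_integral (fun x => Z x `^ (s / r))); last first.
    by move=> x _; rewrite gee0_abs// poweR_ge0.
  apply: le_lt_trans (hK f f0 mf fint) _.
  by rewrite lte_mul_pinfty ?lee_fin// poweR_lty.
pose N := P @^-1` [set +oo].
have mN : measurable N by rewrite -[N]setTI; exact: mP.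
have chi0 x : 0 <= (\1_N x)%:E :> \bar R by rewrite lee_fin.
have mchi : measurable_fun setT (fun x => (\1_N x)%:E : \bar R).
  by apply/measurable_EFinP; exact: measurable_indic.
pose W x := \int[mu]_(y in cube x t) (\1_N y)%:E.
have W0 x : 0 <= W x by exact: integral_ge0.
have WZ : {ae mu, forall x, W x <= 0}.
  apply: filterS (integrable_ae measurableT Zint) => x /(_ I) Zx.
  rewrite leNgt; apply/negP => Wx.
  have : Z x < +oo.
    apply: (@lty_poweRy _ _ (s / r)); first by rewrite gt_eqF// divr_gt0.
    by rewrite ltey_eq Zx.
  apply/negP; rewrite -leNgt.
  apply: (@le_trans _ _ (+oo * W x)); first by rewrite gt0_mulye.
  rewrite -ge0_integralZl//; last 2 first.
  - exact: measurable_cube.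
  - exact: measurable_funTS.
  apply: le_integral_lower => y _; first by rewrite mule_ge0.
  rewrite indicE; case: (boolP (y \in N)) => [/set_mem/= -> |_].
    by rewrite poweRyr ?gt_eqF// leey.
  by rewrite mule0 poweR_ge0.
have W00 : \int[mu]_x W x <= 0.
  apply: le_trans (ae_le_integral_lower (g := cst 0) _ _ WZ) _ => //.
  by rewrite integral0.
have muN : mu N = 0.
  have := @integral_cube_integral R n t (fun x => (\1_N x)%:E) chi0 mchi (ltW t0).
  rewrite -/(W _) => WN; move: W00; rewrite WN integral_indic// setIT => h.
  have t0' : (0 < t ^+ n)%R by rewrite exprn_gt0.
  apply/eqP; rewrite eq_le measure_ge0 andbT.
  by rewrite -(@lee_pmul2l _ (t ^+ n)%:E)// mule0.
exists N; split => // x /= Px; apply/eqP.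
by move/negP: Px; rewrite -leNgt leye_eq.
Qed.

End riesz_ae_finite.

Section sufficiency.
Context {R : realType} {n : nat}.
Local Notation mu := (@lebesgueRn R n).
Local Notation V := 'rV[R]_n.
Local Open Scope ereal_scope.

Lemma loc_p_cube_integral_lty (p t : R) (f : V -> R) (x : V) :
  (1 < p)%R -> (0 < t)%R ->
  measurable_fun setT f ->
  \int[mu]_(y in cube x t) (`|f y| `^ p)%:E < +oo ->
  \int[mu]_(y in cube x t) (`|f y|)%:E < +oo.
Proof.
move=> p1 t0 mf fp.
have tn0 : (0 < t ^+ n)%R by rewrite exprn_gt0.
have := @integral_le_holder_poweR _ V R mu (cube x t)
  (fun y => (`|f y|)%:E) p (t ^+ n)%R (measurable_cube x t).
move=> /(_ _ _ p1 tn0 _)/le_lt_trans; apply.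
- by apply: measurable_funTS; apply/measurable_EFinP; exact: measurableT_comp.
- by move=> y; rewrite lee_fin.
- by apply: mu_cube_le; exact: ltW.
by rewrite lte_mul_pinfty ?lee_fin ?mulr_ge0 ?powR_ge0// poweR_lty.
Qed.

Variables (alpha beta t p q r s : R) (Omega b : V -> R).
Hypotheses (n0 : (0 < n)%N) (hbeta : (0 < beta)%R) (alpha0 : (0 < alpha)%R)
  (halphabeta : (alpha + beta < n%:R)%R) (t0 : (0 < t)%R)
  (p1 : (1 < p)%R) (pr : (p < r)%R) (q1 : (1 < q)%R) (qs : (q < s)%R)
  (hexp_pr : ((alpha + beta) / n%:R = p^-1 - r^-1)%R)
  (hexp_qs : ((alpha + beta) / n%:R = q^-1 - s^-1)%R)
  (hhomog : forall (lambda : R) (x : V),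
      (0 < lambda)%R -> sphere x -> Omega (lambda *: x) = Omega x)
  (hlip : lipschitz_on_sphere Omega).

Let n0' : (0 < n%:R :> R)%R. Proof. by rewrite ltr0n. Qed.

(** Solves the scaling relation for [alpha] alone with the same source exponent [u]. A positive
    solution exists because [1/u - alpha/n = 1/v + beta/n], and it exceeds [u] because
    [alpha > 0]. *)
Let shrink_exponent (u v : R) : (1 < u)%R -> (u < v)%R ->
  ((alpha + beta) / n%:R = u^-1 - v^-1)%R ->
  exists2 w, (u < w)%R & (alpha / n%:R = u^-1 - w^-1)%R.
Proof.
move=> u1 uv E; have u0 : (0 < u)%R := lt_trans ltr01 u1.
have v0 : (0 < v)%R := lt_trans u0 uv.
have an : (0 < alpha / n%:R)%R by rewrite divr_gt0.
have bn : (0 < beta / n%:R)%R by rewrite divr_gt0.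
have vi : (0 < v^-1)%R by rewrite invr_gt0.
have d0 : (0 < u^-1 - alpha / n%:R)%R by move: E; rewrite mulrDl; lra.
exists ((u^-1 - alpha / n%:R)^-1)%R; last by rewrite invrK; ring.
rewrite -[ltLHS]invrK ltf_pV2 ?posrE ?invr_gt0//.
by rewrite ltrBlDr ltrDl.
Qed.

Lemma slice_bounded_of_in_Lip : in_Lip beta b ->
  slice_bounded (frac_commutator b Omega alpha) t p q r s.
Proof.
move=> [b' bb' [C C0 holder]].
have p0 : (0 < p)%R := lt_trans ltr01 p1.
have q0 : (0 < q)%R := lt_trans ltr01 q1.
have r0 : (0 < r)%R := lt_trans p0 pr.
have s0 : (0 < s)%R := lt_trans q0 qs.
have gam0 : (0 < alpha + beta)%R by rewrite addr_gt0.
have alphan : (alpha < n%:R)%R by apply: lt_trans halphabeta; rewrite ltrDl.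
have tn0 : (0 < t ^+ n)%R by rewrite exprn_gt0.
have [M M0 hM] := Omega_bounded hhomog hlip.
have [K K0 hK] := slice_riesz_potential n0 gam0 halphabeta t0 p1 pr q1 qs hexp_pr hexp_qs.
have [r' pr' hr'] := shrink_exponent p1 pr hexp_pr.
have [s' qs' hs'] := shrink_exponent q1 qs hexp_qs.
pose cp := ((t ^+ n) `^ (- p^-1))%R.
pose cr := ((t ^+ n) `^ (- r^-1))%R.
have cp0 : (0 < cp)%R by rewrite powR_gt0.
(* [cp] and [cr] are the normalizing powers of [t^n] that [slice_normE] extracts from the two norms;
   [M * C] comes from the pointwise bound. *)
exists (M * C * cr * K `^ s^-1 / cp)%R.
move=> f [[[g mg fg] floc] fnorm].
pose phi (y : V) := `|g y|%R.
have phi0 y : (0 <= phi y)%R by exact: normr_ge0.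
have mphi : measurable_fun setT phi by exact: measurableT_comp.
have mEphi : measurable_fun setT (EFin \o phi) by exact/measurable_EFinP.
have fphi : {ae mu, forall x, `|(EFin \o f) x| = `|(EFin \o phi) x|}.
  by apply: filterS fg => x /= ->; rewrite normr_id.
have phint x : \int[mu]_(z in cube x t) (phi z)%:E < +oo.
  apply: (@loc_p_cube_integral_lty p) => //.
  have -> : \int[mu]_(y in cube x t) (`|g y| `^ p)%:E =
      \int[mu]_(y in cube x t) (`|f y| `^ p)%:E.
    by apply: ae_eq_integral_lower_in; apply: filterS fg => y ->.
  exact: (floc _ (@compact_cube R n x t)).
pose Y := \int[mu]_x ((\int[mu]_(y in cube x t) (phi y `^ p)%:E) `^ (q / p)).
have Y0 : 0 <= Y by apply: integral_ge0 => x _; exact: poweR_ge0.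
have normE : slice_norm t p q (EFin \o f) = cp%:E * Y `^ q^-1.
  by rewrite (slice_norm_ae_eq t0 p0 q0 fphi) slice_normE//.
have Yfin : Y < +oo.
  apply: (@lty_poweRy _ _ q^-1); first by rewrite invr_neq0// gt_eqF.
  move: fnorm; rewrite normE; apply: contraTT; rewrite -!leNgt !leye_eq => /eqP ->.
  by rewrite gt0_muley// lte_fin.
pose P := riesz_potential (alpha + beta) sup_dist phi.
have P0 x : 0 <= P x by exact: riesz_potential_ge0.
have mP : measurable_fun setT P.
  by apply: measurable_riesz_potential => //; exact: measurable_rV_dist.
(* Absolute convergence of [T f] at almost every point, a prerequisite of [commutator_pointwise]. *)
have Iafin := riesz_potential_ae_finite n0 alpha0 alphan t0 p1 pr' q1 qs' hr' hs'
  phi0 mphi phint Yfin.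
have MC0 : (0 <= M * C)%R by rewrite mulr_ge0// ltW.
have commP : {ae mu, forall x, `|frac_commutator b Omega alpha f x| <=
    `|(M * C)%:E * P x|}.
  have bb2 := bb'; apply: filterS2 Iafin bb2 => x Ix bx.
  rewrite [leRHS]gee0_abs ?mule_ge0 ?lee_fin//.
  exact: (commutator_pointwise hbeta C0 halphabeta hhomog hlip bb' holder M0 hM mg fg bx Ix).
apply: le_trans (slice_norm_ae_le t0 r0 s0 commP) _.
rewrite slice_normZ// slice_normE// normE.
set Z := \int[mu]_x _.
have ZK : Z `^ s^-1 <= (K `^ s^-1)%:E * Y `^ q^-1.
  apply: (@le_trans _ _ ((K%:E * Y `^ (s / q)) `^ s^-1)).
    apply: le_poweR; first by rewrite invr_ge0 ltW.
      by apply: integral_ge0 => x _; exact: poweR_ge0.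
    exact: hK.
  rewrite poweRM ?lee_fin ?poweR_ge0// poweR_EFin -poweRrM.
  by rewrite (_ : s / q * s^-1 = q^-1)%R//; field; rewrite !gt_eqF.
rewrite muleA -EFinM -/cr.
apply: le_trans (lee_wpmul2l _ ZK) _.
  by rewrite lee_fin mulr_ge0 ?powR_ge0.
rewrite !muleA -!EFinM (_ : _ / cp * cp = M * C * cr * K `^ s^-1)%R//.
by rewrite divfK// gt_eqF.
Qed.

End sufficiency.

(** * Necessity of the Lipschitz condition *)

Section slice_cube.
Context {R : realType} {n : nat}.
Local Notation mu := (@lebesgueRn R n).
Local Notation V := 'rV[R]_n.
Variables t l : R.
Hypotheses (t0 : 0 < t) (l0 : 0 < l).
Local Open Scope ereal_scope.

Let tn0 : (0 < t ^+ n)%R. Proof. exact: exprn_gt0. Qed.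
Let lt0 : (0 < l + t)%R. Proof. exact: addr_gt0. Qed.
Let m := Num.min l t.
Let m0 : (0 < m)%R. Proof. by rewrite lt_min l0 t0. Qed.

Let cubes_meet (x x0 y : V) : cube x t y -> cube x0 l y -> cube x0 (l + t) x.
Proof.
by move=> xy x0y i; move: (xy i) (x0y i); rewrite !ler_norml; lra.
Qed.

Let mu_cubes_le (x x0 : V) : mu (cube x t `&` cube x0 l) <= (m ^+ n)%:E.
Proof.
rewrite /m; case: (leP l t) => [lt|tl].
  rewrite -(mu_cube x0); last exact: ltW.
  by apply: le_measure; rewrite ?inE; [apply: measurableI; exact: measurable_cube|exact: measurable_cube|exact: subIsetr].
rewrite -(mu_cube x); last exact: ltW.
by apply: le_measure; rewrite ?inE; [apply: measurableI; exact: measurable_cube|exact: measurable_cube|exact: subIsetl].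
Qed.

(** [cube x t] meets [cube x0 l] in measure at most [min(l, t) ^ n], and only when [x] lies in
    [cube x0 (l + t)]. *)
Lemma slice_norm_indic_le (p q : R) (x0 : V) (E : set V) : (0 < p)%R -> (0 < q)%R ->
  measurable E -> E `<=` cube x0 l ->
  slice_norm t p q (EFin \o \1_E) <=
  ((t ^+ n) `^ (- p^-1) * ((m ^+ n) `^ p^-1 * ((l + t) ^+ n) `^ q^-1))%:E.
Proof.
move=> p0 q0 mE El.
have mE1 : measurable_fun setT (EFin \o \1_E : V -> \bar R).
  by apply/measurable_EFinP; exact: measurable_indic.
rewrite slice_normE//; last by move=> x; rewrite lee_fin.
rewrite EFinM; apply: lee_wpmul2l; first by rewrite lee_fin powR_ge0.
have mn0 : (0 <= m ^+ n)%R by rewrite exprn_ge0// ltW.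
have ln0 : (0 <= (l + t) ^+ n)%R by rewrite exprn_ge0// ltW.
apply: (@le_trans _ _ ((((m ^+ n) `^ (q / p))%:E * ((l + t) ^+ n)%:E) `^ q^-1)); last first.
  rewrite -EFinM poweR_EFin lee_fin powRM ?powR_ge0// -powRrM.
  by rewrite (_ : q / p * q^-1 = p^-1)%R//; field; rewrite !gt_eqF.
apply: le_poweR; first by rewrite invr_ge0 ltW.
  by apply: integral_ge0 => x _; exact: poweR_ge0.
rewrite -(integral_cube_cst x0); last exact: ltW.
rewrite [leRHS]integral_mkcond; apply: le_integral_lower => x _; first exact: poweR_ge0.
have -> : \int[mu]_(y in cube x t) ((EFin \o \1_E) y `^ p) = mu (E `&` cube x t).
  rewrite -(integral_indic mu (measurable_cube x t) mE).
  apply: eq_integral => y _; rewrite /= indicE.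
  by case: (y \in E) => /=; rewrite ?powR1// powR0// gt_eqF.
rewrite patchE; case: ifPn => xl.
  rewrite -poweR_EFin; apply: le_poweR => //; first by rewrite divr_ge0// ltW.
  apply: le_trans (mu_cubes_le x x0); rewrite setIC.
  apply: le_measure; rewrite ?inE.
  - by apply: measurableI => //; exact: measurable_cube.
  - by apply: measurableI; exact: measurable_cube.
  - by apply: setIS.
rewrite (_ : E `&` _ = set0).
  by rewrite measure0 poweR0r// mulf_neq0 ?invr_neq0 ?gt_eqF.
apply/seteqP; split => y //= [/El Ey xy].
by move/negP: xl; apply; apply/mem_set; exact: cubes_meet xy Ey.
Qed.

(** Sliding cubes of side [t] recover [t^n] times the integral. Hoelder's inequality is then used
    twice: inside, on the intersection of two cubes, and outside, on the cube of side [l + t] of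
    centres that matter. Each use costs a factor 2. *)
Lemma integral_le_slice_norm (r s : R) (x0 : V) (G : V -> \bar R) :
  (1 < r)%R -> (1 < s)%R -> (forall x, 0 <= G x) -> measurable_fun setT G ->
  (forall x, ~ cube x0 l x -> G x = 0) ->
  \int[mu]_x G x <=
  ((t ^+ n)^-1 * (2 * (m ^+ n) `^ (1 - r^-1)) *
   (2 * ((l + t) ^+ n) `^ (1 - s^-1)) * (t ^+ n) `^ r^-1)%:E * slice_norm t r s G.
Proof.
move=> r1 s1 G0 mG Gout.
have r0 : (0 < r)%R := lt_trans ltr01 r1.
have s0 : (0 < s)%R := lt_trans ltr01 s1.
have mn0 : (0 < m ^+ n)%R by rewrite exprn_gt0.
have ln0 : (0 < (l + t) ^+ n)%R by rewrite exprn_gt0.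
have mGr : measurable_fun setT (fun y => G y `^ r).
  exact: (measurableT_comp (measurable_poweR _)).
pose Ir x := \int[mu]_(y in cube x t) (G y `^ r).
have Ir0 x : 0 <= Ir x by apply: integral_ge0 => y _; exact: poweR_ge0.
have mIr : measurable_fun setT Ir.
  by apply: measurable_cube_integral => // x; exact: poweR_ge0.
pose h x := Ir x `^ r^-1.
have h0 x : 0 <= h x by exact: poweR_ge0.
have mh : measurable_fun setT h by exact: (measurableT_comp (measurable_poweR _)).
pose c1 := (2 * (m ^+ n) `^ (1 - r^-1))%R.
pose c2 := (2 * ((l + t) ^+ n) `^ (1 - s^-1))%R.
have c10 : (0 <= c1)%R by rewrite mulr_ge0 ?powR_ge0.
have c20 : (0 <= c2)%R by rewrite mulr_ge0 ?powR_ge0.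
have mQ (x : V) rho : measurable (cube x rho) by exact: measurable_cube.
have GI x : \int[mu]_(y in cube x t) G y = \int[mu]_(y in cube x t `&` cube x0 l) G y.
  rewrite [RHS]integral_mkcondr; apply: eq_integral => y _.
  rewrite patchE; case: ifPn => // yx0; apply: Gout => yx0'.
  by move/negP: yx0; apply; exact/mem_set.
have inner x : \int[mu]_(y in cube x t) G y <= (c1%:E * (h \_ (cube x0 (l + t))) x).
  rewrite patchE; case: ifPn => xl.
    rewrite GI; apply: le_trans (integral_le_holder_poweR (M := m ^+ n) _ _ G0 r1 mn0 _) _.
    - exact: measurableI.
    - exact: measurable_funTS.
    - exact: mu_cubes_le.
    apply: lee_wpmul2l; first by rewrite lee_fin.
    apply: le_poweR; first by rewrite invr_ge0 ltW.
      by apply: integral_ge0 => y _; exact: poweR_ge0.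
    by apply: ge0_le_integral_subset => [y|]; [exact: poweR_ge0|exact: subIsetl].
  rewrite mule0 (_ : \int[mu]_(y in _) _ = 0)//; apply: integral0_eq => y xy.
  apply: Gout => x0y; move/negP: xl; apply; apply/mem_set; exact: cubes_meet xy x0y.
have mhp : measurable_fun setT (h \_ (cube x0 (l + t))).
  by apply/(measurable_restrictT _ _).1 => //; exact: measurable_funTS.
have hp0 x : 0 <= (h \_ (cube x0 (l + t))) x by apply: erestrict_ge0.
have tG : (t ^+ n)%:E * \int[mu]_x G x <= c1%:E * (c2%:E *
    ((t ^+ n) `^ r^-1)%:E * slice_norm t r s G).
  rewrite -integral_cube_integral ?(ltW t0)//.
  apply: (@le_trans _ _ (\int[mu]_x (c1%:E * (h \_ (cube x0 (l + t))) x))).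
    by apply: le_integral_lower => x _; [exact: integral_ge0|exact: inner].
  rewrite ge0_integralZl// ?lee_fin//; apply: lee_wpmul2l; first by rewrite lee_fin.
  rewrite -integral_mkcond.
  apply: le_trans (integral_le_holder_poweR (M := (l + t) ^+ n) (mQ _ _) _ h0 s1 ln0 _) _.
  - exact: measurable_funTS.
  - by apply: mu_cube_le; exact: ltW.
  rewrite -muleA; apply: lee_wpmul2l; first by rewrite lee_fin.
  rewrite slice_normE// muleA -EFinM -powRD; last by rewrite (gt_eqF tn0) implybT.
  rewrite addrN powRr0 mul1e; apply: le_poweR; first by rewrite invr_ge0 ltW.
    by apply: integral_ge0 => x _; exact: poweR_ge0.
  apply: (@le_trans _ _ (\int[mu]_x (h x `^ s))).
    by apply: ge0_le_integral_subset => // x; exact: poweR_ge0.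
  apply: le_integral_lower => x _; first exact: poweR_ge0.
  by rewrite /h -poweRrM mulrC.
have -> : \int[mu]_x G x = (t ^+ n)^-1%:E * ((t ^+ n)%:E * \int[mu]_x G x).
  by rewrite muleA -EFinM mulVf ?mul1e// gt_eqF.
apply: le_trans (lee_wpmul2l _ tG) _; first by rewrite lee_fin invr_ge0 ltW.
by rewrite !muleA -!EFinM.
Qed.

Lemma integral_le_indic_norm (gam p q r s D : R) (x0 x1 : V) (G : V -> \bar R)
    (E : set V) :
  (0 < n)%N -> (0 < gam)%R ->
  (1 < p)%R -> (p < r)%R -> (1 < q)%R -> (q < s)%R ->
  (gam / n%:R = p^-1 - r^-1)%R -> (gam / n%:R = q^-1 - s^-1)%R -> (0 <= D)%R ->
  (forall x, 0 <= G x) -> measurable_fun setT G ->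
  (forall x, ~ cube x0 l x -> G x = 0) ->
  measurable E -> E `<=` cube x1 l ->
  slice_norm t r s G <= D%:E * slice_norm t p q (EFin \o \1_E) ->
  \int[mu]_x G x <= (4 * D * (2 * l) `^ (n%:R + gam))%:E.
Proof.
move=> n0 gam0 p1 pr q1 qs E1 E2 D0 G0 mG Gout mE El GE.
have r1 : (1 < r)%R := lt_trans p1 pr.
have s1 : (1 < s)%R := lt_trans q1 qs.
have p0 : (0 < p)%R := lt_trans ltr01 p1.
have q0 : (0 < q)%R := lt_trans ltr01 q1.
apply: le_trans (integral_le_slice_norm r1 s1 G0 mG Gout) _.
set c := (_ * _)%R.
have c0 : (0 <= c)%R.
  by rewrite !mulr_ge0 ?powR_ge0// invr_ge0 ltW.
apply: le_trans (lee_wpmul2l _ GE) _; first by rewrite lee_fin.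
apply: (@le_trans _ _ (c%:E * (D%:E *
    ((t ^+ n) `^ (- p^-1) * ((m ^+ n) `^ p^-1 * ((l + t) ^+ n) `^ q^-1))%:E))).
  by do 2 (apply: lee_wpmul2l; first by rewrite lee_fin); exact: slice_norm_indic_le El.
rewrite -!EFinM lee_fin.
have N0 : (n%:R != 0 :> R)%R by rewrite pnatr_eq0 -lt0n.
have [t' [m' l']] : [/\ (0 <= t)%R, (0 <= m)%R & (0 <= l + t)%R].
  by split; exact: ltW.
(* The powers of [m^n], [(l + t)^n] and [1 / t^n] all have exponent [1 + gam / n], the first and
   third by the relation between [p] and [r], the second by that between [q] and [s]. *)
have key : (c * (D * ((t ^+ n) `^ (- p^-1) * ((m ^+ n) `^ p^-1 * ((l + t) ^+ n) `^ q^-1))) =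
   4 * D * ((m * (l + t) / t) `^ (n%:R + gam)))%R.
  have XE (X : R) : (0 < X)%R ->
      (X `^ (n%:R + gam) = (X ^+ n) `^ (1 + gam / n%:R))%R.
    move=> X0; rewrite powR_exprn; last exact: ltW.
    by rewrite mulrDr mulr1 mulrCA mulfV// mulr1.
  have XD (X e e' : R) : (0 < X)%R ->
      ((X ^+ n) `^ (e + e') = (X ^+ n) `^ e * (X ^+ n) `^ e')%R.
    by move=> X0; rewrite powRD// (gt_eqF (exprn_gt0 _ X0)) implybT.
  have hM : ((m * (l + t) / t) `^ (n%:R + gam) =
      m `^ (n%:R + gam) * (l + t) `^ (n%:R + gam) * (t `^ (n%:R + gam))^-1)%R.
    rewrite powRM ?invr_ge0 ?mulr_ge0// powRM//; congr (_ * _)%R.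
    by rewrite -(powR_inv1 t') -powRrM mulN1r powRN.
  rewrite hM (XE m m0) (XE _ lt0) (XE t t0).
  have -> : (((t ^+ n) `^ (1 + gam / n%:R))^-1 =
      (t ^+ n)^-1 * (t ^+ n) `^ r^-1 * (t ^+ n) `^ (- p^-1))%R.
    rewrite -powRN -(powR_inv1 (ltW tn0)) -!XD//; congr powR.
    by rewrite E1; ring.
  have e1 : (1 + gam / n%:R = (1 - r^-1) + p^-1)%R by rewrite E1; ring.
  have e2 : (1 + gam / n%:R = (1 - s^-1) + q^-1)%R by rewrite E2; ring.
  by rewrite {1}e1 e2 (XD m)// (XD (l + t)%R)// /c; ring.
rewrite key; apply: ler_wpM2l; first by rewrite mulr_ge0.
apply: ge0_ler_powR; rewrite ?nnegrE.
- by rewrite addr_ge0// ltW.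
- by rewrite divr_ge0// mulr_ge0.
- by rewrite mulr_ge0// ltW.
(* [m (l + t) / t] is [l (l + t) / t] if [l <= t] and [l + t] otherwise, hence at most [2 l]; the
   dependence on [t] disappears. *)
rewrite ler_pdivrMr// /m; case: (leP l t) => [lt|/ltW tl].
  by rewrite -mulrA mulrCA ler_pM2l// mulr_natl mulr2n lerD2r.
by rewrite mulrAC [leRHS]mulrC mulr_natl mulr2n mulrC mulrDr; nra.
Qed.

End slice_cube.

Section kernel_cone.
Context {R : realType} {n : nat}.
Local Notation V := 'rV[R]_n.
Variables (alpha : R) (Omega : V -> R).
Hypothesis hhomog : forall (lambda : R) x, 0 < lambda -> sphere x ->
  Omega (lambda *: x) = Omega x.
Hypothesis hlip : lipschitz_on_sphere Omega.
Hypothesis alphan : alpha < n%:R.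

Lemma Omega_scale (c : R) (x : V) : 0 < c -> x != 0 -> Omega (c *: x) = Omega x.
Proof.
move=> c0 x0; have cx0 : c *: x != 0 by rewrite scaler_eq0 gt_eqF.
rewrite (Omega_unit hhomog cx0) (Omega_unit hhomog x0) enormZ gtr0_norm//.
by rewrite scalerA invfM mulrAC mulVf ?gt_eqF// mul1r.
Qed.

(** By homogeneity the kernel at [w] is determined by [v = w / (A l)], which for large [A] is so
    close to [z0] that [Omega v] keeps the sign and the size of [Omega z0], while the norm of [v]
    stays between 1/2 and 2. *)
Lemma kernel_cone (z0 : V) : sphere z0 -> Omega z0 != 0 ->
  exists A c1 c2 : R, [/\ 0 < A, 0 < c1, 0 < c2 &
    forall (l : R) (w : V), 0 < l -> `|w - (A * l) *: z0| <= l ->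
    c1 * l `^ (alpha - n%:R) <= Num.sg (Omega z0) * rough_kernel alpha Omega w /\
    `|rough_kernel alpha Omega w| <= c2 * l `^ (alpha - n%:R)].
Proof.
move=> sz0 Oz0; have z00 : z0 != 0 by rewrite -enorm_gt0 sz0.
set o := `|Omega z0|; have o0 : 0 < o by rewrite normr_gt0.
have FF : Filter (nbhs z0) by apply: nbhs_filter.
have : \forall v \near z0, `|Omega z0 - Omega v| <= o / 2.
  have /(@cvgrPdist_le _ _ _ (nbhs z0) FF) := Omega_continuous hhomog hlip z00.
  by apply; rewrite divr_gt0.
move=> /nbhs_ballP[d1 /= d10 hd1].
have : \forall v \near z0, `|enorm z0 - enorm v| <= 2^-1.
  have /(@cvgrPdist_le _ _ _ (nbhs z0) FF) := @continuous_enorm R n z0.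
  by apply; rewrite invr_gt0.
move=> /nbhs_ballP[d2 /= d20 hd2].
pose d := Num.min d1 d2; have d0 : 0 < d by rewrite lt_min d10 d20.
(* Then [v] is within [1 / A = d / 2] of [z0]. *)
pose A := 2 / d; have A0 : 0 < A by rewrite divr_gt0.
have e0 : alpha - n%:R <= 0 by rewrite subr_le0 ltW.
exists A, (o / 2 * (2 * A) `^ (alpha - n%:R)), (2 * o * (A / 2) `^ (alpha - n%:R)).
split => //.
- by apply: mulr_gt0; [exact: divr_gt0|rewrite powR_gt0// mulr_gt0].
- by apply: mulr_gt0; [exact: mulr_gt0|rewrite powR_gt0// divr_gt0].
move=> l w l0 wl; have Al0 : 0 < A * l by rewrite mulr_gt0.
pose v := (A * l)^-1 *: w.
have wE : w = (A * l) *: v by rewrite /v scalerA mulfV ?scale1r// gt_eqF.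
have vz : `|z0 - v| < d.
  have -> : z0 - v = (A * l)^-1 *: ((A * l) *: z0 - w).
    by rewrite scalerBr scalerA mulVf ?scale1r// gt_eqF.
  rewrite normrZ gtr0_norm ?invr_gt0// distrC.
  rewrite mulrC ltr_pdivrMr//; apply: le_lt_trans wl _.
  by rewrite /A mulrA mulrCA mulfV ?gt_eqF// mulr1 ltr_pMl// ltr1n.
have /hd1 Ov : ball z0 d1 v.
  by rewrite -ball_normE/=; apply: lt_le_trans vz _; rewrite ge_min lexx.
have /hd2 ev : ball z0 d2 v.
  by rewrite -ball_normE/=; apply: lt_le_trans vz _; rewrite ge_min lexx orbT.
rewrite sz0 in ev.
have ev1 : 2^-1 <= enorm v.
  by move: ev; rewrite ler_norml => /andP[]; lra.
have ev2 : enorm v <= 2.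
  by move: ev; rewrite ler_norml => /andP[]; lra.
have v0 : v != 0 by rewrite -enorm_gt0; apply: lt_le_trans ev1; rewrite invr_gt0.
have kE : rough_kernel alpha Omega w =
    Omega v * (enorm v `^ (alpha - n%:R) * (A * l) `^ (alpha - n%:R)).
  rewrite /rough_kernel wE Omega_scale// enormZ (gtr0_norm Al0) -powRN opprB.
  by rewrite powRM ?(ltW Al0) ?enorm_ge0// [X in _ * X]mulrC.
have sOv : o / 2 <= Num.sg (Omega z0) * Omega v /\ `|Omega v| <= 2 * o.
  move: Ov; rewrite ler_norml => /andP[] h1 h2; split.
    rewrite /o; have [oz|oz|oz] := ltgtP (Omega z0) 0.
    - rewrite (ltr0_sg oz) mulN1r; move: h1 h2; rewrite /o (ltr0_norm oz); lra.
    - rewrite (gtr0_sg oz) mul1r; move: h1 h2; rewrite /o (gtr0_norm oz); lra.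
    - by rewrite oz eqxx in Oz0.
  rewrite ler_norml; move: h1 h2 o0; rewrite /o.
  by have [oz|oz] := ger0P (Omega z0); lra.
have lE c : 0 <= c -> (c * l) `^ (alpha - n%:R) =
   c `^ (alpha - n%:R) * l `^ (alpha - n%:R) by move=> c0; rewrite powRM// ltW.
set e := alpha - n%:R in e0 kE lE *.
have lo : (2 * A) `^ e * l `^ e <= enorm v `^ e * (A * l) `^ e.
  have A2 : 0 <= 2 * A by rewrite mulr_ge0// ltW.
  rewrite -(lE _ A2) -(powRM _ (enorm_ge0 v) (ltW Al0)).
  apply: powR_antitone => //; first by rewrite mulr_gt0// enorm_gt0.
  have -> : 2 * A * l = 2 * (A * l) by rewrite mulrA.
  by rewrite (ler_pM2r Al0).
have hi : enorm v `^ e * (A * l) `^ e <= (A / 2) `^ e * l `^ e.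
  have A2 : 0 <= A / 2 by rewrite divr_ge0// ltW.
  rewrite -(lE _ A2) -(powRM _ (enorm_ge0 v) (ltW Al0)).
  apply: powR_antitone => //; first by rewrite mulr_gt0// divr_gt0.
  have -> : A / 2 * l = 2^-1 * (A * l) by ring.
  by rewrite (ler_pM2r Al0).
have X0 : 0 <= enorm v `^ e * (A * l) `^ e by rewrite mulr_ge0 ?powR_ge0.
rewrite kE; split.
  rewrite -[leLHS]mulrA [leRHS]mulrA; apply: ler_pM => //.
  - by rewrite divr_ge0// ltW.
  - by rewrite mulr_ge0 ?powR_ge0.
  - exact: sOv.1.
rewrite normrM (ger0_norm X0) -[leRHS]mulrA; apply: ler_pM => //; exact: sOv.2.
Qed.

End kernel_cone.

Section one_sided.
Context {R : realType} {n : nat}.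
Local Notation mu := (@lebesgueRn R n).
Local Notation V := 'rV[R]_n.
Variables (alpha beta t p q r s : R) (Omega b b0 : V -> R).
Hypotheses (n0 : (0 < n)%N) (hbeta : 0 < beta) (alpha0 : 0 < alpha)
  (halphabeta : alpha + beta < n%:R) (t0 : 0 < t)
  (p1 : 1 < p) (pr : p < r) (q1 : 1 < q) (qs : q < s)
  (hexp_pr : (alpha + beta) / n%:R = p^-1 - r^-1)
  (hexp_qs : (alpha + beta) / n%:R = q^-1 - s^-1)
  (hhomog : forall (lambda : R) (x : V),
      0 < lambda -> sphere x -> Omega (lambda *: x) = Omega x)
  (hlip : lipschitz_on_sphere Omega).
Hypotheses (mb0 : measurable_fun setT b0) (bb0 : \forall x \ae mu, b x = b0 x)
  (bint : forall (x : V) rho, (\int[mu]_(y in cube x rho) `|b0 y|%:E < +oo)%E).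

Let alphan : alpha < n%:R.
Proof. by apply: lt_trans halphabeta; rewrite ltrDl. Qed.

Section fixed_cube.
Variables (z0 : V) (A c1 c2 l m tau : R) (x0 : V) (E : set V).
Hypotheses (c10 : 0 < c1) (c20 : 0 < c2) (l0 : 0 < l)
  (taunorm : `|tau| = 1) (Oz0 : Omega z0 != 0).
Hypothesis cone : forall w : V, `|w - (A * l) *: z0| <= l ->
  c1 * l `^ (alpha - n%:R) <= Num.sg (Omega z0) * rough_kernel alpha Omega w /\
  `|rough_kernel alpha Omega w| <= c2 * l `^ (alpha - n%:R).
Hypotheses (mE : measurable E) (El : E `<=` cube (x0 - (A * l) *: z0) l)
  (Ehalf : ((l ^+ n / 2)%:E <= mu E)%E) (Em : forall y, E y -> tau * b0 y <= m).

Let muE : (mu E < +oo)%E.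
Proof.
have : (mu E <= mu (cube (x0 - (A * l) *: z0) l))%E.
  by apply: le_measure; rewrite ?inE//; exact: measurable_cube.
move=> /le_lt_trans; apply; apply: le_lt_trans (ltry (l ^+ n)%R).
by apply: mu_cube_le; exact: ltW.
Qed.

Let mE1 : measurable_fun setT (\1_E : V -> R).
Proof. exact: measurable_indic. Qed.

Lemma indic_slice_space : slice_space t p q (\1_E : V -> R).
Proof.
have p0 : 0 < p := lt_trans ltr01 p1.
have q0 : 0 < q := lt_trans ltr01 q1.
split; last first.
  apply: le_lt_trans (slice_norm_indic_le t0 l0 p0 q0 mE El) _.
  exact: ltry.
split; first by exists \1_E => //; exact: aeW.
move=> K cK; apply: (@le_lt_trans _ _ (\int[mu]_x (\1_E x)%:E)%E); last first.
  by rewrite integral_indic// setIT.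
apply: (@le_trans _ _ (\int[mu]_(x in K) (\1_E x)%:E)%E).
  apply: le_integral_lower => x _; first by rewrite lee_fin powR_ge0.
  rewrite lee_fin indicE; case: (x \in E) => /=; first by rewrite normr1 powR1.
  by rewrite normr0 powR0// gt_eqF.
by apply: ge0_le_integral_subset => // x; rewrite lee_fin.
Qed.

(** The lower bound for the commutator on the cube: [c1 l ^ (alpha - n)] from the kernel times
    [l^n / 2] from the measure of [E]. The sign [tau] selects the part of [b0] above or below the
    level. *)
Definition oscillation (x : V) : R := c1 / 2 * l `^ alpha * (Num.max (tau * b0 x - m) 0 * \1_(cube x0 l) x).

Let cone_E (x y : V) : cube x0 l x -> E y ->
  `|x - y - (A * l) *: z0| <= l.
Proof.
move=> xl /El; move: xl; rewrite !cubeE ?(ltW l0)//= => xl yl.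
have -> : x - y - (A * l) *: z0 = (x - x0) - (y - (x0 - (A * l) *: z0)).
  by apply/rowP => i; rewrite !mxE; ring.
apply: le_trans (ler_normB _ _) _.
by apply: le_trans (lerD xl yl) _; rewrite -splitr.
Qed.

(** On [E] the difference [tau (b0 x - b0 y)] is at least [tau b0 x - m > 0] and the kernel has the
    sign of [Omega z0], so the integral has no cancellation. *)
Lemma commutator_ge (x : V) : b x = b0 x ->
  ((oscillation x)%:E <= `|frac_commutator b Omega alpha \1_E x|)%E.
Proof.
move=> bx; rewrite /oscillation indicE; case: (boolP (x \in cube x0 l)) => [/set_mem xl|_]; last first.
  by rewrite !mulr0 abse_ge0.
rewrite mulr1; have [bm|bm] := leP (tau * b0 x - m) 0.
  by rewrite !mulr0 abse_ge0.
pose k (y : V) := rough_kernel alpha Omega (x - y).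
have mk : measurable_fun setT k by exact: measurable_rough_kernelB hbeta halphabeta hhomog hlip x.
set L := l `^ (alpha - n%:R).
have L0 : 0 <= L by exact: powR_ge0.
have kE y : E y -> `|k y| <= c2 * L by move=> Ey; exact: (cone (cone_E xl Ey)).2.
have i1 : mu.-integrable setT (fun y => (k y * \1_E y)%:E).
  apply/integrableP; split.
    by apply/measurable_EFinP; exact: measurable_funM.
  apply: (@le_lt_trans _ _ (\int[mu]_y ((c2 * L)%:E * (\1_E y)%:E))%E).
    apply: le_integral_lower => y _; first exact: abse_ge0.
    rewrite -EFinM lee_fin normrM indicE; case: (boolP (y \in E)) => [/set_mem Ey|_].
      by rewrite normr1 !mulr1 kE.
    by rewrite normr0 !mulr0.
  rewrite ge0_integralZl; last 4 first.
  - by [].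
  - exact/measurable_EFinP.
  - by move=> y _; rewrite lee_fin.
  - by rewrite lee_fin mulr_ge0// ltW.
  rewrite integral_indic// setIT lte_mul_pinfty// lee_fin mulr_ge0// ltW//.
have i2 : mu.-integrable setT (fun y => (k y * (b0 x - b0 y) * \1_E y)%:E).
  apply/integrableP; split.
    apply/measurable_EFinP; apply: measurable_funM => //.
    by apply: measurable_funM => //; exact: measurable_funB.
  set Q := cube (x0 - (A * l) *: z0) l.
  have mQ : measurable Q by exact: measurable_cube.
  apply: (@le_lt_trans _ _ (\int[mu]_(y in Q)
      ((c2 * L)%:E * (`|b0 x|%:E + `|b0 y|%:E)))%E).
    rewrite [leRHS]integral_mkcond; apply: le_integral_lower => y _; first exact: abse_ge0.
    rewrite patchE indicE; case: (boolP (y \in E)) => [/set_mem Ey|_].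
      rewrite mem_set; last exact: El.
      rewrite mulr1 -EFinD -EFinM lee_fin normrM; apply: ler_pM => //; first exact: kE.
      exact: ler_normB.
    rewrite mulr0 /= normr0; case: ifP => // _.
    by rewrite -EFinM lee_fin mulr_ge0// mulr_ge0// ltW.
  have mab : measurable_fun setT (fun y : V => `|b0 y|%:E).
    by apply/measurable_EFinP; exact: measurableT_comp.
  rewrite ge0_integralZl; last 4 first.
  - exact: mQ.
  - by apply: measurable_funTS; exact: emeasurable_funD.
  - by move=> y _; rewrite adde_ge0 ?lee_fin.
  - by rewrite lee_fin mulr_ge0// ltW.
  rewrite ge0_integralD; last 5 first.
  - exact: mQ.
  - by move=> y _; rewrite lee_fin.
  - by [].
  - by move=> y _; rewrite lee_fin.
  - exact: measurable_funTS.
  rewrite lte_mul_pinfty ?lee_fin ?mulr_ge0 ?(ltW c20)//.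
  rewrite integral_cube_cst ?(ltW l0)//.
  by apply: lte_add_pinfty; [exact: ltry|exact: bint].
rewrite (frac_commutatorE bb0 (aeW _ (fun y => erefl)) bx i1 i2).
(* Multiplying by this unit sign leaves the modulus unchanged and makes the integrand
   nonnegative. *)
pose sg := Num.sg (Omega z0) * tau.
have sg1 : `|sg| = 1 by rewrite normrM taunorm normr_sg Oz0 mulr1.
set J := (\int[mu]_y _)%E.
have -> : (`|J| = `|sg%:E * J|)%E by rewrite abseM /= sg1 mul1e.
rewrite /J -integralZl//; apply: le_trans (lee_abs _).
apply: (@le_trans _ _ (\int[mu]_y ((c1 * L * (tau * b0 x - m))%:E * (\1_E y)%:E))%E).
  rewrite ge0_integralZl; last 4 first.
  - by [].
  - exact/measurable_EFinP.
  - by move=> y _; rewrite lee_fin.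
  - by rewrite lee_fin mulr_ge0 ?(ltW bm)// mulr_ge0// ltW.
  rewrite integral_indic// setIT.
  apply: (@le_trans _ _ ((c1 * L * (tau * b0 x - m))%:E * (l ^+ n / 2)%:E)%E).
    rewrite -EFinM lee_fin le_eqVlt; apply/orP; left; apply/eqP.
    have -> : l `^ alpha = L * l ^+ n.
      by rewrite /L -powR_mulrn ?(ltW l0)// -powRD ?subrK// (gt_eqF l0) implybT.
    by ring.
  apply: lee_wpmul2l => //.
  by rewrite lee_fin mulr_ge0 ?(ltW bm)// mulr_ge0// ltW.
apply: le_integral_lower => y _.
  by rewrite -EFinM lee_fin mulr_ge0// mulr_ge0 ?(ltW bm)// mulr_ge0// ltW.
rewrite -!EFinM lee_fin indicE; case: (boolP (y \in E)) => [/set_mem Ey|_]; last by rewrite !mulr0.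
rewrite !mulr1 /sg.
have [ck _] := cone (cone_E xl Ey).
have -> : Num.sg (Omega z0) * tau * (rough_kernel alpha Omega (x - y) * (b0 x - b0 y)) =
  (Num.sg (Omega z0) * rough_kernel alpha Omega (x - y)) * (tau * b0 x - tau * b0 y) by ring.
apply: ler_pM => //.
- by rewrite mulr_ge0// ltW.
- exact: ltW.
by rewrite lerD2l lerN2 Em.
Qed.

End fixed_cube.

Lemma one_sided_oscillation (z0 : V) : sphere z0 -> Omega z0 != 0 ->
  slice_bounded (frac_commutator b Omega alpha) t p q r s ->
  exists A K : R, [/\ 0 < A, 0 <= K &
    forall (l m tau : R) (x0 : V) (E : set V), 0 < l -> `|tau| = 1 ->
    measurable E -> E `<=` cube (x0 - (A * l) *: z0) l ->
    ((l ^+ n / 2)%:E <= mu E)%E -> (forall y, E y -> tau * b0 y <= m) ->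
    (\int[mu]_(x in cube x0 l) (Num.max (tau * b0 x - m) 0)%:E <=
     (K * l `^ (n%:R + beta))%:E)%E].
Proof.
move=> sz0 Oz0 [D0 hD0].
(* [slice_bounded] does not say that its constant is nonnegative. *)
pose D := Num.max D0 0; have D_ge0 : 0 <= D by rewrite le_max lexx orbT.
have [A [c1 [c2 [A0 c10 c20 cone]]]] := kernel_cone hhomog hlip alphan sz0 Oz0.
have gam0 : 0 < alpha + beta by rewrite addr_gt0.
have r0 : 0 < r := lt_trans (lt_trans ltr01 p1) pr.
have s0 : 0 < s := lt_trans (lt_trans ltr01 q1) qs.
pose K := 2 / c1 * (4 * D * 2 `^ (n%:R + (alpha + beta))).
exists A, K; split => //.
  by rewrite mulr_ge0 ?divr_ge0 ?(ltW c10)// mulr_ge0 ?powR_ge0// mulr_ge0.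
move=> l m tau x0 E l0 tau1 mE El Ehalf Em.
pose G x := (oscillation c1 l m tau x0 x)%:E.
have la0 : 0 < c1 / 2 * l `^ alpha by rewrite mulr_gt0 ?powR_gt0// divr_gt0.
have mx0 x : 0 <= Num.max (tau * b0 x - m) 0 by rewrite le_max lexx orbT.
have G0 x : (0 <= G x)%E by rewrite lee_fin mulr_ge0 ?(ltW la0)// mulr_ge0.
have mmax : measurable_fun setT (fun x => Num.max (tau * b0 x - m) 0).
  by apply: measurable_maxr => //; apply: measurable_funB => //; exact: measurable_funM.
have mG : measurable_fun setT G.
  apply/measurable_EFinP; apply: measurable_funM => //.
  by apply: measurable_funM => //; apply: measurable_indic; exact: measurable_cube.
have Gout x : ~ cube x0 l x -> G x = 0%E.
  by move=> xl; rewrite /G /oscillation indicE memNset ?mulr0.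
have GD : (slice_norm t r s G <= D%:E * slice_norm t p q (EFin \o \1_E))%E.
  apply: (@le_trans _ _ (slice_norm t r s (frac_commutator b Omega alpha \1_E))).
    apply: slice_norm_ae_le => //; have bb := bb0; apply: filterS bb => x bx.
    rewrite [leLHS]gee0_abs//.
    exact: (commutator_ge c10 c20 l0 tau1 Oz0 (fun w => @cone l w l0) mE El Ehalf Em bx).
  apply: le_trans (hD0 _ (indic_slice_space l0 mE El)) _.
  apply: lee_wpmul2r; first exact: slice_norm_ge0.
  by rewrite lee_fin le_max lexx.
have := integral_le_indic_norm t0 l0 n0 gam0 p1 pr q1 qs hexp_pr hexp_qs D_ge0
  G0 mG Gout mE El GD.
have -> : (\int[mu]_x G x = (c1 / 2 * l `^ alpha)%:E *
    \int[mu]_(x in cube x0 l) (Num.max (tau * b0 x - m) 0)%:E)%E.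
  rewrite [in RHS]integral_mkcond -ge0_integralZl; last 4 first.
  - by [].
  - apply/(measurable_restrictT _ _).1; first exact: measurable_cube.
    by apply: measurable_funTS; exact/measurable_EFinP.
  - by move=> x _; apply: erestrict_ge0 => y _; rewrite lee_fin.
  - by rewrite lee_fin ltW.
  apply: eq_integral => x _; rewrite patchE /G /oscillation indicE.
  by case: ifP => _; rewrite ?mulr1 ?mulr0 ?mule0.
rewrite -lee_pdivlMl// => /le_trans; apply.
rewrite -EFinM lee_fin le_eqVlt; apply/orP; left; apply/eqP.
rewrite powRM ?(ltW l0)// /K.
have -> : l `^ (n%:R + (alpha + beta)) = l `^ alpha * l `^ (n%:R + beta).
  by rewrite -powRD ?(gt_eqF l0) ?implybT//; congr powR; ring.
by field; rewrite !gt_eqF ?powR_gt0.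
Qed.

End one_sided.

Section approximate_median.
Context d (T : measurableType d) (R : realType).
Variable mu : {measure set T -> \bar R}.

(* The slack [eta] replaces a limiting argument at the level [m]. *)
Lemma approximate_median (Q : set T) (f : T -> R) (M eta : R) :
  measurable Q -> mu Q = M%:E -> 0 < M -> 0 < eta ->
  measurable_fun setT f -> (\int[mu]_(x in Q) `|f x|%:E < +oo)%E ->
  exists m, ((M / 2)%:E <= mu (Q `&` [set x | (f x <= m + eta)%R]))%E /\
            ((M / 2)%:E <= mu (Q `&` [set x | (m - eta <= f x)%R]))%E.
Proof.
move=> mQ QM M0 eta0 mf fint.
have mle v : measurable (Q `&` [set x | f x <= v]).
  apply: measurableI => //; rewrite -[X in measurable X]setTI.
  rewrite (_ : [set x | _] = f @^-1` `]-oo, v]%classic); first exact: mf.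
  by apply/seteqP; split => x /=; rewrite in_itv.
have mgt v : measurable (Q `&` [set x | v < f x]).
  apply: measurableI => //; rewrite -[X in measurable X]setTI.
  rewrite (_ : [set x | _] = f @^-1` `]v, +oo[%classic); first exact: mf.
  by apply/seteqP; split => x /=; rewrite in_itv/= andbT.
have mge v : measurable (Q `&` [set x | v <= f x]).
  apply: measurableI => //; rewrite -[X in measurable X]setTI.
  rewrite (_ : [set x | _] = f @^-1` `[v, +oo[%classic); first exact: mf.
  by apply/seteqP; split => x /=; rewrite in_itv/= andbT.
have leM (B : set T) : measurable B -> B `<=` Q -> (mu B <= M%:E)%E.
  by move=> mB BQ; rewrite -QM; apply: le_measure; rewrite ?inE.
have split v : exists a c : R, [/\ mu (Q `&` [set x | f x <= v]) = a%:E,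
    mu (Q `&` [set x | v < f x]) = c%:E & a + c = M].
  have fin (B : set T) : measurable B -> B `<=` Q -> mu B = (fine (mu B))%:E.
    move=> mB BQ; rewrite fineK// ge0_fin_numE//.
    exact: le_lt_trans (leM _ mB BQ) (ltry _).
  exists (fine (mu (Q `&` [set x | f x <= v]))), (fine (mu (Q `&` [set x | v < f x]))).
  have h1 := fin _ (mle v) (@subIsetl _ _ _); have h2 := fin _ (mgt v) (@subIsetl _ _ _).
  split => //; apply: EFin_inj; rewrite EFinD -h1 -h2 -QM -measureU//; last first.
    by apply/seteqP; split => x //= [[_ a1] [_ a2]]; move: (lt_le_trans a2 a1); rewrite ltxx.
  congr (mu _); rewrite -setIUr; apply/setIidPl => x _ /=.
  by case: (leP (f x) v) => ?; [left|right].
pose I := fine (\int[mu]_(x in Q) `|f x|%:E)%E.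
have I0 : 0 <= I by apply/fine_ge0/integral_ge0 => x _; rewrite lee_fin.
have IE : (\int[mu]_(x in Q) `|f x|%:E)%E = I%:E.
  by rewrite fineK// ge0_fin_numE// integral_ge0// => x _; rewrite lee_fin.
(* Chosen so that [v0 M / 2 = I + M / 2]; Chebyshev's inequality then gives the set where
   [|f| >= v0] measure strictly below [M / 2]. *)
pose v0 := 2 * I / M + 1.
have v00 : 0 < v0 by rewrite ltr_wpDl// divr_ge0 ?mulr_ge0// ltW.
have small (B : set T) : measurable B -> B `<=` Q `&` [set x | v0 <= `|f x|] ->
    (mu B < (M / 2)%:E)%E.
  move=> mB BQ.
  have : (v0%:E * mu B <= I%:E)%E.
    rewrite -IE -[B]setIid -integral_indic// -ge0_integralZl; last 4 first.
    - by [].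
    - by apply: measurable_funTS; apply/measurable_EFinP; exact: measurable_indic.
    - by move=> x _; rewrite lee_fin.
    - by rewrite lee_fin ltW.
    apply: (@le_trans _ _ (\int[mu]_(x in B) `|f x|%:E)%E).
      apply: le_integral_lower => x Bx; first by rewrite mule_ge0 ?lee_fin ?(ltW v00).
      by rewrite indicE mem_set// mule1 lee_fin; have [] := BQ _ Bx.
    apply: ge0_le_integral_subset => [x|x /BQ[]//]; by rewrite lee_fin.
  rewrite -lee_pdivlMl// => /le_lt_trans; apply.
  rewrite -EFinM lte_fin mulrC ltr_pdivrMr//.
  rewrite (_ : M / 2 * v0 = I + M / 2) ?ltrDl ?divr_gt0//.
  by rewrite /v0; field; rewrite gt_eqF.
(* The median is [sup S]: [m + eta] is outside [S], which gives the first inequality, and some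
   element of [S] above [m - eta] gives the second. *)
pose S := [set v : R | (mu (Q `&` [set x | (f x <= v)%R]) <= (M / 2)%:E)%E].
have SN : S (- v0).
  rewrite /S/=; apply/ltW/small => // x [Qx /= fx]; split => //=.
  by rewrite -normrN; apply: le_trans (ler_norm _); rewrite lerNr.
have Sub v : S v -> v <= v0.
  move=> Sv; rewrite leNgt; apply/negP => vv.
  have [a [c [a1 c1 acM]]] := split v.
  have : (mu (Q `&` [set x | (v < f x)%R]) < (M / 2)%:E)%E.
    apply: small => // x [Qx /= fx]; split => //=.
    by rewrite (le_trans (ltW vv))// (le_trans (ltW fx))// ler_norm.
  by move: Sv; rewrite /S/= a1 c1 lee_fin lte_fin; lra.
have hS : has_sup S by split; [exists (- v0)|exists v0].
exists (sup S); split.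
  rewrite leNgt; apply/negP => /ltW h.
  have := sup_upper_bound hS h.
  by rewrite gerDl leNgt eta0.
have [v Sv mv] := sup_adherent eta0 hS.
apply: (@le_trans _ _ (mu (Q `&` [set x | (v < f x)%R]))); last first.
  apply: le_measure; rewrite ?inE// => x [Qx /= vx]; split => //=.
  exact: le_trans (ltW mv) (ltW vx).
have [a [c [a1 c1 acM]]] := split v.
by move: Sv; rewrite /S/= a1 c1 !lee_fin; lra.
Qed.

End approximate_median.

(** * Campanato's characterization of Hoelder continuity *)

Section campanato.
Context {R : realType} {n : nat}.
Local Notation mu := (@lebesgueRn R n).
Local Notation V := 'rV[R]_n.
Variables (beta C0 : R) (b0 : V -> R) (m : V -> R -> R).
Hypotheses (beta0 : 0 < beta) (C00 : 0 < C0) (mb0 : measurable_fun setT b0).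
Hypothesis osc : forall x l, 0 < l ->
  (\int[mu]_(y in cube x l) `|b0 y - m x l|%:E <= (C0 * l `^ (n%:R + beta))%:E)%E.

Let K1 := 2 * 2 ^+ n * C0.
Let K2 := K1 / (1 - 2 `^ (- beta)).
Let x1 : 2 `^ (- beta) < 1. Proof. by have /andP[] := powR2_lt1 beta0. Qed.
Let K10 : 0 < K1. Proof. by rewrite !mulr_gt0// exprn_gt0. Qed.
Let K20 : 0 < K2. Proof. by rewrite divr_gt0// subr_gt0. Qed.
Let K12 : K1 <= K2.
Proof.
by rewrite ler_pdivlMr ?subr_gt0// ler_piMr ?(ltW K10)// gerBl powR_ge0.
Qed.

Let powD (l e : R) : 0 < l -> l `^ (n%:R + e) = l ^+ n * l `^ e.
Proof.
by move=> l0; rewrite powRD ?powR_mulrn ?(ltW l0)// (gt_eqF l0) implybT.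
Qed.

Let mosc (c : R) : measurable_fun setT (fun y : V => `|b0 y - c|%:E).
Proof.
by apply/measurable_EFinP; apply: measurableT_comp => //; exact: measurable_funB.
Qed.

(** Integrating over the smaller cube bounds [l^n |m x l - m y l'|] by two oscillations, each at
    most [C0 l' ^ (n + beta)]. Since [l'^n <= 2^n l^n], the constant is [K1 = 2 2^n C0]. *)
Let compare (x y : V) (l l' : R) : 0 < l -> l <= l' -> l' <= 2 * l ->
  cube x l `<=` cube y l' -> `|m x l - m y l'| <= K1 * l' `^ beta.
Proof.
move=> l0 ll' l'l sub; have l'0 : 0 < l' := lt_le_trans l0 ll'.
have : (`|m x l - m y l'|%:E * (l ^+ n)%:E <=
    (C0 * l' `^ (n%:R + beta))%:E + (C0 * l' `^ (n%:R + beta))%:E)%E.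
  rewrite -(integral_cube_cst x) ?(ltW l0)//.
  apply: (@le_trans _ _ (\int[mu]_(z in cube x l) (`|b0 z - m x l|%:E + `|b0 z - m y l'|%:E))%E).
    apply: le_integral_lower => z _; first by rewrite lee_fin.
    by rewrite -EFinD lee_fin (distrC (b0 z)) -(subrKA (b0 z)) ler_normD.
  rewrite ge0_integralD; last 5 first.
  - exact: measurable_cube.
  - by move=> z _; rewrite lee_fin.
  - by apply: measurable_funTS; exact: mosc.
  - by move=> z _; rewrite lee_fin.
  - by apply: measurable_funTS; exact: mosc.
  apply: leeD.
    apply: le_trans (osc _ l0) _; rewrite lee_fin ler_wpM2l ?(ltW C00)//.
    by apply: ge0_ler_powR; rewrite ?nnegrE ?(ltW l0) ?(ltW l'0)// addr_ge0// ltW.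
  by apply: le_trans (osc _ l'0); apply: ge0_le_integral_subset.
rewrite -EFinM -EFinD lee_fin powD// => h.
have ln0 : 0 < l ^+ n by rewrite exprn_gt0.
rewrite -(ler_pM2r ln0); apply: le_trans h _.
have : l' ^+ n <= 2 ^+ n * l ^+ n.
  by rewrite -exprMn; apply: lerXn2r; rewrite ?nnegrE ?mulr_ge0 ?(ltW l0) ?(ltW l'0).
have := powR_ge0 l' beta; set u := l' `^ beta => u0 h.
rewrite -mulr2n -mulr_natl /K1.
have -> : 2 * 2 ^+ n * C0 * u * l ^+ n = 2 * (C0 * ((2 ^+ n * l ^+ n) * u)) by ring.
rewrite ler_pM2l// ler_pM2l//; exact: ler_wpM2r.
Qed.

Let telescope k (x : V) (l l' : R) : 0 < l -> l <= l' -> l' <= 2 ^+ k * l ->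
  `|m x l - m x l'| <= K2 * l' `^ beta.
Proof.
elim: k l' => [|k IH] l' l0 ll' l'l.
  have -> : l' = l by apply/eqP; rewrite eq_le ll' andbT; move: l'l; rewrite expr0 mul1r.
  by rewrite subrr normr0 mulr_ge0 ?powR_ge0// ltW.
have l'0 : 0 < l' := lt_le_trans l0 ll'.
have [l2|l2] := leP l' (2 * l).
  apply: (@le_trans _ _ (K1 * l' `^ beta)); last by rewrite ler_wpM2r ?powR_ge0.
  apply: compare => // z; rewrite !cubeE ?(ltW l0) ?(ltW l'0)//= => /le_trans; apply.
  by rewrite ler_pM2r.
have lh : l <= l' / 2 by rewrite ler_pdivlMr// mulrC ltW.
have h0 : 0 < l' / 2 by rewrite divr_gt0.
rewrite -(subrKA (m x (l' / 2))); apply: le_trans (ler_normD _ _) _.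
apply: (@le_trans _ _ (K2 * (l' / 2) `^ beta + K1 * l' `^ beta)).
  apply: lerD.
    by apply: IH => //; rewrite ler_pdivrMr// mulrC mulrA -exprS.
  apply: compare => //; [lra|lra|].
  move=> z; rewrite !cubeE ?(ltW h0) ?(ltW l'0)//= => /le_trans; apply.
  by rewrite ler_pM2r//; lra.
have := @powR_dyadicV _ l' beta 1 (ltW l'0); rewrite !expr1 => ->.
rewrite [X in K2 * X]mulrC mulrA -mulrDl ler_wpM2r ?powR_ge0//.
(* [K2] is the fixed point of the recursion: [K2 2 ^ (- beta) + K1 = K2]. *)
rewrite /K2 le_eqVlt; apply/orP; left; apply/eqP; field.
by rewrite subr_eq0 eq_sym lt_eqF.
Qed.

(** Each lower estimate at one scale is below each upper estimate at another. This keeps the infimum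
    in [b'] finite and within [K2 l ^ beta] of [m x l]. *)
Let close (x : V) (l l' : R) : 0 < l -> 0 < l' ->
  m x l - K2 * l `^ beta <= m x l' + K2 * l' `^ beta.
Proof.
have main a c : 0 < a -> a <= c -> `|m x a - m x c| <= K2 * a `^ beta + K2 * c `^ beta.
  move=> a0 ac; have [k kc] : exists k : nat, c / a < k%:R.
    by exists (Num.trunc (c / a)).+1; exact: truncnS_gt.
  apply: (@le_trans _ _ (K2 * c `^ beta)).
    apply: (telescope (k := k)) => //; rewrite -ler_pdivrMr//.
    by rewrite (le_trans (ltW kc))// -natrX ler_nat ltnW// ltn_expl.
  by rewrite lerDr mulr_ge0 ?powR_ge0// ltW.
move=> l0 l'0; have [ll'|l'l] := leP l l'.
  by have := main l l' l0 ll'; rewrite ler_norml; lra.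
by have := main l' l l'0 (ltW l'l); rewrite ler_norml; lra.
Qed.

(* Stands for the limit of [m x l] as [l] tends to [0], which [close] allows to
   write as an infimum. *)
Let b' (x : V) := inf [set m x l + K2 * l `^ beta | l in [set l : R | 0 < l]].

Let b'_close (x : V) (l : R) : 0 < l -> `|b' x - m x l| <= K2 * l `^ beta.
Proof.
move=> l0; pose S := [set m x l + K2 * l `^ beta | l in [set l : R | 0 < l]].
rewrite /b' -/S.
have Sl l' : 0 < l' -> lbound S (m x l' - K2 * l' `^ beta).
  by move=> l'0 _ [a a0 <-]; exact: close.
have Sne : S !=set0 by exists (m x l + K2 * l `^ beta); exists l.
rewrite ler_distl; apply/andP; split.
  by apply: lb_le_inf => //; exact: Sl.
apply: ge_inf; first by exists (m x l - K2 * l `^ beta); exact: Sl.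
by exists l.
Qed.

(** With [d = |x - y|], the path is [b' x], [m x (2 d)], [m y (4 d)], [b' y]; the middle step is
    [compare], as the cube of side [2 d] at [x] lies in that of side [4 d] at [y]. *)
Let K3 := K2 * 2 `^ beta + (K1 + K2) * 4 `^ beta.
Let K30 : 0 < K3.
Proof.
by apply: addr_gt0; apply: mulr_gt0 => //; rewrite ?powR_gt0//; exact: addr_gt0.
Qed.

Let b'_holder (x y : V) : `|b' x - b' y| <= K3 * `|x - y| `^ beta.
Proof.
have [->|xy] := eqVneq x y; first by rewrite subrr normr0 mulr_ge0 ?powR_ge0// ltW.
set d := `|x - y|; have d0 : 0 < d by rewrite normr_gt0 subr_eq0.
have l0 : 0 < 2 * d by rewrite mulr_gt0.
have l20 : 0 < 4 * d by rewrite mulr_gt0.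
have h1 := b'_close x l0; have h2 := b'_close y l20.
have h3 : `|m x (2 * d) - m y (4 * d)| <= K1 * (4 * d) `^ beta.
  apply: compare => //; [lra|lra|].
  move=> z; rewrite !cubeE ?(ltW l0) ?(ltW l20)//= => zx.
  have -> : z - y = (z - x) + (x - y) by rewrite subrKA.
  by apply: le_trans (ler_normD _ _) _; rewrite -/d; lra.
rewrite !powRM ?(ltW d0)// in h1 h2 h3.
move: h1 h2 h3; rewrite /K3 !ler_norml.
set u := d `^ beta; set w2 := 2 `^ beta; set w4 := 4 `^ beta.
move=> /andP[a1 a2] /andP[a3 a4] /andP[a5 a6].
apply/andP; split; nra.
Qed.

(** That [b'] represents [b0] is shown without Lebesgue differentiation. The integral of [|b0 - b'|]
    over a cube of side [e] is [O(e ^ (n + beta))]; integrating over the centres and dividing by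
    [e^n] leaves [O(e ^ beta)] on a fixed cube. *)
Lemma campanato_holder : in_Lip beta b0.
Proof.
have mb' : measurable_fun setT b'.
  apply: continuous_measurable_rV.
  apply: (@holder_continuous _ _ K3 beta) => // x y.
  apply: le_trans (b'_holder x y) _; rewrite ler_pM2l//.
  by apply: ge0_ler_powR; rewrite ?nnegrE ?enorm_ge0 ?(ltW beta0)// norm_le_enorm.
exists b'; last first.
  exists K3 => // x y; apply: le_trans (b'_holder x y) _; rewrite ler_pM2l//.
  by apply: ge0_ler_powR; rewrite ?nnegrE ?enorm_ge0 ?(ltW beta0)// norm_le_enorm.
pose h (y : V) := `|b0 y - b' y|%:E.
have h0 y : (0 <= h y)%E by rewrite lee_fin.
have mh : measurable_fun setT h.
  by apply/measurable_EFinP; apply: measurableT_comp => //; exact: measurable_funB.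
pose K4 := C0 + K2 + K3.
have K40 : 0 < K4 by apply: addr_gt0 => //; exact: addr_gt0.
have local (z : V) (e : R) : 0 < e ->
    (\int[mu]_(y in cube z e) h y <= (K4 * (e ^+ n * e `^ beta))%:E)%E.
  move=> e0; have e0' := ltW e0.
  apply: (@le_trans _ _ (\int[mu]_(y in cube z e) (`|b0 y - m z e|%:E + ((K2 + K3) * e `^ beta)%:E))%E).
    apply: le_integral_lower => y zy; first exact: h0.
    rewrite -EFinD lee_fin.
    have a1 := b'_close z e0; have a2 := b'_holder z y.
    have a3 : `|z - y| `^ beta <= e `^ beta.
      apply: ge0_ler_powR; rewrite ?nnegrE ?(ltW beta0)//.
      by move: zy; rewrite cubeE//= distrC => /le_trans; apply; rewrite ler_pdivrMr// ler_peMr ?ler1n.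
    have a4 : K3 * `|z - y| `^ beta <= K3 * e `^ beta by rewrite ler_pM2l.
    have -> : b0 y - b' y = (b0 y - m z e) + ((m z e - b' z) + (b' z - b' y)) by ring.
    apply: le_trans (ler_normD _ _) _; rewrite lerD2l.
    apply: le_trans (ler_normD _ _) _; rewrite mulrDl; apply: lerD.
      by rewrite distrC.
    exact: le_trans a2 a4.
  rewrite ge0_integralD; last 5 first.
  - exact: measurable_cube.
  - by move=> y _; rewrite lee_fin.
  - by apply: measurable_funTS; exact: mosc.
  - by move=> y _; rewrite lee_fin mulr_ge0 ?powR_ge0// addr_ge0// ltW.
  - exact: measurable_cst.
  rewrite integral_cube_cst//.
  apply: le_trans (leeD (osc z e0) (lexx _)) _.
  rewrite -EFinM -EFinD lee_fin powD// le_eqVlt; apply/orP; left; apply/eqP.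
  by rewrite /K4; ring.
have zero (N : nat) : (\int[mu]_(y in cube 0 N%:R) h y = 0)%E.
  apply/eqP; rewrite eq_le integral_ge0// andbT.
  apply/lee_addgt0Pr => eps eps0; rewrite add0e.
  pose c := K4 * (N%:R + 1) ^+ n.
  have c0 : 0 < c by rewrite mulr_gt0// exprn_gt0// ltr_wpDl.
  (* The bound [e <= 1] keeps all relevant centres in the cube of side [N + 1]; the other bound
     makes [c e ^ beta] at most [eps]. *)
  pose e := Num.min 1 ((eps / c) `^ beta^-1).
  have e0 : 0 < e by rewrite lt_min ltr01 powR_gt0// divr_gt0.
  have e1 : e <= 1 by rewrite ge_min lexx.
  have ebeta : e `^ beta <= eps / c.
    rewrite -[leRHS](@powR_powRVK _ beta) ?gt_eqF ?divr_ge0 ?(ltW eps0) ?(ltW c0)//.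
    by apply: ge0_ler_powR; rewrite ?nnegrE ?powR_ge0 ?(ltW beta0) ?(ltW e0)// ge_min lexx orbT.
  have en0 : 0 < e ^+ n by rewrite exprn_gt0.
  have mhN : measurable_fun setT (h \_ (cube 0 N%:R)).
    apply/(measurable_restrictT _ _).1; first exact: measurable_cube.
    exact: measurable_funTS.
  have hN0 y : (0 <= (h \_ (cube 0 N%:R)) y)%E by apply: erestrict_ge0.
  have : ((e ^+ n)%:E * \int[mu]_(y in cube 0 N%:R) h y <=
      (K4 * (e ^+ n * e `^ beta))%:E * ((N%:R + 1) ^+ n)%:E)%E.
    rewrite integral_mkcond -integral_cube_integral ?(ltW e0)//.
    have N10 : 0 <= N%:R + 1 :> R by rewrite addr_ge0.
    rewrite -(integral_cube_cst 0)// [leRHS]integral_mkcond.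
    apply: le_integral_lower => z _; first exact: integral_ge0.
    rewrite patchE; case: ifPn => zN.
      apply: le_trans (local z e e0).
      apply: le_integral_lower => y _; first exact: hN0.
      by rewrite patchE; case: ifP.
    rewrite integral0_eq// => y zy; rewrite patchE; case: ifPn => // /set_mem yN.
    exfalso; move/negP: zN; apply; apply/mem_set.
    move: zy yN; rewrite !cubeE ?(ltW e0)//= !subr0 => zy yN.
    rewrite -(subKr y z); apply: le_trans (ler_normB _ _) _.
    by apply: le_trans (lerD yN zy) _; move: e1; lra.
  rewrite -lee_pdivlMl// => /le_trans; apply.
  rewrite -!EFinM lee_fin.
  have -> : (e ^+ n)^-1 * (K4 * (e ^+ n * e `^ beta) * (N%:R + 1) ^+ n) = c * e `^ beta.
    by rewrite /c; field; rewrite gt_eqF.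
  by rewrite mulrC -ler_pdivlMr.
have aeN (N : nat) : {ae mu, forall y, cube 0 N%:R y -> h y = 0%E}.
  have := ae_eq_integral_abs mu (measurable_cube 0 N%:R) (measurable_funTS (D := cube 0 N%:R) mh).
  move=> [+ _]; apply.
  by rewrite -[RHS](zero N); apply: eq_integral => y _; rewrite gee0_abs.
have : {ae mu, forall y N, cube 0 N%:R y -> h y = 0%E} by exact: ae_foralln.
apply: filterS => y hy.
have [N yN] : exists N : nat, 2 * `|y| < N%:R.
  by exists (Num.trunc (2 * `|y|)).+1; exact: truncnS_gt.
have yN2 : `|y| <= N%:R / 2 by rewrite ler_pdivlMr// mulrC ltW.
have := hy N; rewrite cubeE//= subr0 => /(_ yN2)[] /eqP.
by rewrite normr_eq0 subr_eq0 => /eqP.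
Qed.

End campanato.

Section necessity.
Context {R : realType} {n : nat}.
Local Notation mu := (@lebesgueRn R n).
Local Notation V := 'rV[R]_n.
Variables (alpha beta t p q r s : R) (Omega b : V -> R).
Hypotheses (n0 : (0 < n)%N) (hbeta : 0 < beta) (alpha0 : 0 < alpha)
  (halphabeta : alpha + beta < n%:R) (t0 : 0 < t)
  (p1 : 1 < p) (pr : p < r) (q1 : 1 < q) (qs : q < s)
  (hexp_pr : (alpha + beta) / n%:R = p^-1 - r^-1)
  (hexp_qs : (alpha + beta) / n%:R = q^-1 - s^-1)
  (hhomog : forall (lambda : R) (x : V),
      0 < lambda -> sphere x -> Omega (lambda *: x) = Omega x)
  (hlip : lipschitz_on_sphere Omega)
  (hb : loc_integrable b).

Lemma in_Lip_of_slice_bounded (z0 : V) : sphere z0 -> Omega z0 != 0 ->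
  slice_bounded (frac_commutator b Omega alpha) t p q r s -> in_Lip beta b.
Proof.
move=> sz0 Oz0 bounded; have [[b0 mb0 bb0] bloc] := hb.
have bint (x : V) (rho : R) : (\int[mu]_(y in cube x rho) `|b0 y|%:E < +oo)%E.
  have -> : (\int[mu]_(y in cube x rho) `|b0 y|%:E =
      \int[mu]_(y in cube x rho) `|b y|%:E)%E.
    by apply: ae_eq_integral_lower_in; have bb := bb0; apply: filterS bb => y ->.
  exact: (bloc _ (@compact_cube R n x rho)).
have [A [K [A0 K0 one]]] := one_sided_oscillation n0 hbeta alpha0 halphabeta t0
  p1 pr q1 qs hexp_pr hexp_qs hhomog hlip mb0 bb0 bint sz0 Oz0 bounded.
have C00 : 0 < 1 + K + K by rewrite -addrA ltr_wpDr// addr_ge0.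
have osc (xl : V * R) : exists m : R, 0 < xl.2 ->
    (\int[mu]_(y in cube xl.1 xl.2) `|b0 y - m|%:E <=
     ((1 + K + K) * xl.2 `^ (n%:R + beta))%:E)%E.
  case: xl => x l /=; have [l0|l0] := ltP 0 l; last by exists 0.
  have lb0 : 0 < l `^ beta by rewrite powR_gt0.
  have ln0 : 0 < l ^+ n by rewrite exprn_gt0.
  set Q := cube (x - (A * l) *: z0) l.
  have mQ : measurable Q by exact: measurable_cube.
  have Qn : mu Q = (l ^+ n)%:E by rewrite mu_cube// ltW.
  (* The slack [l ^ beta] in the median adds only [l ^ (n + beta)] to the oscillation: this is the 1
     in [1 + K + K]. *)
  have [m [m1 m2]] := approximate_median mQ Qn ln0 lb0 mb0 (bint _ _).
  exists m => _.
  have mE1 : measurable (Q `&` [set y | b0 y <= m + l `^ beta]).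
    apply: measurableI => //; rewrite -[X in measurable X]setTI.
    rewrite (_ : [set y | _] = b0 @^-1` `]-oo, m + l `^ beta]%classic); first exact: mb0.
    by apply/seteqP; split => y /=; rewrite in_itv.
  have mE2 : measurable (Q `&` [set y | m - l `^ beta <= b0 y]).
    apply: measurableI => //; rewrite -[X in measurable X]setTI.
    rewrite (_ : [set y | _] = b0 @^-1` `[m - l `^ beta, +oo[%classic); first exact: mb0.
    by apply/seteqP; split => y /=; rewrite in_itv/= andbT.
  have o1 : (\int[mu]_(y in cube x l) (Num.max (1 * b0 y - (m + l `^ beta)) 0)%:E <=
      (K * l `^ (n%:R + beta))%:E)%E.
    apply: (one _ _ _ _ _ l0 _ mE1) => //; first by rewrite normr1.
    by move=> y [_ /=]; rewrite mul1r.
  (* The lower half uses [tau = -1], so the level [m - l ^ beta] changes sign as well. *)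
  have o2 : (\int[mu]_(y in cube x l) (Num.max (-1 * b0 y - (- (m - l `^ beta))) 0)%:E <=
      (K * l `^ (n%:R + beta))%:E)%E.
    apply: (one _ _ _ _ _ l0 _ mE2) => //; first by rewrite normrN1.
    by move=> y [_ /=]; rewrite mulN1r lerN2.
  have mmax (c d : R) : measurable_fun setT (fun y : V => (Num.max (c * b0 y - d) 0)%:E).
    apply/measurable_EFinP; apply: measurable_maxr => //.
    by apply: measurable_funB => //; exact: measurable_funM.
  have max0 (c d : R) (y : V) : (0 <= (Num.max (c * b0 y - d) 0)%:E)%E.
    by rewrite lee_fin le_max lexx orbT.
  apply: (@le_trans _ _ (\int[mu]_(y in cube x l)
     ((l `^ beta)%:E + ((Num.max (1 * b0 y - (m + l `^ beta)) 0)%:E +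
      (Num.max (-1 * b0 y - (- (m - l `^ beta))) 0)%:E)))%E).
    apply: le_integral_lower => y _; first by rewrite lee_fin.
    rewrite -!EFinD lee_fin ler_norml.
    have h1 : 1 * b0 y - (m + l `^ beta) <= Num.max (1 * b0 y - (m + l `^ beta)) 0.
      by rewrite le_max lexx.
    have h2 : -1 * b0 y - (- (m - l `^ beta)) <= Num.max (-1 * b0 y - (- (m - l `^ beta))) 0.
      by rewrite le_max lexx.
    have := max0 1 (m + l `^ beta) y; have := max0 (-1) (- (m - l `^ beta)) y.
    rewrite !lee_fin; move: h1 h2.
    set u := Num.max _ _; set w := Num.max _ _ => h1 h2 w0 u0.
    by apply/andP; split; lra.
  rewrite ge0_integralD; last 5 first.
  - exact: measurable_cube.
  - by move=> y _; rewrite lee_fin ltW.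
  - exact: measurable_cst.
  - by move=> y _; exact: adde_ge0.
  - by apply: measurable_funTS; exact: emeasurable_funD.
  rewrite integral_cube_cst ?(ltW l0)// ge0_integralD; last 5 first.
  - exact: measurable_cube.
  - by move=> y _; exact: max0.
  - exact: measurable_funTS.
  - by move=> y _; exact: max0.
  - exact: measurable_funTS.
  apply: (le_trans (leeD (lexx _) (leeD o1 o2))).
  rewrite -EFinM -!EFinD lee_fin !mulrDl mul1r addrA lerD2r lerD2r.
  by rewrite powRD ?powR_mulrn ?(ltW l0)// ?(gt_eqF l0) ?implybT// mulrC.
have [m hm] := boolp.choice osc.
have [b' b0b' hb'] : in_Lip beta b0.
  apply: (@campanato_holder _ _ beta (1 + K + K) b0 (fun x l => m (x, l))) => //.
  by move=> x l; exact: (hm (x, l)).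
exists b' => //; have bb := bb0.
by apply: filterS2 bb b0b' => y -> ->.
Qed.

End necessity.

Theorem theorem1p5 (R : realType) (n : nat) (alpha beta t p q r s : R)
    (Omega b : 'rV[R]_n -> R)
    (hbeta : 0 < beta < 1) (halpha : 0 < alpha < n%:R)
    (halphabeta : alpha + beta < n%:R) (ht : 0 < t)
    (hp : 1 < p) (hpr : p < r) (hq : 1 < q) (hqs : q < s)
    (hexp_pr : (alpha + beta) / n%:R = p^-1 - r^-1)
    (hexp_qs : (alpha + beta) / n%:R = q^-1 - s^-1)
    (hhomog : forall (lambda : R) (x : 'rV[R]_n),
      0 < lambda -> sphere x -> Omega (lambda *: x) = Omega x)
    (hcancel : (\int[sphere_measure]_(x in sphere) (Omega x)%:E = 0)%E)
    (hb : loc_integrable b) :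
  (lipschitz_on_sphere Omega ->
     in_Lip beta b ->
     slice_bounded (frac_commutator b Omega alpha) t p q r s) /\
  (lipschitz_on_sphere Omega ->
     (exists U : set 'rV[R]_n, [/\ open U, U !=set0 & smooth_on U Omega]) ->
     (exists2 x : 'rV[R]_n, sphere x & Omega x != 0) ->
     slice_bounded (frac_commutator b Omega alpha) t p q r s ->
     in_Lip beta b).
Proof.
have [beta0 _] := andP hbeta; have [alpha0 alphan] := andP halpha.
have n0 : (0 < n)%N by rewrite -(ltr_nat R); exact: lt_trans alphan.
split=> [hlip|hlip _ [z0 sz0 Oz0]].
  exact: slice_bounded_of_in_Lip.
exact: in_Lip_of_slice_bounded sz0 Oz0.
Qed.
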